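(* Let $(X_t)_{t\in\mathbb Z}$ be a stationary Markov chain and let $k\ge2$. Assume that the chain is reversible, that $I-K^2$ is invertible on $L^2_0(\nu)$, and that the Green--Kubo series defining $B_k$ converges on all of $\mathcal H_k$. Then $$\mathcal H_k=\mathcal M_k^+\oplus S_{2,k}\oplus\cdots\oplus S_{k,k}\oplus\ker B_k$$ (orthogonal direct sum). Consequently, every $f\in\mathcal H_k$ has a unique decomposition $$f=f_{\mathrm{marg}}+\sum_{m=2}^kf^{[m]}+f_0,$$ where $f_{\mathrm{marg}}\in\mathcal M_k^+$, $f^{[m]}\in S_{m,k}$ for $2\le m\le k$, and $f_0\in\ker B_k$.
   Context: $(X_t)_{t\in\mathbb Z}$ is a stationary Markov chain on a measurable space $(E,\mathcal E)$ with invariant distribution $\nu$ and transition kernel $K$. The kernel acts on $L^2(\nu)$ by $(Kh)(x)=\int_E h(y)\,K(x,dy)$ and maps $L^2_0(\nu)=\{h\in L^2(\nu):\int h\,d\nu=0\}$ into itself; reversibility means $K$ is self-adjoint. For $n\ge1$, $\pi_n$ is the law of $(X_1,\ldots,X_n)$, i.e. $\pi_n(dx_1,\ldots,dx_n)=\nu(dx_1)K(x_1,dx_2)\cdots K(x_{n-1},dx_n)$, and $\mathcal H_n=L^2_0(\pi_n)$ is the Hilbert space of real-valued $f\in L^2(\pi_n)$ with $\int f\,d\pi_n=0$, identified with the random variables $f(X_1,\ldots,X_n)$. The transition operator of the $k$-window chain $(X_t,\ldots,X_{t+k-1})$ acts on $\mathcal H_k$ by $$(P_kf)(x_1,\ldots,x_k)=\int_E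 f(x_2,\ldots,x_k,z)\,K(x_k,dz),$$ and $P_k^*$ is its Hilbert-space adjoint. The Green--Kubo covariance operator is $B_k=I+\sum_{r\ge1}P_k^r+\sum_{r\ge1}(P_k^* )^r$. Incremental space at block length $m\ge2$: $\mathcal I_m=(W_{m-1}^L+W_{m-1}^R)^\perp\subset\mathcal H_m$, where $W_{m-1}^L$ (resp. $W_{m-1}^R$) is the subspace of $\mathcal H_m$ of centered square-integrable functions of $(X_1,\ldots,X_{m-1})$ (resp. of $(X_2,\ldots,X_m)$). For $2\le m\le k$, $$S_{m,k}=\Big\{\sum_{i=1}^{k-m+1}h(x_i,\ldots,x_{i+m-1}):h\in\mathcal I_m\Big\}\subset\mathcal H_k.$$ The one-coordinate marginal space is $\mathcal M_k=\overline{\{a_1(X_1)+\cdots+a_k(X_k):a_i\in L^2_0(\nu)\}}\subset\mathcal H_k$. It is decomposed orthogonally as $\mathcal M_k=\mathcal M_k^+\oplus(\mathcal M_k\cap\ker B_k)$, where $\mathcal M_k^+$ is the nonzero spectral part of $\mathcal M_k$ for $B_k$; that is, $\mathcal M_k^+$ is the orthogonal complement of $\mathcal M_k\cap\ker B_k$ in $\mathcal M_k$. *)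

(* Defs.v *)
From HB Require Import structures.
From mathcomp Require Import all_boot all_order all_algebra.
From mathcomp Require Import all_classical all_reals all_analysis.

Unset Implicit Arguments.
Unset Printing Implicit Defensive.
Import Order.TTheory GRing.Theory Num.Theory.
Import numFieldNormedType.Exports.
Local Open Scope classical_set_scope.
Local Open Scope ring_scope.

(* An element of L^2(mu) is represented by a measurable function T -> R with
   finite L^2-norm, and equality in L^2(mu) is equality mu-almost everywhere.
   The sets of functions below that stand for subspaces of L^2_0(mu) are
   therefore closed under mu-a.e. equality of members of L^2_0(mu). *)

Section L2.
Context {d} {T : measurableType d} {R : realType}.
Context (mu : {measure set T -> \bar R}).
Implicit Types (f g : T -> R) (U V : set (T -> R)).

Definition L2 : set (T -> R) := [set f | f \in Lfun mu 2%:E].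

Definition L20 : set (T -> R) := [set f | L2 f /\ \int[mu]_x f x = 0].

Definition inner f g : R := \int[mu]_x (f x * g x).

Definition L2norm f : \bar R := 'N[mu]_2%:E[EFin \o f].

Definition L2cvg (u : nat -> T -> R) f : Prop :=
  L2norm (u n \- f) @[n --> \oo] --> 0%E.

Definition self_adjoint V (A : (T -> R) -> (T -> R)) : Prop :=
  forall f g, V f -> V g -> inner (A f) g = inner f (A g).

(* Two-sided bounded inverse of the linear operator A on V.  Boundedness makes
   S compatible with a.e. equality, and S is then automatically linear. *)
Definition invertible_on V (A : (T -> R) -> (T -> R)) : Prop :=
  exists (S : (T -> R) -> (T -> R)) (C : R),
    forall f, V f ->
      [/\ V (S f), (L2norm (S f) <= C%:E * L2norm f)%E,
          S (A f) = f %[ae mu] & A (S f) = f %[ae mu] ].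

(* The Hilbert-space adjoint of A on V: A^* g is the (a.e. unique) element of V
   representing the functional f |-> <A f, g>. *)
Definition adjoint V (A : (T -> R) -> (T -> R)) g : T -> R :=
  get [set h | V h /\ forall f, V f -> inner (A f) g = inner f h].

Definition power_sum (A : (T -> R) -> (T -> R)) f (n : nat) : T -> R :=
  \sum_(1 <= r < n.+1) iter r A f.

Definition power_series_cvg V (A : (T -> R) -> (T -> R)) : Prop :=
  forall f, V f -> exists2 g, V g & L2cvg (power_sum A f) g.

(* sum_{r >= 1} A^r f, meaningful when the series converges in V *)
Definition power_series V (A : (T -> R) -> (T -> R)) f : T -> R :=
  get [set g | V g /\ L2cvg (power_sum A f) g].

Definition ortho_in V U : set (T -> R) :=
  [set f | V f /\ forall g, U g -> inner f g = 0].

Definition add_set U V : set (T -> R) := [set f \+ g | f in U & g in V].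

Definition linear_subspace V U : Prop :=
  [/\ U `<=` V, U (cst 0) &
      forall (a : R) f g, U f -> U g -> U (fun x => a * f x + g x)].

Definition orthogonal_direct_sum V (s : seq (set (T -> R))) : Prop :=
  [/\ forall i, (i < size s)%N -> linear_subspace V (nth set0 s i),
      forall i j, (i < size s)%N -> (j < size s)%N -> i != j ->
        forall f g, nth set0 s i f -> nth set0 s j g -> inner f g = 0 &
      forall f, V f -> exists2 g : nat -> T -> R,
        (forall i, (i < size s)%N -> nth set0 s i (g i)) &
        f = (fun x => \sum_(i < size s) g i x) %[ae mu] ].

End L2.

(* Usual notation:
     path_law X n            pi_n, the law of (X_1, ..., X_n)
     path_space X n          H_n = L^2_0(pi_n)
     transition_op K k       P_k
     green_kubo X K k        B_k = I + sum_(r >= 1) P_k^r + sum_(r >= 1) (P_k^* )^r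
     incremental_space X m   I_m = (W_{m-1}^L + W_{m-1}^R)^perp
     block_sum_space X m k   S_{m,k}
     marginal_space X nu k   M_k, the closure of the sums a_1(X_1) + ... + a_k(X_k)
     marginal_plus X nu K k  M_k^+
   Coordinate x_i of a path is entry i - 1 of the corresponding tuple. *)

Section Chain.
Context {d} {E : measurableType d} {R : realType}.
Context {d'} {Omega : measurableType d'} {P : probability Omega R}.
Implicit Types (X : int -> {RV P >-> E}) (K : R.-pker E ~> E).

Definition window X (t : int) (n : nat) (w : Omega) : n.-tuple E :=
  [tuple X (t + i%:Z) w | i < n].

Lemma measurable_window X t n : measurable_fun setT (window X t n).
Proof.
apply/measurable_fun_tnthP => i.
rewrite (_ : _ \o _ = X (t + i%:Z))//.
by apply/funext => w /=; rewrite tnth_mktuple.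
Qed.

HB.instance Definition _ X t n :=
  isMeasurableFun.Build _ _ _ _ (window X t n) (measurable_window X t n).

Definition past X (t : int) : set (set Omega) :=
  <<s [set F | exists (s : int) (A : set E),
        [/\ s <= t, measurable A & F = X s @^-1` A] ] >>.

Record stationary_markov_chain X (nu : probability E R) K : Prop := {
  chain_stationary : forall (s t : int) n (A : set (n.-tuple E)),
    measurable A ->
    distribution P (window X s n) A = distribution P (window X t n) A ;
  chain_marginal : forall (t : int) (A : set E),
    measurable A -> distribution P (X t) A = nu A ;
  chain_markov : forall (t : int) (F : set Omega) (A : set E),
    past X t F -> measurable A ->
    P (F `&` X (t + 1) @^-1` A) = (\int[P]_(w in F) K (X t w) A)%E }.

Definition path_law X (n : nat) : probability (n.-tuple E) R :=
  distribution P (window X 1 n).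

Definition path_space X (n : nat) : set (n.-tuple E -> R) :=
  L20 (path_law X n).

Definition kernel_op K (h : E -> R) : E -> R := fun x => \int[K x]_y h y.

(* [nth z x j.+1] is x_{j+2} for j < k - 1 and the default z for
   j = k - 1, so that f is evaluated at (x_2, ..., x_k, z). *)
Definition transition_op K (k : nat) (f : k.-tuple E -> R) : k.-tuple E -> R :=
  fun x => \int[K (last point x)]_z f [tuple nth z x j.+1 | j < k].

Definition transition_adj X K (k : nat) :
    (k.-tuple E -> R) -> (k.-tuple E -> R) :=
  adjoint (path_law X k) (path_space X k) (transition_op K k).

(* The two series in B_k converge separately, in norm, at every point of H_k. *)
Definition green_kubo_cvg X K (k : nat) : Prop :=
  power_series_cvg (path_law X k) (path_space X k) (transition_op K k) /\
  power_series_cvg (path_law X k) (path_space X k) (transition_adj X K k).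

Definition green_kubo X K (k : nat) (f : k.-tuple E -> R) : k.-tuple E -> R :=
  fun x => f x
    + power_series (path_law X k) (path_space X k) (transition_op K k) f x
    + power_series (path_law X k) (path_space X k) (transition_adj X K k) f x.

Definition ker_green_kubo X K (k : nat) : set (k.-tuple E -> R) :=
  [set f | path_space X k f /\
           green_kubo X K k f = cst 0 %[ae path_law X k] ].

(* (x_{i+1}, ..., x_{i+m}), for i + m <= k (then [point] is never used) *)
Definition block (i m : nat) (k : nat) (x : k.-tuple E) : m.-tuple E :=
  [tuple nth point x (i + j)%N | j < m].

(* the elements of H_m that are functions of (X_{i+1}, ..., X_{i+n}) *)
Definition block_space X (m i n : nat) : set (m.-tuple E -> R) :=
  [set f | path_space X m f /\
     exists2 g : n.-tuple E -> R, measurable_fun setT g &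
       f = g \o block i n m %[ae path_law X m] ].

Definition incremental_space X (m : nat) : set (m.-tuple E -> R) :=
  ortho_in (path_law X m) (path_space X m)
    (add_set (block_space X m 0 m.-1) (block_space X m 1 m.-1)).

Definition block_sum_space X (m k : nat) : set (k.-tuple E -> R) :=
  [set f | path_space X k f /\
     exists2 h, incremental_space X m h &
       f = (fun x => \sum_(i < (k - m + 1)%N) h (block i m k x))
         %[ae path_law X k] ].

Definition marginal_space X (nu : probability E R) (k : nat) :
    set (k.-tuple E -> R) :=
  [set f | path_space X k f /\
     forall e : R, 0 < e -> exists2 a : 'I_k -> E -> R,
       (forall i, L20 nu (a i)) &
       (L2norm (path_law X k)
          (fun x => (f x - \sum_(i < k) a i (tnth x i))%R) < e%:E)%E ].

Definition marginal_plus X (nu : probability E R) K (k : nat) :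
    set (k.-tuple E -> R) :=
  ortho_in (path_law X k) (marginal_space X nu k)
    (marginal_space X nu k `&` ker_green_kubo X K k).

Definition decomposition X (nu : probability E R) K (k : nat)
    (f fmarg : k.-tuple E -> R) (fblk : nat -> k.-tuple E -> R)
    (f0 : k.-tuple E -> R) : Prop :=
  [/\ marginal_plus X nu K k fmarg,
      forall m, (2 <= m <= k)%N -> block_sum_space X m k (fblk m),
      ker_green_kubo X K k f0 &
      f = (fun x => fmarg x + \sum_(2 <= m < k.+1) fblk m x + f0 x)
        %[ae path_law X k] ].

End Chain.

(* Main.v *)
(* By stationarity, <B_k f, g> is the sum over all r in Z of the correlations
   of f(X_{r+1}, ..., X_{r+k}) with g(X_1, ..., X_k).  In this form B_k is
   symmetric, and it kills every difference of two shifts of the same function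
   because the series telescopes.

   An increment h in I_m has zero conditional expectation given the past or,
   by reversibility, given the future, so only k - m + 1 terms of the series of
   h(x_1, ..., x_m) survive.  Since the element of S_{m,k} built from h equals
   (k - m + 1) h(x_1, ..., x_m) modulo ker B_k, it is an eigenvector of B_k for
   the eigenvalue k - m + 1.  Hence the S_{m,k} are orthogonal to each other
   and to ker B_k; they are orthogonal to M_k by the same vanishing of
   conditional expectations.

   For marginals, B_k maps (c - K c)(x_1) to an explicit element of M_k, which
   is orthogonal to ker B_k and equals (k c - (k - 2) K c)(x_1) modulo ker B_k.
   As K is a contraction, k - (k - 2) K is invertible on L^2_0(nu), so every
   sum of marginals is of this form modulo ker B_k.

   Finally, a function of m coordinates is the sum of a function of the first
   m - 1, a function of the last m - 1 and an increment (for m = 2 this uses the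
   inverse of I - K^2).  Modulo ker B_k the two functions of m - 1 coordinates
   can be shifted to the same window and the increment can be replaced by an
   element of S_{m,k}, and an induction on m concludes. *)
Require Import Defs.
From HB Require Import structures.
From mathcomp Require Import all_boot all_order all_algebra.
From mathcomp Require Import all_classical all_reals all_analysis.
From mathcomp Require Import measurable_realfun zify ring lra.

Import Order.TTheory GRing.Theory Num.Theory.
Import numFieldNormedType.Exports.
Local Open Scope classical_set_scope.
Local Open Scope ring_scope.

(** * L2 over a probability measure *)

(** Reversibility is given only as self-adjointness of K on L^2(nu), while the argument conditions
    on the future of a whole window. The bridge is the invariance of the path law under reversal,
    proved on boxes; it yields the conditional expectation [cond_exp_prev] and, with it, an explicit
    adjoint of P_k.

    The adjoint and the sums of the series are chosen by [get] and determined only almost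
    everywhere, so B_k is handled through the form <B_k f, g>. Correlations are computed on [Omega]
    with windows at arbitrary integer times, where powers of P_k become translations. Convergence of
    the series enters twice: it makes the form a limit of correlations, and it sends single
    correlations to 0, which removes the boundary terms of telescoping sums.

    The operator k - (k - 2) K equals k (I - q K) with q = (k - 2) / k < 1, so a Neumann series
    inverts it. By definition M_k^+ is orthogonal only to the part of ker B_k inside M_k;
    orthogonality to all of ker B_k is obtained by approximating its elements by the functions
    [marg_range c], which lie in the range of B_k. *)

Lemma ae_eq_Rintegral {d} {T : measurableType d} {R : realType}
    (mu : {measure set T -> \bar R}) (f g : T -> R) :
  measurable_fun setT f -> measurable_fun setT g -> f = g %[ae mu] ->
  \int[mu]_x f x = \int[mu]_x g x.
Proof.
move=> mf mg fg; rewrite /Rintegral; congr fine; apply: ae_eq_integral => //.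
- exact/measurable_EFinP.
- exact/measurable_EFinP.
- by apply: filterS fg => x fgx _; rewrite fgx.
Qed.

Lemma Rintegral_distribution {d d'} {T : measurableType d} {T' : measurableType d'}
    {R : realType} (P : probability T R) (Z : {RV P >-> T'}) (f : T' -> R) :
  measurable_fun setT f ->
  \int[distribution P Z]_y f y = \int[P]_w f (Z w).
Proof.
move=> mf; rewrite /Rintegral; congr fine; rewrite integralE [RHS]integralE.
have mfE : measurable_fun setT (EFin \o f) by exact/measurable_EFinP.
by congr (_ - _)%E; rewrite ge0_integral_distribution//;
  [apply: eq_integral => w _; rewrite /= !funeposE|exact: measurable_funepos
  |apply: eq_integral => w _; rewrite /= !funenegE|exact: measurable_funeneg].
Qed.

Lemma eq_measure_Rintegral {d} {T : measurableType d} {R : realType}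
    (mu1 mu2 : {measure set T -> \bar R}) (f : T -> R) :
  (forall A, measurable A -> mu1 A = mu2 A) ->
  \int[mu1]_x f x = \int[mu2]_x f x.
Proof.
by move=> mu12; rewrite /Rintegral; congr fine; apply: eq_measure_integral => A + _; exact: mu12.
Qed.

Section L2_theory.
Context {d} {T : measurableType d} {R : realType} (mu : probability T R).
Implicit Types (f g h : T -> R) (a : R).

Lemma L2P f : L2 mu f <->
  measurable_fun setT f /\ mu.-integrable setT (EFin \o (fun x => f x ^+ 2)).
Proof.
split=> [Lf|[mf /integrableP[_ If]]].
  split; last exact: Lfun2_integrable_sqr.
  by move: Lf; rewrite /L2/= inE => /andP[]; rewrite inE.
rewrite /L2/= inE; apply/andP; split; rewrite inE//= /finite_norm unlock.
apply: poweR_lty; apply: le_lt_trans If; apply: ge0_le_integral => //=.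
- apply/measurable_EFinP; apply: (@measurableT_comp _ _ _ _ _ _ (fun x : R => x `^ 2)) => //.
  exact/measurableT_comp.
- by apply/measurable_EFinP/measurableT_comp => //; exact: measurable_funX.
- by move=> x _; rewrite lee_fin normrX powR_mulrn.
Qed.

Lemma L2_measurable f : L2 mu f -> measurable_fun setT f.
Proof. by move/L2P => []. Qed.

Lemma L2_mul_integrable f g : L2 mu f -> L2 mu g ->
  mu.-integrable setT (EFin \o (fun x => f x * g x)).
Proof. by move=> Lf Lg; apply/Lfun1_integrable/Lfun2_mul_Lfun1. Qed.

Lemma L2_cst a : L2 mu (cst a).
Proof. exact: Lfun_cst. Qed.

Lemma L2_integrable f : L2 mu f -> mu.-integrable setT (EFin \o f).
Proof.
move=> Lf; have := L2_mul_integrable _ _ Lf (L2_cst 1).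
by congr integrable; apply/funext => x /=; rewrite mulr1.
Qed.

Lemma L2_comb a f g : L2 mu f -> L2 mu g -> L2 mu (fun x => a * f x + g x).
Proof.
move=> Lf Lg; have -> : (fun x => a * f x + g x) = (a \o* f + g)%R.
  by apply/funext => x; rewrite mulrC.
have le12 : (1 <= 2%:E :> \bar R)%E by rewrite lee_fin ler1n.
have [_ addL] := Lfun_addr_closed mu le12.
by apply: addL => //; apply: Lfun_scale; rewrite ?ler1n.
Qed.

Lemma L2_sub f g : L2 mu f -> L2 mu g -> L2 mu (fun x => f x - g x).
Proof.
move=> Lf Lg; rewrite (_ : (fun _ => _) = (fun x => -1 * g x + f x)).
  exact: L2_comb.
by apply/funext => x; rewrite mulN1r addrC.
Qed.

Lemma L2_add f g : L2 mu f -> L2 mu g -> L2 mu (fun x => f x + g x).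
Proof.
move=> Lf Lg; rewrite (_ : (fun _ => _) = (fun x => 1 * f x + g x)).
  exact: L2_comb.
by apply/funext => x; rewrite mul1r.
Qed.

Lemma L2_scale a f : L2 mu f -> L2 mu (fun x => a * f x).
Proof.
move=> Lf; rewrite (_ : (fun _ => _) = (fun x => a * f x + cst 0 x)).
  exact/L2_comb/L2_cst.
by apply/funext => x; rewrite addr0.
Qed.

Lemma L2_sum (I : Type) (s : seq I) (F : I -> T -> R) :
  (forall i, L2 mu (F i)) -> L2 mu (fun x => \sum_(i <- s) F i x).
Proof.
move=> LF; elim: s => [|i s IH].
  by under eq_fun do rewrite big_nil; exact: L2_cst.
by under eq_fun do rewrite big_cons; exact: L2_add.
Qed.

Lemma L2_ae f g : measurable_fun setT g -> f = g %[ae mu] -> L2 mu f -> L2 mu g.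
Proof.
move=> mg fg /L2P[mf If]; apply/L2P; split => //.
have mgg : measurable_fun setT (EFin \o (fun x => g x ^+ 2)).
  by apply/measurable_EFinP; exact: measurable_funX.
move/integrableP: If => [mff If]; apply/integrableP; split => //.
rewrite (ae_eq_integral (abse \o (EFin \o (fun x => f x ^+ 2))))//.
- exact: measurableT_comp.
- exact: measurableT_comp.
- by apply: filterS fg => x fgx _; rewrite /= fgx.
Qed.

Lemma innerC f g : inner mu f g = inner mu g f.
Proof. by rewrite /inner; under eq_Rintegral do rewrite mulrC. Qed.

Lemma innerDl f g h : L2 mu f -> L2 mu g -> L2 mu h ->
  inner mu (fun x => f x + g x) h = inner mu f h + inner mu g h.
Proof.
move=> Lf Lg Lh; rewrite /inner -RintegralD//; [|exact: L2_mul_integrable..].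
by under eq_Rintegral do rewrite mulrDl.
Qed.

Lemma innerZl a f h : L2 mu f -> L2 mu h ->
  inner mu (fun x => a * f x) h = a * inner mu f h.
Proof.
move=> Lf Lh; rewrite /inner -RintegralZl//; last exact: L2_mul_integrable.
by under eq_Rintegral do rewrite -mulrA.
Qed.

Lemma innerBl f g h : L2 mu f -> L2 mu g -> L2 mu h ->
  inner mu (fun x => f x - g x) h = inner mu f h - inner mu g h.
Proof.
move=> Lf Lg Lh; rewrite /inner -RintegralB//; [|exact: L2_mul_integrable..].
by under eq_Rintegral do rewrite mulrBl.
Qed.

Lemma inner0l h : inner mu (cst 0) h = 0.
Proof.
rewrite /inner; under eq_Rintegral do rewrite mul0r.
by rewrite Rintegral_cst ?mul0r.
Qed.

Lemma inner_suml (I : Type) (s : seq I) (F : I -> T -> R) h :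
  (forall i, L2 mu (F i)) -> L2 mu h ->
  inner mu (fun x => \sum_(i <- s) F i x) h = \sum_(i <- s) inner mu (F i) h.
Proof.
move=> LF Lh; elim: s => [|i s IH].
  by under eq_fun do rewrite big_nil; rewrite big_nil inner0l.
under eq_fun do rewrite big_cons; rewrite big_cons innerDl// ?IH//.
exact: L2_sum.
Qed.

Lemma innerDr f g h : L2 mu f -> L2 mu g -> L2 mu h ->
  inner mu h (fun x => f x + g x) = inner mu h f + inner mu h g.
Proof. by move=> *; rewrite !(innerC h) innerDl. Qed.

Lemma innerZr a f h : L2 mu f -> L2 mu h ->
  inner mu h (fun x => a * f x) = a * inner mu h f.
Proof. by move=> *; rewrite !(innerC h) innerZl. Qed.

Lemma inner_ael f g h : L2 mu f -> L2 mu g -> L2 mu h ->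
  f = g %[ae mu] -> inner mu f h = inner mu g h.
Proof.
move=> Lf Lg Lh fg; rewrite /inner /Rintegral; congr fine.
apply: ae_eq_integral => //=.
- exact: measurable_int (L2_mul_integrable _ _ Lf Lh).
- exact: measurable_int (L2_mul_integrable _ _ Lg Lh).
- by near=> x => _ /=; rewrite (near fg x).
Unshelve. all: by end_near. Qed.

Lemma inner_ge0 f : 0 <= inner mu f f.
Proof. by apply: Rintegral_ge0 => x _; rewrite -expr2 sqr_ge0. Qed.

Lemma inner_eq0 f : L2 mu f -> inner mu f f = 0 -> f = cst 0 %[ae mu].
Proof.
move=> Lf ff0.
have Iff := L2_mul_integrable _ _ Lf Lf.
have := integrable_fin_num measurableT Iff => /fineK /= ff.
have : (\int[mu]_x `|(f x * f x)%:E|)%E = 0%E.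
  under eq_integral => x _ do rewrite /= ger0_norm -?expr2 ?sqr_ge0//.
  have -> : (\int[mu]_x (f x ^+ 2)%:E = \int[mu]_x (f x * f x)%:E)%E by [].
  by rewrite -ff; move: ff0; rewrite /inner /Rintegral => ->.
move/(ae_eq_integral_abs mu measurableT (measurable_int _ Iff)).
by apply: filterS => x /(_ Logic.I)/eqP; rewrite eqe mulf_eq0 orbb => /eqP.
Qed.

Lemma inner_sqDl f g : L2 mu f -> L2 mu g ->
  inner mu (fun x => f x + g x) (fun x => f x + g x) =
  inner mu f f + 2 * inner mu f g + inner mu g g.
Proof.
move=> Lf Lg; have Lfg := L2_add _ _ Lf Lg.
by rewrite innerDl// !innerDr// (innerC g f); ring.
Qed.

(** The squared norm p t of f + t g is nonnegative; if <g, g> is nonzero, its value at the minimiser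
    gives the inequality. *)
Lemma inner_cauchy_schwarz f g : L2 mu f -> L2 mu g ->
  inner mu f g ^+ 2 <= inner mu f f * inner mu g g.
Proof.
move=> Lf Lg.
pose p t := inner mu f f + 2 * (t * inner mu f g) + t ^+ 2 * inner mu g g.
have p_ge0 t : 0 <= p t.
  have Ltg := L2_scale t _ Lg.
  have := inner_ge0 (fun x => f x + t * g x).
  by rewrite inner_sqDl// innerZr// (innerZl t g)// innerZr// /p !expr2 !mulrA.
have [gg0|gg0] := eqVneq (inner mu g g) 0; last first.
  have := p_ge0 (- inner mu f g / inner mu g g).
  have gg_gt0 : 0 < inner mu g g by rewrite lt_def gg0 inner_ge0.
  move=> p0; rewrite -subr_ge0.
  have -> : inner mu f f * inner mu g g - inner mu f g ^+ 2 =
     inner mu g g * p (- inner mu f g / inner mu g g) by rewrite /p; field.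
  by rewrite mulr_ge0// ltW.
(* Now <g, g> = 0 and p is affine. If <f, g> were nonzero, p would take the value - <f, f> - 2 < 0
   at this point. *)
have H := p_ge0 (- (inner mu f f + 1) / inner mu f g).
have [->|fg0] := eqVneq (inner mu f g) 0; first by rewrite expr0n/= gg0 mulr0.
move: H; rewrite /p gg0 mulr0 addr0 -mulrA mulVf// mulr1.
have := inner_ge0 f; nra.
Qed.

Lemma L2normE f : L2 mu f -> L2norm mu f = ((inner mu f f) `^ 2^-1)%:E.
Proof.
move=> Lf; have := integrable_fin_num measurableT (L2_mul_integrable _ _ Lf Lf).
rewrite /L2norm unlock /inner /Rintegral => /fineK /= ff.
rewrite (@eq_integral _ _ _ mu _ (fun x => (f x * f x)%:E)) => [|x _].
  by rewrite -ff poweR_EFin.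
by rewrite /= -expr2 powR_mulrn// real_normK// num_real.
Qed.

Lemma L2norm_lt f (e : R) : L2 mu f -> (L2norm mu f < e%:E)%E ->
  inner mu f f < e ^+ 2.
Proof.
move=> Lf; rewrite L2normE// lte_fin => fe.
have e0 : 0 < e by apply: le_lt_trans fe; exact: powR_ge0.
rewrite ltNge; apply/negP => ef; move: fe; rewrite ltNge => /negP; apply.
have {1}-> : e = (e ^+ 2) `^ 2^-1.
  by rewrite -powR_mulrn ?ltW// -powRrM mulfV ?powRr1 ?ltW// pnatr_eq0.
by apply: ge0_ler_powR => //; rewrite ?nnegrE ?inner_ge0// sqr_ge0.
Qed.

Lemma lt_L2norm f (e : R) : L2 mu f -> 0 < e -> inner mu f f < e ^+ 2 ->
  (L2norm mu f < e%:E)%E.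
Proof.
move=> Lf e0 fe; rewrite L2normE// lte_fin.
have -> : e = (e ^+ 2) `^ 2^-1.
  by rewrite -powR_mulrn ?ltW// -powRrM mulfV ?powRr1 ?ltW// pnatr_eq0.
by apply: gt0_ltr_powR => //; rewrite ?nnegrE ?inner_ge0// sqr_ge0.
Qed.

Lemma L2cvg_inner (u : nat -> T -> R) f h :
  (forall n, L2 mu (u n)) -> L2 mu f -> L2 mu h -> L2cvg mu u f ->
  inner mu (u n) h @[n --> \oo] --> inner mu f h.
Proof.
move=> Lu Lf Lh uf; apply/cvgrPdist_lt => e e0.
(* Adding 1 keeps c positive when h vanishes and gives <h, h> < c ^ 2, which is what the final
   estimate needs. *)
pose c := inner mu h h + 1.
have c0 : 0 < c by rewrite /c; have := inner_ge0 h; lra.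
pose e' := e / c.
have e'0 : 0 < e' by rewrite divr_gt0.
have /fine_cvgP[fin lim] := uf.
have L n : L2 mu (u n \- f) by exact: L2_sub.
near=> n.
rewrite distrC -(innerBl (u n) f h)// -/(u n \- f).
have un : inner mu (u n \- f) (u n \- f) < e' ^+ 2.
  apply: L2norm_lt => //.
  rewrite -[X in (X < _)%E]fineK; last by near: n.
  rewrite lte_fin.
  have : `|0 - fine (L2norm mu (u n \- f))| < e'.
    by near: n; move/cvgrPdist_lt: lim; exact.
  by rewrite sub0r normrN; apply: le_lt_trans; exact: ler_norm.
rewrite -(ltr_pXn2r (ltn0Sn 1)) ?nnegrE ?normr_ge0 ?ltW// real_normK ?num_real//.
apply: le_lt_trans (inner_cauchy_schwarz _ _ (L n) Lh) _.
apply: le_lt_trans (ler_wpM2r (inner_ge0 _) (ltW un)) _.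
rewrite /e' expr_div_n -mulrA -[ltRHS]mulr1 ltr_pM2l ?exprn_gt0//.
rewrite mulrC ltr_pdivrMr ?exprn_gt0// mul1r.
by rewrite /c; have := inner_ge0 h; nra.
Unshelve. all: by end_near. Qed.

End L2_theory.

(** * Disintegration along a probability kernel *)

Section kernel_pullback.
Context {d1 d2 d3} {T1 : measurableType d1} {T2 : measurableType d2}
  {T3 : measurableType d3} {R : realType}.
Variables (K : R.-pker T2 ~> T3) (g : T1 -> T2).

(** The measurability proof is an argument so that the kernel structures declared below can be
    recovered from the term itself. *)
Definition kpull (mg : measurable_fun setT g) (x : T1) :
  {measure set T3 -> \bar R} := K (g x).

Variable mg : measurable_fun setT g.

Let measurable_kpull U : measurable U -> measurable_fun setT (kpull mg ^~ U).
Proof.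
by move=> mU; apply: (@measurableT_comp _ _ _ _ _ _ (K ^~ U) _ g) => //; exact: measurable_kernel.
Qed.

HB.instance Definition _ := isKernel.Build _ _ _ _ R (kpull mg) measurable_kpull.

Let kpull_prob x : kpull mg x setT = 1%E.
Proof. exact: prob_kernel. Qed.

HB.instance Definition _ := Kernel_isProbability.Build _ _ _ _ R (kpull mg) kpull_prob.

End kernel_pullback.

Section disintegration.
Context {d d1 d2 d3} {Omega : measurableType d} {T : measurableType d1}
  {E : measurableType d2} {E' : measurableType d3} {R : realType}.
Variables (P : probability Omega R) (K : R.-pker E ~> E').
Variables (V : Omega -> T) (Y : Omega -> E) (Y' : Omega -> E').
Hypothesis mV : measurable_fun setT V.
Hypothesis mY : measurable_fun setT Y.
Hypothesis mY' : measurable_fun setT Y'.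
Local Open Scope ereal_scope.

Lemma measurable_kernel_integral (phi : T * E' -> \bar R) :
  measurable_fun setT phi -> (forall p, 0 <= phi p) ->
  measurable_fun setT (fun w => \int[K (Y w)]_z phi (V w, z)).
Proof.
move=> mphi phi0.
apply: (measurable_fun_integral_finite_kernel (fun p => phi (V p.1, p.2)) (kpull K Y mY)) => //.
apply: measurableT_comp mphi _; apply/measurable_fun_pairP; split => /=.
  exact: (@measurableT_comp _ _ _ _ _ _ V _ fst).
exact: measurable_snd.
Qed.

Let Z w := (V w, Y' w).
Let mZ : measurable_fun setT Z.
Proof. by apply/measurable_fun_pairP; split. Qed.
HB.instance Definition _ := isMeasurableFun.Build _ _ _ _ Z mZ.

Let mY2 : measurable_fun [set: unit * Omega] (Y \o snd).
Proof. exact: measurableT_comp. Qed.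

Let W (p : (unit * Omega) * E') := (V p.1.2, p.2).
Let mW : measurable_fun setT W.
Proof.
apply/measurable_fun_pairP; split => /=; last exact: measurable_snd.
by apply: measurableT_comp mV _; exact: measurableT_comp.
Qed.

Let mP : measurable_fun [set: unit] (fun _ : unit => P : pprobability Omega R).
Proof. exact: measurable_cst. Qed.

(** The law of (V w, z) when w is drawn from P and then z from K (Y w). P is seen as a kernel from
    [unit] because the composition is one of kernels. *)
Let joint := (kprobability mP \; (kpull K _ mY2 \; kdirac mW)) tt.

Let integral_joint (phi : T * E' -> \bar R) :
  measurable_fun setT phi -> (forall p, 0 <= phi p) ->
  \int[joint]_p phi p = \int[P]_w \int[K (Y w)]_z phi (V w, z).
Proof.
move=> mphi phi0; rewrite /joint integral_kcomp//.
apply: eq_integral => w _.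
rewrite integral_kcomp//; apply: eq_integral => z _.
by rewrite integral_dirac// diracT mul1e.
Qed.

Hypothesis disint : forall (B : set T) (A : set E'), measurable B -> measurable A ->
  P (V @^-1` B `&` Y' @^-1` A) = \int[P]_(w in V @^-1` B) K (Y w) A.

(** By [disint] the law of (V, Y') and [joint] agree on rectangles, a generating family stable under
    intersection; hence the two measures are equal. *)
Lemma ge0_disintegration (phi : T * E' -> \bar R) :
  measurable_fun setT phi -> (forall p, 0 <= phi p) ->
  \int[P]_w phi (V w, Y' w) = \int[P]_w \int[K (Y w)]_z phi (V w, z).
Proof.
move=> mphi phi0; rewrite -integral_joint//.
transitivity (\int[distribution P Z]_p phi p).
  by rewrite ge0_integral_distribution.
apply: eq_measure_integral => A mA _.
pose G := [set B1 `*` B2 | B1 in @measurable _ T & B2 in @measurable _ E'].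
apply: (measure_unique G (fun=> setT)) => //.
- by rewrite measurable_prod_measurableType.
- move=> _ _ [B1 mB1 [B2 mB2 <-]] [C1 mC1 [C2 mC2 <-]].
  by rewrite -setXI; exists (B1 `&` C1); [exact: measurableI|exists (B2 `&` C2); [exact: measurableI|]].
- by move=> _; exists setT => //; exists setT => //; rewrite setXTT.
- by apply/seteqP; split => // x _; exists 0%N.
- move=> _ [B mB [C mC <-]].
  transitivity (P (V @^-1` B `&` Y' @^-1` C)); first by [].
  transitivity (\int[joint]_p (\1_(B `*` C) p)%:E); last first.
    by rewrite integral_indic ?setIT//; exact: measurableX.
  rewrite disint// integral_joint//; last first.
    by apply/measurable_EFinP; apply: measurable_indic; exact: measurableX.
  rewrite integral_mkcond; apply: eq_integral => w _; rewrite patchE.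
  case: ifPn => [/set_mem VB|/negP VB].
    transitivity (\int[K (Y w)]_z (\1_C z)%:E); first by rewrite integral_indic ?setIT.
    apply: eq_integral => z _; rewrite !indicE in_setX/=.
    by have -> : V w \in B by exact/mem_set.
  rewrite integral0_eq// => z _; rewrite indicE in_setX/=.
  by have /negPf -> : (V w) \notin B by apply/negP => /set_mem Vw; apply/VB/mem_set.
- by move=> _; apply: le_lt_trans (probability_le1 (distribution P Z) measurableT) _; rewrite ltry.
Qed.

Section real_valued.
Variable phi : T * E' -> R.
Hypothesis mphi : measurable_fun setT phi.

Lemma measurable_kernel_Rintegral :
  measurable_fun setT (fun w => \int[K (Y w)]_z phi (V w, z))%R.
Proof.
apply: (@measurableT_comp _ _ _ _ _ _ (@fine R)) => //.
have mp : measurable_fun setT (EFin \o phi) by exact/measurable_EFinP.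
have E1 w : (fun z => (phi (V w, z))%:E) = (EFin \o phi) \o (fun z => (V w, z)) by [].
under eq_fun do rewrite integralE E1 funepos_comp funeneg_comp.
apply: emeasurable_funB.
  apply: (measurable_kernel_integral ((EFin \o phi)^\+)) => //.
  exact: measurable_funepos.
apply: (measurable_kernel_integral ((EFin \o phi)^\-)) => //.
exact: measurable_funeneg.
Qed.

Hypothesis iphi : P.-integrable setT (EFin \o (fun w => phi (V w, Y' w))).

Let iabs : P.-integrable setT (fun w => \int[K (Y w)]_z `|phi (V w, z)|%:E).
Proof.
have mabs : measurable_fun setT (fun p => `|phi p|%:E).
  by apply/measurable_EFinP; exact: measurableT_comp.
apply/integrableP; split; first exact: (measurable_kernel_integral (fun p => `|phi p|%:E)).
under eq_integral do rewrite gee0_abs ?integral_ge0//.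
rewrite -(ge0_disintegration (fun p => `|phi p|%:E))//.
by move/integrableP : iphi => [].
Qed.

Lemma disintegration_integrable_ae :
  {ae P, forall w, (K (Y w)).-integrable setT (EFin \o (fun z => phi (V w, z)))}.
Proof.
have := integrable_ae measurableT iabs.
apply: filterS => w /(_ Logic.I); rewrite ge0_fin_numE ?integral_ge0// => w_lty.
apply/integrableP; split => //; apply/measurable_EFinP.
exact: measurableT_comp.
Qed.

(** The nonnegative case is applied to the positive and negative parts, which [iabs] makes
    integrable. The inner integral is the difference of theirs only for almost every w, where phi (V
    w, .) is integrable for the kernel. *)
Lemma disintegration :
  (\int[P]_w phi (V w, Y' w) = \int[P]_w \int[K (Y w)]_z phi (V w, z))%R.
Proof.
have mp : measurable_fun setT (EFin \o phi) by exact/measurable_EFinP.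
have mpp := measurable_funepos mp.
have mpn := measurable_funeneg mp.
rewrite {1 2}/Rintegral; congr fine.
have ip : P.-integrable setT (fun w => \int[K (Y w)]_z ((EFin \o phi)^\+ (V w, z))).
  apply: le_integrable iabs => //; first exact: measurable_kernel_integral.
  move=> w _; rewrite !gee0_abs ?integral_ge0//; apply: ge0_le_integral => //.
  - exact: measurableT_comp.
  - by apply/measurable_EFinP/measurableT_comp => //; exact: measurableT_comp.
  - by move=> z _; rewrite funeposE ge_max !lee_fin ler_norm normr_ge0.
have ineg : P.-integrable setT (fun w => \int[K (Y w)]_z ((EFin \o phi)^\- (V w, z))).
  apply: le_integrable iabs => //; first exact: measurable_kernel_integral.
  move=> w _; rewrite !gee0_abs ?integral_ge0//; apply: ge0_le_integral => //.
  - exact: measurableT_comp.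
  - by apply/measurable_EFinP/measurableT_comp => //; exact: measurableT_comp.
  - by move=> z _; rewrite funenegE ge_max -EFinN !lee_fin -normrN ler_norm normr_ge0.
transitivity (\int[P]_w (\int[K (Y w)]_z ((EFin \o phi)^\+ (V w, z)) -
                         \int[K (Y w)]_z ((EFin \o phi)^\- (V w, z)))).
  rewrite integralB//.
  rewrite -(ge0_disintegration ((EFin \o phi)^\+))// -(ge0_disintegration ((EFin \o phi)^\-))//.
  have -> : (fun w => (phi (V w, Y' w))%:E) = (EFin \o phi) \o (fun w => (V w, Y' w)) by [].
  by rewrite [LHS]integralE funepos_comp funeneg_comp.
apply: ae_eq_integral => //.
- by apply: emeasurable_funB; exact: measurable_kernel_integral.
- exact/measurable_EFinP/measurable_kernel_Rintegral.
- apply: filterS disintegration_integrable_ae => w iw _ /=.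
  rewrite /Rintegral fineK; last exact: integrable_fin_num.
  rewrite [RHS]integralE; congr (_ - _); apply: eq_integral => z _.
    by rewrite !funeposE.
  by rewrite !funenegE.
Qed.

End real_valued.

End disintegration.

Section kernel_Jensen.
Context {d1 d2} {E : measurableType d1} {E' : measurableType d2} {R : realType}.
Variables (K : R.-pker E ~> E').

(** A name for the measure K x to which a probability structure can be attached, so that the inner
    product lemmas apply over it. *)
Let Kx (x : E) : set E' -> \bar R := K x.
HB.instance Definition _ x := Measure.on (Kx x).
HB.instance Definition _ x := Measure_isProbability.Build _ _ _ (Kx x) (prob_kernel x).

(** Cauchy-Schwarz against the constant 1 over K x. Values in the extended reals allow every
    measurable u: a section of a square integrable function is square integrable only at almost
    every x. *)
Lemma kernel_sqr_Rintegral_le (x : E) (u : E' -> R) : measurable_fun setT u ->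
  (((\int[K x]_z u z) ^+ 2)%:E <= \int[K x]_z (u z ^+ 2)%:E)%E.
Proof.
move=> mu.
have mu2 : measurable_fun setT (EFin \o (fun z => u z ^+ 2)).
  by apply/measurable_EFinP; exact: measurable_funX.
have [uoo|] := ltP (\int[K x]_z (u z ^+ 2)%:E)%E +oo%E; last first.
  by rewrite leye_eq => /eqP ->; rewrite leey.
have iu2 : (Kx x).-integrable setT (EFin \o (fun z => u z ^+ 2)).
  apply/integrableP; split => //.
  by under eq_integral => z _ do rewrite /= ger0_norm ?sqr_ge0//.
have Lu : L2 (Kx x) u by apply/L2P.
have := inner_cauchy_schwarz (Kx x) u (cst 1) Lu (L2_cst (Kx x) 1).
have -> : inner (Kx x) u (cst 1) = \int[K x]_z u z.
  by apply: eq_Rintegral => z _; rewrite mulr1.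
have -> : inner (Kx x) (cst 1) (cst 1) = 1.
  rewrite /inner; under eq_Rintegral do rewrite mulr1.
  transitivity (1 * fine (K x setT)); first exact: Rintegral_cst.
  by rewrite prob_kernel/= mulr1.
rewrite mulr1 -lee_fin => /le_trans; apply.
rewrite /inner /Rintegral.
under eq_integral do rewrite -expr2.
by rewrite fineK//; exact: (integrable_fin_num measurableT iu2).
Qed.

End kernel_Jensen.

(** * Windows of the chain, the Markov property and time reversal *)

Lemma tnth_rev {T : Type} {n} (x : n.-tuple T) i :
  tnth [tuple of rev x] i = tnth x (rev_ord i).
Proof.
by move: (tnth x i) => a; rewrite !(tnth_nth a)/= nth_rev ?size_tuple.
Qed.

Section tuples.
Context {d} {E : measurableType d}.

Lemma measurable_block (i m n : nat) : (i + m <= n)%N ->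
  measurable_fun setT (@block d E i m n).
Proof.
move=> imn; apply/measurable_fun_tnthP => j.
have jn : (i + j < n)%N by rewrite (leq_trans _ imn)// ltn_add2l.
rewrite (_ : _ \o _ = (tnth (T:=E))^~ (Ordinal jn)); first exact: measurable_tnth.
by apply/funext => x /=; rewrite tnth_mktuple (tnth_nth point).
Qed.

Lemma measurable_rcons n :
  measurable_fun setT (fun p : n.-tuple E * E => [tuple of rcons p.1 p.2]).
Proof.
apply/measurable_fun_tnthP => j.
have [jn|jn] := ltnP j n.
  rewrite (_ : _ \o _ = fun p => tnth p.1 (Ordinal jn)).
    exact: (measurableT_comp (measurable_tnth _)).
  by apply/funext => p /=; rewrite !(tnth_nth point)/= nth_rcons size_tuple jn.
rewrite (_ : _ \o _ = snd) //.
apply/funext => p /=; rewrite (tnth_nth point)/= nth_rcons size_tuple ltnNge jn/=.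
by have -> : (j == n :> nat) by rewrite eqn_leq jn -ltnS ltn_ord.
Qed.

Definition rev_path {n} (x : n.-tuple E) : n.-tuple E := [tuple of rev x].

Lemma measurable_rev n : measurable_fun setT (@rev_path n).
Proof.
apply/measurable_fun_tnthP => j.
rewrite (_ : _ \o _ = (tnth (T:=E))^~ (rev_ord j)); first exact: measurable_tnth.
by apply/funext => x /=; rewrite /rev_path tnth_rev.
Qed.

HB.instance Definition _ n := isMeasurableFun.Build _ _ _ _ (@rev_path n) (@measurable_rev n).

Lemma measurable_last n : (0 < n)%N -> measurable_fun setT (fun x : n.-tuple E => last point x).
Proof.
case: n => // n _.
rewrite (_ : (fun _ => _) = (tnth (T:=E))^~ (@ord_max n)); first exact: measurable_tnth.
by apply/funext => x; rewrite (tnth_nth point) (last_nth point)/= size_tuple; case: x => -[].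
Qed.

Lemma block_rev (i m n : nat) (x : n.-tuple E) : (i + m <= n)%N ->
  block i m n (rev_path x) = rev_path (block (n - (i + m)) m n x).
Proof.
move=> imn; apply: eq_from_tnth => j.
have jm := ltn_ord j.
have ijn : (i + j < n)%N by lia.
have jm' : (m - j.+1 < m)%N by lia.
rewrite tnth_mktuple (tnth_nth point) /rev_path [val _]/=.
rewrite !nth_rev ?size_tuple// (nth_mktuple _ _ (Ordinal jm'))/=; congr nth; lia.
Qed.

Lemma block_id n (x : n.-tuple E) : block 0 n n x = x.
Proof. by apply: eq_from_tnth => j; rewrite tnth_mktuple (tnth_nth point). Qed.

Lemma rev_pathK n : involutive (@rev_path n).
Proof. by move=> x; apply/val_inj; rewrite /= revK. Qed.

End tuples.

Section chain.
Context {d} {E : measurableType d} {R : realType} {nu : probability E R}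
  {K : R.-pker E ~> E} {d'} {Omega : measurableType d'} {P : probability Omega R}
  {X : int -> {RV P >-> E}}.
Hypothesis chainX : stationary_markov_chain X nu K.

(** Functions of windows of different lengths and positions all become random variables on [Omega],
    where they can be paired; s is the time of the first coordinate. *)
Definition window_fun {n} (f : n.-tuple E -> R) (s : int) : Omega -> R := f \o window X s n.
Local Notation ev := window_fun.

Lemma measurable_ev n (f : n.-tuple E -> R) s :
  measurable_fun setT f -> measurable_fun setT (ev f s).
Proof. by move=> mf; apply: measurableT_comp mf _; exact: measurable_window. Qed.

Lemma block_window i m n s w : (i + m <= n)%N ->
  block i m n (window X s n w) = window X (s + i%:Z) m w.
Proof.
move=> imn; apply: eq_from_tnth => j.
have jn : (i + j < n)%N by rewrite (leq_trans _ imn)// ltn_add2l.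
rewrite !tnth_mktuple (nth_mktuple _ _ (Ordinal jn))/=.
by rewrite -addrA -PoszD.
Qed.

Lemma ev_block i m n (f : m.-tuple E -> R) s : (i + m <= n)%N ->
  ev (f \o block i m n) s = ev f (s + i%:Z).
Proof. by move=> imn; apply/funext => w; rewrite /ev/= block_window. Qed.

Lemma window_rcons n s w :
  window X s n.+1 w = [tuple of rcons (window X s n w) (X (s + n%:Z) w)].
Proof.
apply: eq_from_tnth => j; rewrite tnth_mktuple (tnth_nth point) [val _]/= nth_rcons size_tuple.
have [jn|jn] := ltnP j n; first by rewrite (nth_mktuple _ _ (Ordinal jn)).
have -> : (j = n :> nat) by apply/eqP; rewrite eqn_leq jn -ltnS ltn_ord.
by rewrite eqxx.
Qed.

Lemma last_window n s w : last point (window X s n.+1 w) = X (s + n%:Z) w.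
Proof. by rewrite window_rcons last_rcons. Qed.

Lemma last_window_gt0 n s w : (0 < n)%N ->
  last point (window X s n w) = X (s + n.-1%:Z) w.
Proof. by case: n => // n _; rewrite last_window. Qed.

Lemma Rintegral_path n s (f : n.-tuple E -> R) : measurable_fun setT f ->
  \int[path_law X n]_x f x = \int[P]_w ev f s w.
Proof.
move=> mf; rewrite -(Rintegral_distribution P (window X s n))//.
by apply: eq_measure_Rintegral => A mA; exact: (chain_stationary _ _ _ chainX).
Qed.

Lemma ge0_integral_path n s (f : n.-tuple E -> \bar R) :
  measurable_fun setT f -> (forall x, (0 <= f x)%E) ->
  (\int[path_law X n]_x f x = \int[P]_w f (window X s n w))%E.
Proof.
move=> mf f0; rewrite -(@ge0_integral_distribution _ _ _ _ _ P (window X s n))//.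
by apply: eq_measure_integral => A mA _; exact: (chain_stationary _ _ _ chainX).
Qed.

Lemma integrable_path n s (f : n.-tuple E -> R) : measurable_fun setT f ->
  (path_law X n).-integrable setT (EFin \o f) <-> P.-integrable setT (EFin \o ev f s).
Proof.
move=> mf; have mev := measurable_ev n f s mf.
have E1 : (\int[path_law X n]_x `|(f x)%:E| = \int[P]_w `|(ev f s w)%:E|)%E.
  apply: (ge0_integral_path n s (fun x => `|(f x)%:E|%E)) => //.
  by apply/measurable_EFinP; exact: measurableT_comp.
split=> /integrableP[_ If]; apply/integrableP; split; try exact/measurable_EFinP.
  by rewrite /= -E1.
by rewrite /= E1.
Qed.

Lemma L2_evP n s (f : n.-tuple E -> R) : measurable_fun setT f ->
  L2 (path_law X n) f <-> L2 P (ev f s).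
Proof.
move=> mf; have mev := measurable_ev n f s mf.
split=> /L2P[_ If]; apply/L2P; split => //.
  by apply/(integrable_path n s (fun x => f x ^+ 2)) => //; exact: measurable_funX.
by apply/(integrable_path n s (fun x => f x ^+ 2)) => //; exact: measurable_funX.
Qed.

Lemma L2_ev n s (f : n.-tuple E -> R) : L2 (path_law X n) f -> L2 P (ev f s).
Proof. by move=> Lf; apply/(L2_evP n s f) => //; exact: L2_measurable Lf. Qed.

Lemma inner_path n s (f g : n.-tuple E -> R) :
  measurable_fun setT f -> measurable_fun setT g ->
  inner (path_law X n) f g = inner P (ev f s) (ev g s).
Proof. by move=> mf mg; rewrite /inner (Rintegral_path n s)//; exact: measurable_funM. Qed.

Lemma common_window (s t : int) (m n : nat) : exists r N a b,
  [/\ s = r + a%:Z, t = r + b%:Z, (a + m <= N)%N & (b + n <= N)%N].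
Proof.
have [st|ts] := leP s t.
  exists s, (m + `|(t - s)%R| + n)%N, 0%N, `|(t - s)%R|%N.
  by split; lia.
exists t, (m + `|(s - t)%R| + n)%N, `|(s - t)%R|%N, 0%N.
by split; lia.
Qed.

(** One longer window contains both, and stationarity of its law moves them together. *)
Lemma inner_ev_shift (a s t : int) m n (f : m.-tuple E -> R) (g : n.-tuple E -> R) :
  measurable_fun setT f -> measurable_fun setT g ->
  inner P (ev f (s + a)) (ev g (t + a)) = inner P (ev f s) (ev g t).
Proof.
move=> mf mg; have [r [N [i [j [-> -> im jn]]]]] := common_window s t m n.
rewrite -!(addrAC r a) -!(ev_block _ _ N)// -!inner_path//.
- by apply: measurableT_comp => //; exact: measurable_block.
- by apply: measurableT_comp => //; exact: measurable_block.
- by apply: measurableT_comp => //; exact: measurable_block.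
- by apply: measurableT_comp => //; exact: measurable_block.
Qed.

(** For 0 < n, a version of the conditional expectation given the first n coordinates. For n = 0 the
    kernel would be taken at the default [point], so the lemmas below assume 0 < n. *)
Definition cond_exp_next {n} (f : n.+1.-tuple E -> R) : n.-tuple E -> R :=
  fun x => \int[K (last point x)]_z f [tuple of rcons x z].
Local Notation cond_next := cond_exp_next.

Lemma past_window (s t : int) n : s + n%:Z <= t + 1 ->
  measurable_fun setT
    (window X s n : g_sigma_algebraType [set F | exists (s : int) (A : set E),
        [/\ s <= t, measurable A & F = X s @^-1` A] ] -> n.-tuple E).
Proof.
move=> snt; apply/measurable_fun_tnthP => j.
rewrite (_ : _ \o _ = X (s + j%:Z)); last first.
  by apply/funext => w /=; rewrite tnth_mktuple.
move=> _ A mA; rewrite setTI; apply: sub_sigma_algebra.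
by exists (s + j%:Z), A; split => //; have := ltn_ord j; lia.
Qed.

(** * The Markov property at the right end of a window *)

Section markov.
Variables (n p : nat) (s t : int).
Hypothesis n0 : (0 < n)%N.
Hypothesis tpsn : t + p%:Z <= s + n%:Z.

(** The second window carries a test function. It must end by time s + n - 1, but it may start
    before s. *)
Let V w := (window X s n w, window X t p w).
Let Y := X (s + n.-1%:Z).

Let mV : measurable_fun setT V.
Proof. by apply/measurable_fun_pairP; split; exact: measurable_window. Qed.

Let Y'E : X (s + n%:Z) = X (s + n.-1%:Z + 1).
Proof. by congr X; lia. Qed.

Let disint (B : set (n.-tuple E * p.-tuple E)) (A : set E) :
  measurable B -> measurable A ->
  P (V @^-1` B `&` X (s + n%:Z) @^-1` A) = (\int[P]_(w in V @^-1` B) K (Y w) A)%E.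
Proof.
move=> mB mA; rewrite Y'E; apply: (chain_markov _ _ _ chainX) => //.
pose G := [set F | exists (s0 : int) (A : set E),
        [/\ s0 <= s + n.-1%:Z, measurable A & F = X s0 @^-1` A] ].
have mVG : measurable_fun setT (V : g_sigma_algebraType G -> _).
  by apply/measurable_fun_pairP; split; apply: past_window; lia.
by have := mVG measurableT B mB; rewrite setTI.
Qed.

Let last_s w : last point (window X s n w) = Y w.
Proof. exact: last_window_gt0. Qed.

Let mY : measurable_fun setT Y. Proof. by []. Qed.
Let mY' : measurable_fun setT (X (s + n%:Z)). Proof. by []. Qed.

Lemma markov_next (phi : n.+1.-tuple E -> p.-tuple E -> R) :
  measurable_fun setT (fun q : n.+1.-tuple E * p.-tuple E => phi q.1 q.2) ->
  P.-integrable setT (EFin \o (fun w => phi (window X s n.+1 w) (window X t p w))) ->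
  [/\ {ae P, forall w, (K (X (s + n.-1%:Z) w)).-integrable setT
         (EFin \o (fun z => phi [tuple of rcons (window X s n w) z] (window X t p w)))},
      measurable_fun setT (fun w => \int[K (last point (window X s n w))]_z
         phi [tuple of rcons (window X s n w) z] (window X t p w)) &
      \int[P]_w phi (window X s n.+1 w) (window X t p w) =
      \int[P]_w \int[K (last point (window X s n w))]_z
         phi [tuple of rcons (window X s n w) z] (window X t p w)].
Proof.
move=> mphi iphi.
pose psi (q : (n.-tuple E * p.-tuple E) * E) := phi [tuple of rcons q.1.1 q.2] q.1.2.
have mpsi : measurable_fun setT psi.
  pose h (q : (n.-tuple E * p.-tuple E) * E) := ([tuple of rcons q.1.1 q.2], q.1.2).
  have mh : measurable_fun setT h.
    apply/measurable_fun_pairP; split.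
      apply: (@measurableT_comp _ _ _ _ _ _ (fun p : n.-tuple E * E => [tuple of rcons p.1 p.2]) _
         (fun q : (n.-tuple E * p.-tuple E) * E => (q.1.1, q.2))).
        exact: measurable_rcons.
      apply/measurable_fun_pairP; split; last exact: measurable_snd.
      exact: (@measurableT_comp _ _ _ _ _ _ fst _ fst).
    exact: (@measurableT_comp _ _ _ _ _ _ snd _ fst).
  exact: (@measurableT_comp _ _ _ _ _ _ (fun q : n.+1.-tuple E * p.-tuple E => phi q.1 q.2) _ h).
have psiE w : phi (window X s n.+1 w) (window X t p w) = psi (V w, X (s + n%:Z) w).
  by rewrite /psi/= -window_rcons.
have ipsi : P.-integrable setT (EFin \o (fun w => psi (V w, X (s + n%:Z) w))).
  by apply: eq_integrable iphi => // w _ /=; rewrite psiE.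
have Kae := disintegration_integrable_ae P K V Y (X (s + n%:Z)) mV mY mY' disint psi mpsi ipsi.
have mK := measurable_kernel_Rintegral K V Y mV mY psi mpsi.
split => //.
- by under eq_fun do rewrite last_s.
- under eq_Rintegral do rewrite psiE.
  rewrite (disintegration P K V Y (X (s + n%:Z)) mV mY mY' disint psi mpsi ipsi).
  by under [RHS]eq_Rintegral do rewrite last_s.
Qed.

Lemma markov_next_ge0 (phi : n.+1.-tuple E -> \bar R) :
  measurable_fun setT phi -> (forall x, (0 <= phi x)%E) ->
  (\int[P]_w phi (window X s n.+1 w) =
   \int[P]_w \int[K (last point (window X s n w))]_z phi [tuple of rcons (window X s n w) z])%E.
Proof.
move=> mphi phi0.
pose psi (q : (n.-tuple E * p.-tuple E) * E) := phi [tuple of rcons q.1.1 q.2].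
have mpsi : measurable_fun setT psi.
  apply: (@measurableT_comp _ _ _ _ _ _ phi _
     (fun q : (n.-tuple E * p.-tuple E) * E => [tuple of rcons q.1.1 q.2])) => //.
  apply: (@measurableT_comp _ _ _ _ _ _ (fun p : n.-tuple E * E => [tuple of rcons p.1 p.2]) _
         (fun q : (n.-tuple E * p.-tuple E) * E => (q.1.1, q.2))).
    exact: measurable_rcons.
  apply/measurable_fun_pairP; split; last exact: measurable_snd.
  exact: (@measurableT_comp _ _ _ _ _ _ fst _ fst).
under eq_integral do rewrite window_rcons.
have := ge0_disintegration P K V Y (X (s + n%:Z)) mV mY mY' disint psi mpsi (fun q => phi0 _).
by rewrite /psi/= => ->; under [RHS]eq_integral do rewrite last_s.
Qed.

End markov.

Lemma measurable_cond_next n (f : n.+1.-tuple E -> R) : (0 < n)%N ->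
  measurable_fun setT f -> measurable_fun setT (cond_next f).
Proof.
move=> n0 mf.
apply: (@measurable_kernel_Rintegral _ _ _ _ (n.-tuple E) (n.-tuple E) E E R K id
  (fun x => last point x) _ _ (fun p => f [tuple of rcons p.1 p.2])) => //.
  exact: measurable_last.
by apply: measurableT_comp mf _; exact: measurable_rcons.
Qed.

(** By Jensen for the kernel, the square of the conditional expectation is at most the conditional
    expectation of f ^ 2, whose integral is that of f ^ 2. *)
Lemma L2_cond_next n (f : n.+1.-tuple E -> R) : (0 < n)%N ->
  L2 (path_law X n.+1) f -> L2 (path_law X n) (cond_next f).
Proof.
move=> n0 /L2P[mf /integrableP[_ If]].
have mc := measurable_cond_next n f n0 mf.
have mf2 : measurable_fun setT (fun x => (f x ^+ 2)%:E).
  by apply/measurable_EFinP; exact: measurable_funX.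
apply/L2P; split => //; apply/integrableP; split.
  by apply/measurable_EFinP; exact: measurable_funX.
apply: le_lt_trans If.
under eq_integral do rewrite /= ger0_norm ?sqr_ge0//.
under [leRHS]eq_integral do rewrite /= ger0_norm ?sqr_ge0//.
rewrite (ge0_integral_path n.+1 0 (fun x => (f x ^+ 2)%:E))//; last first.
  by move=> x; rewrite lee_fin sqr_ge0.
have tpsn : 0 + 0%:Z <= 0 + n%:Z by lia.
rewrite (markov_next_ge0 n 0 0 0 n0 tpsn (fun x => (f x ^+ 2)%:E))//; last first.
  by move=> x; rewrite lee_fin sqr_ge0.
rewrite (ge0_integral_path n 0 (fun x => (cond_next f x ^+ 2)%:E))//; last 2 first.
- by apply/measurable_EFinP; exact: measurable_funX.
- by move=> x; rewrite lee_fin sqr_ge0.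
apply: ge0_le_integral => //.
- by move=> w _; rewrite lee_fin sqr_ge0.
- apply/measurable_EFinP; apply: measurable_funX.
  exact: (measurable_ev n (cond_next f)).
- apply: (@measurable_kernel_integral _ _ _ _ Omega (n.-tuple E) E E R K (window X 0 n)
    (fun w => last point (window X 0 n w)) _ _ (fun p => (f [tuple of rcons p.1 p.2] ^+ 2)%:E)) => //.
  + rewrite (_ : (fun _ => _) = X (0 + n.-1%:Z))//.
    by apply/funext => w; rewrite last_window_gt0.
  + apply/measurable_EFinP; apply: measurable_funX.
    by apply: measurableT_comp mf _; exact: measurable_rcons.
  + by move=> p; rewrite lee_fin sqr_ge0.
- move=> w _; apply: (kernel_sqr_Rintegral_le K _ (fun z => f [tuple of rcons (window X 0 n w) z])).
  apply: measurableT_comp mf _.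
  apply: (@measurableT_comp _ _ _ _ _ _ (fun p : n.-tuple E * E => [tuple of rcons p.1 p.2]) _
         (fun z => (window X 0 n w, z))); first exact: measurable_rcons.
  exact: pair1_measurable.
Qed.

(** The window of g ends before time s + n, the time of the last coordinate of f, so that coordinate
    can be integrated out. *)
Lemma inner_cond_next n p (f : n.+1.-tuple E -> R) (g : p.-tuple E -> R) (s t : int) :
  (0 < n)%N -> t + p%:Z <= s + n%:Z ->
  L2 (path_law X n.+1) f -> L2 (path_law X p) g ->
  inner P (ev f s) (ev g t) = inner P (ev (cond_next f) s) (ev g t).
Proof.
move=> n0 tpsn Lf Lg.
have mf := L2_measurable _ _ Lf; have mg := L2_measurable _ _ Lg.
have mfg : measurable_fun setT (fun q : n.+1.-tuple E * p.-tuple E => f q.1 * g q.2).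
  by apply: measurable_funM; [exact: (@measurableT_comp _ _ _ _ _ _ f _ fst)
    | exact: (@measurableT_comp _ _ _ _ _ _ g _ snd)].
have ifg := L2_mul_integrable P _ _ (L2_ev _ s _ Lf) (L2_ev _ t _ Lg).
have [_ mK E1] := markov_next n p s t n0 tpsn (fun x y => f x * g y) mfg ifg.
rewrite [LHS]E1.
have mf1 : measurable_fun setT (fun q : n.+1.-tuple E * p.-tuple E => f q.1).
  exact: (@measurableT_comp _ _ _ _ _ _ f _ fst).
have [Kae _ _] := markov_next n p s t n0 tpsn (fun x y => f x) mf1 (L2_integrable P _ (L2_ev _ s _ Lf)).
apply: ae_eq_Rintegral => //.
  by apply: measurable_funM; apply: measurable_ev => //; exact: measurable_cond_next.
apply: filterS Kae => w Kw _; rewrite RintegralZr//.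
by rewrite last_window_gt0.
Qed.

(** * Time reversal of the path law from self-adjointness of the kernel *)

Section reversal.
Hypothesis reversible : self_adjoint nu (L2 nu) (kernel_op K).

(** A class stable under the kernel and under multiplication by indicators, and contained in L^2 of
    every probability, so that self-adjointness applies to every function built from a box. *)
Definition unit_valued {dT} {T : measurableType dT} (v : T -> R) :=
  measurable_fun setT v /\ forall x, 0 <= v x <= 1.

Lemma unit_valued_integrable {dT} {T : measurableType dT}
    (mu : {measure set T -> \bar R}) v : (mu setT < +oo)%E ->
  unit_valued v -> mu.-integrable setT (EFin \o v).
Proof.
move=> mu_fin [mv v01]; apply: measurable_bounded_integrable => //.
exists 1; split; first exact: num_real.
move=> x x1 y _; rewrite /= ger0_norm; last by have /andP[] := v01 y.
by have /andP[_ /le_trans] := v01 y; apply; exact: ltW.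
Qed.

Lemma unit_valued_L2 {dT} {T : measurableType dT} (mu : probability T R) v :
  unit_valued v -> L2 mu v.
Proof.
move=> [mv v01]; apply/L2P; split => //.
apply: (unit_valued_integrable mu (fun x => v x ^+ 2)).
  exact: le_lt_trans (probability_le1 mu measurableT) (ltry _).
split; first exact: measurable_funX.
by move=> x; have /andP[v0 v1] := v01 x; rewrite sqr_ge0 expr_le1.
Qed.

Lemma unit_valued_cst1 : unit_valued (cst 1 : E -> R).
Proof. by split => // x; rewrite ler01 lexx. Qed.

Lemma unit_valued_indicM (A : set E) (v : E -> R) : measurable A -> unit_valued v ->
  unit_valued (fun x => \1_A x * v x).
Proof.
move=> mA [mv v01]; split; first exact: measurable_funM.
move=> x; have := v01 x; rewrite indicE; case: (x \in A); rewrite ?mul1r//.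
by rewrite mul0r lexx ler01.
Qed.

Lemma kernel_op1 : kernel_op K (cst 1) = cst 1.
Proof.
apply/funext => x; rewrite /kernel_op.
transitivity (1 * fine (K x setT)); first exact: Rintegral_cst.
by rewrite prob_kernel mul1r.
Qed.

Lemma measurable_kernel_op v : measurable_fun setT v -> measurable_fun setT (kernel_op K v).
Proof.
move=> mv; apply: (@measurable_kernel_Rintegral _ _ _ _ E E E E R K id id _ _
  (fun p => v p.2)) => //.
exact: (@measurableT_comp _ _ _ _ _ _ v _ snd).
Qed.

Lemma unit_valued_kernel_op (v : E -> R) : unit_valued v -> unit_valued (kernel_op K v).
Proof.
move=> uv; have [mv v01] := uv; split; first exact: measurable_kernel_op.
move=> x; apply/andP; split.
  by apply: Rintegral_ge0 => y _; have /andP[] := v01 y.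
have Kfin : (K x setT < +oo)%E by rewrite prob_kernel ltry.
have -> : 1 = kernel_op K (cst 1) x by rewrite kernel_op1.
apply: le_Rintegral => //.
- exact: unit_valued_integrable.
- exact: (unit_valued_integrable _ _ Kfin unit_valued_cst1).
- by move=> y _; have /andP[] := v01 y.
Qed.

(** Folding over A_1, ..., A_n gives 1_{A_1} K (1_{A_2} K (... 1_{A_n} K v)): the expectation, for
    the chain started at x, of the indicator that the first n states lie in A_1, ..., A_n times v of
    the next state. *)
Definition path_step (A : set E) (v : E -> R) : E -> R :=
  fun x => \1_A x * kernel_op K v x.

Lemma unit_valued_foldr s (v : E -> R) : (forall A, A \in s -> measurable A) -> unit_valued v ->
  unit_valued (foldr path_step v s).
Proof.
move=> + uv; elim: s => //= A s IH ms; apply: unit_valued_indicM.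
  by apply: ms; rewrite inE eqxx.
by apply/unit_valued_kernel_op/IH => B Bs; apply: ms; rewrite inE Bs orbT.
Qed.

(* Self-adjointness moves one kernel at a time to the other side. *)
Lemma inner_foldr_rev s (u v : E -> R) : (forall A, A \in s -> measurable A) ->
  unit_valued u -> unit_valued v ->
  inner nu u (kernel_op K (foldr path_step v s)) =
  inner nu (kernel_op K (foldr path_step u (rev s))) v.
Proof.
elim: s u => [|A s IH] u ms uu uv /=.
  by rewrite reversible//; exact: unit_valued_L2.
have mA : measurable A by apply: ms; rewrite inE eqxx.
have ms' B : B \in s -> measurable B by move=> Bs; apply: ms; rewrite inE Bs orbT.
have uF := unit_valued_foldr s v ms' uv.
have uKF := unit_valued_kernel_op _ uF.
have uAKF := unit_valued_indicM A _ mA uKF.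
have uAu : unit_valued (path_step A u).
  by apply: unit_valued_indicM => //; exact: unit_valued_kernel_op.
rewrite rev_cons foldr_rcons -(IH (path_step A u) ms' uAu uv).
rewrite -[LHS](reversible u _ (unit_valued_L2 nu _ uu) (unit_valued_L2 nu _ uAKF)).
by rewrite /inner; apply: eq_Rintegral => x _; rewrite /path_step; ring.
Qed.

(** This is [inner_foldr_rev] with 1 at both ends. The additional outer kernel disappears because K
    is self-adjoint and K 1 = 1. *)
Lemma Rintegral_foldr_rev s : (forall A, A \in s -> measurable A) ->
  \int[nu]_x foldr path_step (cst 1) s x =
  \int[nu]_x foldr path_step (cst 1) (rev s) x.
Proof.
move=> ms.
have u1 := unit_valued_cst1.
have L1 := unit_valued_L2 nu _ u1.
have L r : (forall A, A \in r -> measurable A) ->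
    \int[nu]_x foldr path_step (cst 1) r x =
    inner nu (cst 1) (kernel_op K (foldr path_step (cst 1) r)).
  move=> mr; have Lr := unit_valued_L2 nu _ (unit_valued_foldr r _ mr u1).
  rewrite -(reversible _ _ L1 Lr).
  by rewrite kernel_op1; apply: eq_Rintegral => x _; rewrite mul1r.
have mrev A : A \in rev s -> measurable A by rewrite mem_rev => /ms.
by rewrite (L _ ms) (L _ mrev) (inner_foldr_rev s _ _ ms u1 u1) innerC.
Qed.

Lemma Rintegral_marginal (t : int) (v : E -> R) : measurable_fun setT v ->
  \int[P]_w v (X t w) = \int[nu]_x v x.
Proof.
move=> mv; rewrite -(Rintegral_distribution P (X t))//.
by apply: eq_measure_Rintegral => A mA; exact: (chain_marginal _ _ _ chainX).
Qed.

Lemma measurable_prod_indic n (s : seq (set E)) : (forall A, A \in s -> measurable A) ->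
  measurable_fun setT (fun y : n.-tuple E => \prod_(i < n) (\1_(nth setT s i) (tnth y i) : R)).
Proof.
move=> ms; apply: measurable_prod => i _.
apply: (measurableT_comp _ (measurable_tnth i)); apply: measurable_indic.
have [is_|si] := ltnP i (size s); first exact/ms/mem_nth.
by rewrite nth_default.
Qed.

(** The terminal factor v makes an induction at the right end possible: conditioning turns v into K
    v, and the last indicator then turns K v into [path_step A v], the terminal factor for the
    shorter list. *)
Lemma path_product (t : int) (s : seq (set E)) (v : E -> R) :
  (forall A, A \in s -> measurable A) -> unit_valued v ->
  \int[P]_w (\prod_(i < size s) \1_(nth setT s i) (X (t + i%:Z) w) *
    v (X (t + (size s)%:Z) w)) = \int[nu]_x foldr path_step v s x.
Proof.
elim/last_ind: s v => [|s A IH] v ms uv.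
  rewrite /=; under eq_Rintegral do rewrite big_ord0 mul1r.
  by apply: Rintegral_marginal; case: uv.
have ms' B : B \in s -> measurable B by move=> Bs; apply: ms; rewrite mem_rcons inE Bs orbT.
have mA : measurable A by apply: ms; rewrite mem_rcons inE eqxx.
have uKv := unit_valued_kernel_op v uv.
rewrite foldr_rcons -(IH (path_step A v) ms' (unit_valued_indicM A _ mA uKv)).
(* v is read as a function of two consecutive states, since conditioning must leave at least one
   coordinate. *)
pose f (y : 2.-tuple E) := v (tnth y ord_max).
pose g (y : (size s).+1.-tuple E) :=
  \prod_(i < (size s).+1) (\1_(nth setT (rcons s A) i) (tnth y i) : R).
have uf : unit_valued f.
  case: uv => mv v01; split; last by move=> y; exact: v01.
  by apply: (measurableT_comp mv); exact: measurable_tnth.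
have ug : unit_valued g.
  split; first by apply: measurable_prod_indic.
  move=> y; rewrite prodr_ge0/= => [|i _]; last by rewrite indicE.
  by apply: prodr_ile1 => i _; rewrite indicE; case: (_ \in _); rewrite ?lexx ler01.
transitivity (inner P (ev f (t + (size s)%:Z)) (ev g t)).
  apply: eq_Rintegral => w _; rewrite size_rcons mulrC /ev /f /g/=; congr (_ * _).
    by rewrite tnth_mktuple /= -addrA -PoszD addn1.
  by apply: eq_bigr => i _; rewrite tnth_mktuple.
have ts : t + ((size s).+1)%:Z <= t + (size s)%:Z + 1 by lia.
rewrite (inner_cond_next 1 _ f g _ _ isT ts); [|exact: unit_valued_L2..].
apply: eq_Rintegral => w _.
have -> : ev (cond_next f) (t + (size s)%:Z) w = kernel_op K v (X (t + (size s)%:Z) w).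
  have f_rcons (y : 1.-tuple E) z : f [tuple of rcons y z] = v z.
    by rewrite /f (tnth_nth point)/= nth_rcons size_tuple.
  transitivity (\int[K (last point (window X (t + (size s)%:Z) 1 w))]_z
    f [tuple of rcons (window X (t + (size s)%:Z) 1 w) z]) => //.
  by rewrite last_window addr0; apply: eq_Rintegral => z _; rewrite f_rcons.
have -> : ev g t w = \prod_(i < (size s).+1)
  \1_(nth setT (rcons s A) i) (tnth (window X t (size s).+1 w) i) by [].
rewrite big_ord_recr/= tnth_mktuple nth_rcons ltnn eqxx.
rewrite mulrC -mulrA /path_step; congr (_ * _); apply: eq_bigr => i _.
by rewrite tnth_mktuple/= nth_rcons ltn_ord.
Qed.

(** Boxes generate the sigma-algebra and are stable under intersection. The mass of a box is an
    iterated kernel integral, which [Rintegral_foldr_rev] identifies with that of the reversed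
    box. *)
Lemma path_law_rev n (A : set (n.-tuple E)) : measurable A ->
  path_law X n A = path_law X n (rev_path @^-1` A).
Proof.
pose box (s : n.-tuple (set E)) := [set y : n.-tuple E | forall i, tnth s i (tnth y i)].
pose G := [set B | exists2 s : n.-tuple (set E), (forall i, measurable (tnth s i)) & B = box s].
have mbox s : (forall i, measurable (tnth s i)) -> measurable (box s).
  move=> ms; rewrite (_ : box s = \bigcap_(i in [set: 'I_n]) ((tnth (T:=E))^~ i @^-1` tnth s i)).
    apply: fin_bigcap_measurable => // i _; rewrite -[X in measurable X]setTI.
    exact: measurable_tnth.
  by apply/seteqP; split=> y /= ys i; [move=> _; exact: ys|exact: ys].
have path_box (s : n.-tuple (set E)) : (forall i, measurable (tnth s i)) ->
    path_law X n (box s) = (\int[nu]_x foldr path_step (cst 1) s x)%:E.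
  move=> ms.
  have ms' B : B \in (s : seq _) -> measurable B by move=> /tnthP[i ->].
  rewrite -(path_product 0 s (cst 1) ms' unit_valued_cst1).
  transitivity (\int[path_law X n]_y (\1_(box s) y : R))%:E.
    by rewrite /Rintegral integral_indic ?setIT ?fineK ?fin_num_measure//; exact: mbox.
  rewrite (Rintegral_path n 0); last by apply: measurable_indic; exact: mbox.
  congr EFin; rewrite size_tuple; apply: eq_Rintegral => w _; rewrite mulr1 /ev/= indicE.
  have [|] := boolP (_ \in box s).
    move=> /set_mem ys; rewrite big1// => i _.
    rewrite indicE mem_set// -(tnth_nth setT).
    by have := ys i; rewrite tnth_mktuple.
  move=> ys; apply/esym/eqP; rewrite prodf_seq_eq0; apply/hasP.
  apply: contra_notP (negP ys) => nh; apply/mem_set => i; rewrite tnth_mktuple.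
  apply: contrapT => si; apply: nh; exists i => /=; first by rewrite mem_index_enum.
  rewrite indicE -(tnth_nth setT) memNset//.
move=> mA; apply: (measure_unique G (fun=> setT) _ _ _ _ (path_law X n)
  (distribution (path_law X n) rev_path)) => //.
- apply/seteqP; split.
    apply: smallest_sub; first exact: smallest_sigma_algebra.
    move=> B; rewrite -bigcup_seq => -[i _ [C mC <-]]; apply: sub_sigma_algebra.
    exists [tuple if j == i then C else setT | j < n].
      by move=> j; rewrite tnth_mktuple; case: ifP.
    apply/seteqP; split=> y /=.
      by move=> [_ yC] j; rewrite tnth_mktuple; case: eqP => // ->.
    by move=> /(_ i); rewrite tnth_mktuple eqxx.
  apply: smallest_sub; first exact: sigma_algebra_measurable.
  by move=> _ [s ms ->]; exact: mbox.
- move=> _ _ [s ms ->] [r mr ->].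
  exists [tuple tnth s i `&` tnth r i | i < n].
    by move=> i; rewrite tnth_mktuple; exact: measurableI.
  apply/seteqP; split=> y /=.
    by move=> [ys yr] i; rewrite tnth_mktuple; split; [exact: ys|exact: yr].
  by move=> y_; split=> i; have := y_ i; rewrite tnth_mktuple => -[].
- move=> _; exists [tuple setT | i < n] => [i|]; first by rewrite tnth_mktuple.
  by apply/seteqP; split=> y // _ i; rewrite tnth_mktuple.
- by apply/seteqP; split => // x _; exists 0%N.
- move=> _ [s ms ->].
  have mrs i : measurable (tnth [tuple of rev s] i).
    by rewrite tnth_rev.
  transitivity (path_law X n (box [tuple of rev s])).
    apply: (etrans (path_box s ms)); apply: (etrans _ (esym (path_box _ mrs))); congr EFin; apply: Rintegral_foldr_rev.
    by move=> B /tnthP[i ->].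
  rewrite /distribution /pushforward; congr (path_law X n _); apply/seteqP; split=> y /= ys i.
    by have := ys (rev_ord i); rewrite tnth_rev rev_ordK /rev_path tnth_rev.
  by have := ys (rev_ord i); rewrite /rev_path !tnth_rev rev_ordK.
- by move=> _; apply: le_lt_trans (probability_le1 (path_law X n) measurableT) (ltry _).
Qed.

Lemma Rintegral_path_rev n s (f : n.-tuple E -> R) : measurable_fun setT f ->
  \int[path_law X n]_x f x = \int[P]_w ev (f \o rev_path) s w.
Proof.
move=> mf; rewrite -Rintegral_path; last exact: measurableT_comp.
rewrite -(Rintegral_distribution (path_law X n) rev_path f mf).
by apply: eq_measure_Rintegral => A mA; exact: path_law_rev.
Qed.

(** Time r is reflected to -1 - r, so the window occupying s, ..., s + m - 1 becomes the one
    starting at - s - m. *)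
Lemma inner_ev_rev (s t : int) m n (f : m.-tuple E -> R) (g : n.-tuple E -> R) :
  measurable_fun setT f -> measurable_fun setT g ->
  inner P (ev f s) (ev g t) =
  inner P (ev (f \o rev_path) (- s - m%:Z)) (ev (g \o rev_path) (- t - n%:Z)).
Proof.
move=> mf mg; have [r [N [i [j [-> -> im jn]]]]] := common_window s t m n.
have mfi : measurable_fun setT (f \o block i m N).
  by apply: measurableT_comp => //; exact: measurable_block.
have mgj : measurable_fun setT (g \o block j n N).
  by apply: measurableT_comp => //; exact: measurable_block.
rewrite -!(ev_block _ _ N)// -inner_path// /inner.
rewrite (Rintegral_path_rev N (- r - N%:Z)); last exact: measurable_funM.
apply: eq_Rintegral => w _; rewrite /ev/= !block_rev// !block_window ?subnK//; [|lia..].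
by congr (f (rev_path (window X _ m w)) * g (rev_path (window X _ n w))); lia.
Qed.

(** Under reversibility and for 0 < n, the conditional expectation given the last n coordinates; it
    is therefore read on a window that starts one step later than that of f. *)
Definition cond_exp_prev {n} (f : n.+1.-tuple E -> R) : n.-tuple E -> R :=
  cond_next (f \o rev_path) \o rev_path.
Local Notation cond_prev := cond_exp_prev.

Lemma L2_rev n (f : n.-tuple E -> R) :
  L2 (path_law X n) f -> L2 (path_law X n) (f \o rev_path).
Proof.
move=> Lf; have mf := L2_measurable _ _ Lf.
have mfr : measurable_fun setT (f \o rev_path) by exact: measurableT_comp.
move/L2P: Lf => [_ /integrableP[_ If]]; apply/L2P; split => //.
apply/integrableP; split; first by apply/measurable_EFinP; exact: measurable_funX.
apply: le_lt_trans If.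
have mf2 : measurable_fun setT (fun x => `|(f x ^+ 2)%:E|%E).
  by apply: measurableT_comp => //; apply/measurable_EFinP; exact: measurable_funX.
rewrite -(@ge0_integral_distribution _ _ _ _ _ (path_law X n) rev_path
  (fun x => `|(f x ^+ 2)%:E|%E))//.
rewrite (eq_measure_integral (path_law X n))// => A mA _.
by apply/esym; exact: path_law_rev.
Qed.

Lemma L2_cond_prev n (f : n.+1.-tuple E -> R) : (0 < n)%N ->
  L2 (path_law X n.+1) f -> L2 (path_law X n) (cond_prev f).
Proof. by move=> n0 Lf; exact/L2_rev/L2_cond_next/L2_rev. Qed.

(** Reversal sends the window of g, which starts after time s, into the past of the coordinate to be
    integrated out, where [inner_cond_next] applies. *)
Lemma inner_cond_prev n p (f : n.+1.-tuple E -> R) (g : p.-tuple E -> R) (s t : int) :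
  (0 < n)%N -> s + 1 <= t ->
  L2 (path_law X n.+1) f -> L2 (path_law X p) g ->
  inner P (ev f s) (ev g t) = inner P (ev (cond_prev f) (s + 1)) (ev g t).
Proof.
move=> n0 st Lf Lg.
have mf := L2_measurable _ _ Lf; have mg := L2_measurable _ _ Lg.
rewrite inner_ev_rev// inner_cond_next//; [|lia|exact: L2_rev..].
rewrite [RHS](inner_ev_rev _ _ _ _ (cond_prev f) g (L2_measurable _ _ (L2_cond_prev n f n0 Lf)) mg).
have -> : - s - n.+1%:Z = - (s + 1) - n%:Z by lia.
suff -> : ev (cond_prev f \o rev_path) (- (s + 1) - n%:Z) =
  ev (cond_next (f \o rev_path)) (- (s + 1) - n%:Z) by [].
by apply/funext => w; rewrite /ev /cond_prev/= rev_pathK.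
Qed.

End reversal.

End chain.

(** * The Green--Kubo operator *)

Section path_spaces.
Context {d} {E : measurableType d} {R : realType} {nu : probability E R}
  {K : R.-pker E ~> E} {d'} {Omega : measurableType d'} {P : probability Omega R}
  {X : int -> {RV P >-> E}}.
Hypothesis chainX : stationary_markov_chain X nu K.
Hypothesis reversible : self_adjoint nu (L2 nu) (kernel_op K).
Local Notation ev := (@window_fun _ _ _ _ _ _ X _).
Local Notation cond_next := (@cond_exp_next _ _ _ K _).
Local Notation cond_prev := (@cond_exp_prev _ _ _ K _).

Lemma path_space_L2 n f : path_space X n f -> L2 (path_law X n) f.
Proof. by case. Qed.

Lemma path_space_measurable n f : path_space X n f -> measurable_fun setT f.
Proof. by move=> /path_space_L2; exact: L2_measurable. Qed.

Lemma path_space_ev n s f : path_space X n f -> L2 P (ev f s).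
Proof. by move=> /path_space_L2; exact: (L2_ev chainX). Qed.

Lemma path_spaceP n s f : path_space X n f <->
  L2 (path_law X n) f /\ inner P (ev f s) (cst 1) = 0.
Proof.
suff E1 : L2 (path_law X n) f -> \int[path_law X n]_x f x = inner P (ev f s) (cst 1).
  by split=> -[Lf f0]; split; rewrite ?E1// -?E1.
move=> Lf; rewrite (Rintegral_path chainX n s); last exact: L2_measurable Lf.
by apply: eq_Rintegral => w _; rewrite mulr1.
Qed.

Lemma path_space_comb n a f g : path_space X n f -> path_space X n g ->
  path_space X n (fun x => a * f x + g x).
Proof.
move=> Hf Hg.
have Lf := path_space_ev _ 0 _ Hf; have Lg := path_space_ev _ 0 _ Hg.
have [Lf' f0] := (path_spaceP n 0 f).1 Hf; have [Lg' g0] := (path_spaceP n 0 g).1 Hg.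
apply/(path_spaceP n 0); split; first exact: L2_comb.
transitivity (inner P (fun w => a * ev f 0 w + ev g 0 w) (cst 1)) => //.
by rewrite innerDl ?innerZl ?f0 ?g0 ?mulr0 ?addr0//; [exact: L2_cst|exact: L2_scale|exact: L2_cst].
Qed.

Lemma path_space0 n : path_space X n (cst 0).
Proof.
by apply/(path_spaceP n 0); split; [exact: L2_cst|rewrite -[RHS](inner0l P (cst 1))].
Qed.

Lemma path_spaceD n f g : path_space X n f -> path_space X n g ->
  path_space X n (fun x => f x + g x).
Proof.
move=> Hf Hg; rewrite (_ : (fun _ => _) = (fun x => 1 * f x + g x)).
  exact: path_space_comb.
by apply/funext => x; rewrite mul1r.
Qed.

Lemma path_spaceZ n a f : path_space X n f -> path_space X n (fun x => a * f x).
Proof.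
move=> Hf; rewrite (_ : (fun _ => _) = (fun x => a * f x + cst 0 x)).
  exact/path_space_comb/path_space0.
by apply/funext => x; rewrite addr0.
Qed.

Lemma path_spaceB n f g : path_space X n f -> path_space X n g ->
  path_space X n (fun x => f x - g x).
Proof.
move=> Hf Hg; rewrite (_ : (fun _ => _) = (fun x => -1 * g x + f x)).
  exact: path_space_comb.
by apply/funext => x; rewrite mulN1r addrC.
Qed.

Lemma path_space_sum n (I : Type) (r : seq I) (F : I -> n.-tuple E -> R) :
  (forall i, path_space X n (F i)) -> path_space X n (fun x => \sum_(i <- r) F i x).
Proof.
move=> HF; elim: r => [|i r IH].
  by under eq_fun do rewrite big_nil; exact: path_space0.
by under eq_fun do rewrite big_cons; exact: path_spaceD.
Qed.

Lemma path_space_block i m n f : (i + m <= n)%N ->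
  path_space X m f -> path_space X n (f \o block i m n).
Proof.
move=> imn /(path_spaceP m i) [Lf f0].
have mf := L2_measurable _ _ Lf.
have mfb : measurable_fun setT (f \o block i m n).
  by apply: measurableT_comp => //; exact: measurable_block.
apply/(path_spaceP n 0); rewrite (ev_block i m n f 0 imn) add0r; split => //.
by apply/(L2_evP chainX n 0) => //; rewrite ev_block// add0r; exact: (L2_ev chainX).
Qed.

Lemma path_space_cond_next n f : (0 < n)%N ->
  path_space X n.+1 f -> path_space X n (cond_next f).
Proof.
move=> n0 /(path_spaceP n.+1 0) [Lf f0]; apply/(path_spaceP n 0).
split; first exact: (L2_cond_next chainX).
rewrite -f0; have H : (0 : int) + 0%:Z <= 0 + n%:Z by lia.
by rewrite [RHS](inner_cond_next chainX n 0 f (cst 1) 0 0 n0 H Lf (L2_cst _ 1)).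
Qed.

Lemma path_space_cond_prev n f : (0 < n)%N ->
  path_space X n.+1 f -> path_space X n (cond_prev f).
Proof.
move=> n0 /(path_spaceP n.+1 0) [Lf f0]; apply/(path_spaceP n 1).
split; first exact: (L2_cond_prev chainX reversible).
rewrite -f0; have H : (0 : int) + 1 <= 1 by lia.
have L1 : L2 (path_law X 0) (cst 1) by exact: L2_cst.
by rewrite [RHS](inner_cond_prev chainX reversible n 0 f (cst 1) 0 1 n0 H Lf L1).
Qed.

End path_spaces.

(** * The form <B_k f, g> as a two-sided sum of correlations, and the kernel of B_k *)

Section green_kubo.
Context {d} {E : measurableType d} {R : realType} {nu : probability E R}
  {K : R.-pker E ~> E} {d'} {Omega : measurableType d'} {P : probability Omega R}
  {X : int -> {RV P >-> E}} {k : nat}.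
Hypothesis chainX : stationary_markov_chain X nu K.
Hypothesis k_gt0 : (0 < k)%N.
Hypothesis reversible : self_adjoint nu (L2 nu) (kernel_op K).
Local Notation ev := (@window_fun _ _ _ _ _ _ X _).
Local Notation cond_next := (@cond_exp_next _ _ _ K _).
Local Notation cond_prev := (@cond_exp_prev _ _ _ K _).
Local Notation H := (path_space X k).
Local Notation pi := (path_law X k).
Local Notation A := (transition_op K k).
Local Notation B := (transition_adj X K k).

(** Placing f on the last k of k + 1 coordinates exhibits P_k as a conditional expectation, to which
    the Markov lemmas apply. *)
Lemma transition_opE f : A f = cond_next (f \o block 1 k k.+1).
Proof.
apply/funext => x; rewrite /transition_op /cond_exp_next; apply: eq_Rintegral => z _ /=.
congr f; apply: eq_from_tnth => j; rewrite !tnth_mktuple /= nth_rcons size_tuple add1n.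
have [jk|jk] := ltnP j.+1 k; first by apply: set_nth_default; rewrite size_tuple.
have -> : j.+1 = k :> nat by have := ltn_ord j; lia.
by rewrite eqxx nth_default// size_tuple.
Qed.

Lemma path_space_transition f : H f -> H (A f).
Proof.
by move=> Hf; rewrite transition_opE; apply: (path_space_cond_next chainX) => //; exact: (path_space_block chainX).
Qed.

Lemma inner_transition n f (g : n.-tuple E -> R) s t : H f -> L2 (path_law X n) g ->
  t + n%:Z <= s + k%:Z -> inner P (ev (A f) s) (ev g t) = inner P (ev f (s + 1)) (ev g t).
Proof.
move=> Hf Lg tnsk; rewrite transition_opE -(inner_cond_next chainX)//; last first.
  exact/path_space_L2/(path_space_block chainX).
by rewrite ev_block.
Qed.

Lemma path_space_iter r f : H f -> H (iter r A f).
Proof. by move=> Hf; elim: r => //= r; exact: path_space_transition. Qed.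

Lemma inner_iter_transition r f g : H f -> H g ->
  inner pi (iter r A f) g = inner P (ev f r%:Z) (ev g 0).
Proof.
move=> Hf Hg; have HAf := path_space_iter r f Hf.
rewrite (inner_path chainX k 0); [|exact: path_space_measurable HAf|exact: path_space_measurable Hg].
(* Generalised over both times, because each application of P_k trades for a shift of s by 1; t <= s
   keeps g in the past. *)
suff IH s t : t <= s -> inner P (ev (iter r A f) s) (ev g t) = inner P (ev f (s + r%:Z)) (ev g t).
  by rewrite IH// add0r.
elim: r {HAf} s t => [|r IH] s t ts; first by rewrite addr0.
have tksk : t + k%:Z <= s + k%:Z by lia.
have ts1 : t <= s + 1 by lia.
rewrite iterS (inner_transition _ _ _ _ _ (path_space_iter r f Hf) (path_space_L2 _ _ Hg) tksk).
by rewrite IH// -addrA; congr (inner P (ev f _) (ev g _)); lia.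
Qed.

(** The adjoint is defined by [get], so a representative has to be exhibited: the backward
    transition operator, which places g one step earlier and integrates out the state preceding the
    window. *)
Lemma transition_adjP g : H g ->
  H (B g) /\ forall f, H f -> inner pi (A f) g = inner pi f (B g).
Proof.
move=> Hg; suff : exists h, H h /\ forall f, H f -> inner pi (A f) g = inner pi f h.
  exact: getPex.
exists (cond_prev (g \o block 0 k k.+1)); split=> [|f Hf].
  by apply: (path_space_cond_prev chainX reversible) => //; exact: (path_space_block chainX).
have HAf := path_space_transition _ Hf.
have Hgb : path_space X k.+1 (g \o block 0 k k.+1) by apply: (path_space_block chainX).
have mf := path_space_measurable _ _ Hf.
rewrite (inner_path chainX k 0); [|exact: path_space_measurable HAf|exact: path_space_measurable Hg].
rewrite inner_transition//; last exact: path_space_L2 Hg.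
rewrite (inner_path chainX k 1) => //; last first.
  exact: path_space_measurable (path_space_cond_prev chainX reversible _ _ k_gt0 Hgb).
rewrite innerC [RHS]innerC -(inner_cond_prev chainX reversible _ _ (g \o block 0 k k.+1) f 0 1)//.
- by rewrite ev_block// addr0.
- exact: path_space_L2 Hgb.
- exact: path_space_L2 Hf.
Qed.

Lemma path_space_iter_adj r g : H g -> H (iter r B g).
Proof. by move=> Hg; elim: r => //= r Hr; have [] := transition_adjP _ Hr. Qed.

(** Moving the r adjoints across gives <f, P_k^r g>; stationarity then shifts both windows by -
    r. *)
Lemma inner_iter_adj r f g : H f -> H g ->
  inner pi (iter r B f) g = inner P (ev f (- r%:Z)) (ev g 0).
Proof.
move=> Hf Hg.
have -> : inner P (ev f (- r%:Z)) (ev g 0) = inner pi f (iter r A g).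
  rewrite innerC [RHS]innerC inner_iter_transition//.
  rewrite -(inner_ev_shift chainX (- r%:Z) r%:Z 0) ?subrr ?add0r//.
    exact: path_space_measurable Hg.
  exact: path_space_measurable Hf.
elim: r g Hg => [|r IH] g Hg //.
have Hr := path_space_iter_adj r _ Hf.
have [_ BP] := transition_adjP _ Hr.
rewrite iterS innerC -BP// innerC IH; last exact: path_space_transition.
by rewrite -iterSr.
Qed.

Definition gk_sum (f g : k.-tuple E -> R) (n : nat) : R :=
  inner P (ev f 0) (ev g 0) +
  \sum_(1 <= r < n.+1) (inner P (ev f r%:Z) (ev g 0) + inner P (ev f (- r%:Z)) (ev g 0)).

Hypothesis gk_cvg : green_kubo_cvg X K k.

Lemma power_seriesP C f : power_series_cvg pi H C -> H f ->
  H (power_series pi H C f) /\ L2cvg pi (power_sum C f) (power_series pi H C f).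
Proof.
move=> HC Hf; suff : exists g, H g /\ L2cvg pi (power_sum C f) g by exact: getPex.
by have [g Hg gf] := HC f Hf; exists g.
Qed.

Lemma path_space_power_sum C f n : (forall r, H (iter r C f)) -> H (power_sum C f n).
Proof.
move=> HC; rewrite /power_sum (_ : \sum_(_ <= r < _) _ =
  fun x => \sum_(1 <= r < n.+1) iter r C f x); first exact: (path_space_sum chainX).
by apply/funext => x; rewrite fct_sumE.
Qed.

Lemma power_sum_cvg C f g : power_series_cvg pi H C -> (forall r, H (iter r C f)) ->
  H f -> H g ->
  \sum_(1 <= r < n.+1) inner pi (iter r C f) g @[n --> \oo] -->
  inner pi (power_series pi H C f) g.
Proof.
move=> HC Hr Hf Hg; have [Hs cs] := power_seriesP _ _ HC Hf.
have Hn n := path_space_power_sum _ _ n Hr.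
have := L2cvg_inner pi (power_sum C f) _ g (fun n => path_space_L2 _ _ (Hn n))
  (path_space_L2 _ _ Hs) (path_space_L2 _ _ Hg) cs.
rewrite (_ : (fun n => _) = (fun n => \sum_(1 <= r < n.+1) inner pi (iter r C f) g))//.
apply/funext => n; rewrite -inner_suml//; last exact: path_space_L2 Hg.
  by rewrite /power_sum; congr inner; apply/funext => x; rewrite fct_sumE.
by move=> r; exact: path_space_L2 (Hr r).
Qed.

Lemma path_space_green_kubo f : H f -> H (green_kubo X K k f).
Proof.
move=> Hf; case: gk_cvg => cA cB.
apply: (path_spaceD chainX); last by have [] := power_seriesP _ _ cB Hf.
by apply: (path_spaceD chainX) => //; have [] := power_seriesP _ _ cA Hf.
Qed.

Lemma gk_sum_cvg f g : H f -> H g ->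
  gk_sum f g n @[n --> \oo] --> inner pi (green_kubo X K k f) g.
Proof.
move=> Hf Hg; case: gk_cvg => cA cB.
have [HA _] := power_seriesP _ _ cA Hf; have [HB _] := power_seriesP _ _ cB Hf.
have lA := power_sum_cvg _ _ _ cA (fun r => path_space_iter r _ Hf) Hf Hg.
have lB := power_sum_cvg _ _ _ cB (fun r => path_space_iter_adj r _ Hf) Hf Hg.
have Lf := path_space_L2 _ _ Hf; have Lg := path_space_L2 _ _ Hg.
have LA := path_space_L2 _ _ HA; have LB := path_space_L2 _ _ HB.
rewrite /green_kubo (innerDl pi) ?(innerDl pi f)//; last exact: L2_add.
have -> : gk_sum f g = (fun n => inner pi f g + (\sum_(1 <= r < n.+1) inner pi (iter r A f) g) +
    \sum_(1 <= r < n.+1) inner pi (iter r B f) g).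
  apply/funext => n; rewrite /gk_sum big_split/= addrA.
  rewrite -(inner_path chainX k 0 f g (L2_measurable _ _ Lf) (L2_measurable _ _ Lg)).
  by congr (_ + _ + _); apply: eq_bigr => r _; rewrite ?inner_iter_transition ?inner_iter_adj.
by apply: cvgD lB; apply: cvgD lA; exact: cvg_cst.
Qed.

(** Later arguments use B_k through this form, whose values are identified as limits of [gk_sum] by
    [gk_unique]. *)
Definition gk (f g : k.-tuple E -> R) : R := inner pi (green_kubo X K k f) g.

Lemma gk_unique f g (l : R) : H f -> H g -> gk_sum f g n @[n --> \oo] --> l -> gk f g = l.
Proof.
move=> Hf Hg gl; rewrite -(cvg_lim (@Rhausdorff R) gl).
by rewrite (cvg_lim (@Rhausdorff R) (gk_sum_cvg f g Hf Hg)).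
Qed.

(** Stationarity exchanges the correlations at lags r and - r. *)
Lemma gkC f g : H f -> H g -> gk f g = gk g f.
Proof.
move=> Hf Hg; have mf := path_space_measurable _ _ Hf; have mg := path_space_measurable _ _ Hg.
apply: gk_unique => //; suff -> : gk_sum f g = gk_sum g f by exact: gk_sum_cvg.
apply/funext => n; rewrite /gk_sum (innerC P); congr (_ + _); apply: eq_bigr => r _.
rewrite addrC; congr (_ + _); rewrite innerC.
  by rewrite -(inner_ev_shift chainX r%:Z 0 (- r%:Z))// add0r addNr.
by rewrite -(inner_ev_shift chainX (- r%:Z) 0 r%:Z)// add0r subrr.
Qed.

Lemma gk_comb a f f' g : H f -> H f' -> H g ->
  gk (fun x => a * f x + f' x) g = a * gk f g + gk f' g.
Proof.
move=> Hf Hf' Hg; apply: gk_unique => //; first exact: (path_space_comb chainX).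
have Lf s := path_space_ev chainX k s f Hf; have Lf' s := path_space_ev chainX k s f' Hf'.
have Lg s := path_space_ev chainX k s g Hg.
have C s : inner P (ev (fun x => a * f x + f' x) s) (ev g 0) =
    a * inner P (ev f s) (ev g 0) + inner P (ev f' s) (ev g 0).
  rewrite -innerZl// -innerDl//; exact: L2_scale.
have -> : gk_sum (fun x => a * f x + f' x) g = (fun n => a * gk_sum f g n + gk_sum f' g n).
  apply/funext => n; rewrite /gk_sum !C mulrDr mulr_sumr.
  under eq_bigr do rewrite !C.
  rewrite addrACA -big_split/=; congr (_ + _); apply: eq_bigr => r _; ring.
apply: cvgD; last exact: gk_sum_cvg.
by apply: cvgM; [exact: cvg_cst|exact: gk_sum_cvg].
Qed.

Lemma gkB f f' g : H f -> H f' -> H g -> gk (fun x => f x - f' x) g = gk f g - gk f' g.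
Proof.
move=> Hf Hf' Hg; rewrite (_ : (fun _ => _) = (fun x => -1 * f' x + f x)).
  by rewrite gk_comb// mulN1r addrC.
by apply/funext => x; rewrite mulN1r addrC.
Qed.

(** For the converse, the test function is B_k f itself. *)
Lemma ker_green_kuboP f :
  ker_green_kubo X K k f <-> H f /\ forall g, H g -> gk f g = 0.
Proof.
split=> -[Hf f0]; have HB := path_space_green_kubo f Hf; split => //.
  move=> g Hg; rewrite /gk (inner_ael pi _ (cst 0)) ?inner0l//; last 2 first.
  - exact: L2_cst.
  - exact: path_space_L2 Hg.
  exact: path_space_L2 HB.
by apply: inner_eq0; [exact: path_space_L2 HB|exact: f0].
Qed.

(** The difference has norm 0 under the path law, hence norm 0 on [Omega] at every time s by
    stationarity. *)
Lemma ev_ae n (f g : n.-tuple E -> R) s : L2 (path_law X n) f -> L2 (path_law X n) g ->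
  f = g %[ae path_law X n] -> ev f s = ev g s %[ae P].
Proof.
move=> Lf Lg fg; have Lfg := L2_sub _ _ _ Lf Lg.
have : inner P (ev (fun x => f x - g x) s) (ev (fun x => f x - g x) s) = 0.
  rewrite -(inner_path chainX); [|exact: L2_measurable Lfg..].
  rewrite (inner_ael _ _ (cst 0)) ?inner0l//; first exact: L2_cst.
  by apply: filterS fg => x fgx _; rewrite fgx ?subrr.
move/(inner_eq0 P _ (L2_ev chainX _ _ _ Lfg)).
by apply: filterS => w /(_ Logic.I)/eqP; rewrite /ev/= subr_eq0 => /eqP.
Qed.

Lemma gk_ae f f' g : H f -> H f' -> H g -> f = f' %[ae pi] -> gk f g = gk f' g.
Proof.
move=> Hf Hf' Hg ff'; apply: gk_unique => //.
suff -> : gk_sum f g = gk_sum f' g by exact: gk_sum_cvg.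
have E1 s : inner P (ev f s) (ev g 0) = inner P (ev f' s) (ev g 0).
  apply: inner_ael; try exact: (path_space_ev chainX).
  by apply: ev_ae => //; exact: path_space_L2.
by apply/funext => n; rewrite /gk_sum E1; congr (_ + _); apply: eq_bigr => r _; rewrite !E1.
Qed.

Lemma ker_ae f f' : H f' -> f = f' %[ae pi] ->
  ker_green_kubo X K k f -> ker_green_kubo X K k f'.
Proof.
move=> Hf' ff' /ker_green_kuboP[Hf f0]; apply/ker_green_kuboP; split; first exact: Hf'.
by move=> g Hg; rewrite -(gk_ae f f' g Hf Hf' Hg ff') f0.
Qed.

Lemma ker_comb a f g : ker_green_kubo X K k f -> ker_green_kubo X K k g ->
  ker_green_kubo X K k (fun x => a * f x + g x).
Proof.
move=> /ker_green_kuboP[Hf f0] /ker_green_kuboP[Hg g0]; apply/ker_green_kuboP.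
split=> [|h Hh]; first exact: (path_space_comb chainX).
by rewrite gk_comb// f0// g0// mulr0 addr0.
Qed.

Lemma ker0 : ker_green_kubo X K k (cst 0).
Proof.
have H0 := path_space0 chainX k; apply/ker_green_kuboP; split=> // g Hg.
have E1 : (fun x => cst 0 x - cst 0 x) = cst 0 :> (k.-tuple E -> R).
  by apply/funext => x; rewrite subrr.
by have := gkB _ _ g H0 H0 Hg; rewrite E1 subrr.
Qed.

Lemma kerD f g : ker_green_kubo X K k f -> ker_green_kubo X K k g ->
  ker_green_kubo X K k (fun x => f x + g x).
Proof.
move=> kf kg; rewrite (_ : (fun _ => _) = (fun x => 1 * f x + g x)); first exact: ker_comb.
by apply/funext => x; rewrite mul1r.
Qed.

Lemma kerZ a f : ker_green_kubo X K k f -> ker_green_kubo X K k (fun x => a * f x).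
Proof.
move=> kf; rewrite (_ : (fun _ => _) = (fun x => a * f x + cst 0 x)).
  exact/ker_comb/ker0.
by apply/funext => x; rewrite addr0.
Qed.

Lemma ker_sum (I : Type) (r : seq I) (F : I -> k.-tuple E -> R) :
  (forall i, ker_green_kubo X K k (F i)) -> ker_green_kubo X K k (fun x => \sum_(i <- r) F i x).
Proof.
move=> HF; elim: r => [|i r IH].
  by under eq_fun do rewrite big_nil; exact: ker0.
by under eq_fun do rewrite big_cons; exact: kerD.
Qed.

Lemma cvg_sum_term (u : nat -> R) (l : R) :
  \sum_(1 <= r < n.+1) u r @[n --> \oo] --> l -> u n @[n --> \oo] --> 0.
Proof.
move=> ul; pose S n := \sum_(1 <= r < n.+1) u r.
have ul1 : S n.+1 @[n --> \oo] --> l by rewrite (cvg_shiftS S).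
have : S n.+1 - S n @[n --> \oo] --> l - l by exact: cvgB.
rewrite subrr -(cvg_shiftS u) (_ : (fun n => S n.+1 - S n) = [sequence u n.+1]_n)//.
by apply/funext => n; rewrite /S /= big_nat_recr//= addrAC subrr add0r.
Qed.

(** These correlations are the general term of a convergent series. Their decay is what removes
    boundary terms at infinity below. *)
Lemma inner_ev_cvg0 f g : H f -> H g -> inner P (ev f n%:Z) (ev g 0) @[n --> \oo] --> 0.
Proof.
move=> Hf Hg; case: gk_cvg => cA _.
have := power_sum_cvg _ _ _ cA (fun r => path_space_iter r _ Hf) Hf Hg.
move=> /cvg_sum_term; rewrite (_ : (fun n => _) = fun n => inner P (ev f n%:Z) (ev g 0))//.
by apply/funext => n; rewrite inner_iter_transition.
Qed.

Lemma inner_ev_cvgN0 f g : H f -> H g -> inner P (ev f (- n%:Z)) (ev g 0) @[n --> \oo] --> 0.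
Proof.
move=> Hf Hg; case: gk_cvg => _ cB.
have := power_sum_cvg _ _ _ cB (fun r => path_space_iter_adj r _ Hf) Hf Hg.
move=> /cvg_sum_term; rewrite (_ : (fun n => _) = fun n => inner P (ev f (- n%:Z)) (ev g 0))//.
by apply/funext => n; rewrite inner_iter_adj.
Qed.

Lemma ker_coboundary i n (g : n.-tuple E -> R) : (i + n < k)%N -> path_space X n g ->
  ker_green_kubo X K k (fun x => g (block i n k x) - g (block i.+1 n k x)).
Proof.
move=> ink Hg.
have Hi : H (g \o block i n k) by apply: (path_space_block chainX) => //; exact: ltnW.
have Hi1 : H (g \o block i.+1 n k) by exact: (path_space_block chainX).
apply/ker_green_kuboP; split; first exact: (path_spaceB chainX).
move=> h Hh; apply: gk_unique => //; first exact: (path_spaceB chainX).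
pose e s := inner P (ev (g \o block i n k) s) (ev h 0).
have E1 s : inner P (ev (fun x => g (block i n k x) - g (block i.+1 n k x)) s) (ev h 0) =
    e s - e (s + 1).
  rewrite (innerBl P _ _ _ (path_space_ev chainX k s _ Hi) (path_space_ev chainX k s _ Hi1)
    (path_space_ev chainX k 0 _ Hh)).
  rewrite /e; congr (_ - _); rewrite !ev_block//; last exact: ltnW.
  by congr (inner P (ev g _) _); lia.
(* Only the two extreme terms survive in the truncated sum, and both tend to 0. *)
have E2 n' : gk_sum (fun x => g (block i n k x) - g (block i.+1 n k x)) h n' =
    e (- n'%:Z) - e (n'.+1%:Z).
  rewrite /gk_sum E1; elim: n' => [|n' IH].
    by rewrite big_geq// addr0 oppr0 add0r.
  rewrite big_nat_recr//= addrA IH !E1.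
  have -> : - n'.+1%:Z + 1 = - n'%:Z by lia.
  have -> : n'.+1%:Z + 1 = n'.+2%:Z by lia.
  by ring.
rewrite (_ : gk_sum _ h = fun n' => e (- n'%:Z) - e (n'.+1%:Z)); last exact/funext.
rewrite -(subrr 0); apply: cvgB; first exact: inner_ev_cvgN0.
by rewrite (cvg_shiftS (fun n' => e n'%:Z)); exact: inner_ev_cvg0.
Qed.

Lemma ker_shift i n (g : n.-tuple E -> R) : (i + n <= k)%N -> path_space X n g ->
  ker_green_kubo X K k (fun x => g (block i n k x) - g (block 0 n k x)).
Proof.
move=> + Hg; elim: i => [_|i IH ink].
  by under eq_fun do rewrite subrr; exact: ker0.
have k1 := IH (ltnW ink).
have k2 := kerZ (-1) _ (ker_coboundary i n g ink Hg).
rewrite (_ : (fun _ => _) = (fun x => (g (block i n k x) - g (block 0 n k x)) +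
  -1 * (g (block i n k x) - g (block i.+1 n k x)))); first exact: kerD.
by apply/funext => x; ring.
Qed.

End green_kubo.

(** * Block sums of increments and sums of marginals *)

(* [e] and [f] stand for the correlations of c(X_s) and (K c)(X_s) with a
   function of the window; the Markov property gives the two recurrences. *)
Lemma telescope_two_sided {R : comRingType} {k : nat} {e f : int -> R} (j : nat) :
  (0 < k)%N -> (forall s, k.-1%:Z <= s -> e (s + 1) = f s) ->
  (forall s, s <= 0 -> e (s - 1) = f s) ->
  e 0 - f 0 + \sum_(1 <= r < (k.-1 + j).+1)
    ((e r%:Z - f r%:Z) + (e (- r%:Z) - f (- r%:Z))) =
  \sum_(0 <= i < k) (e i%:Z - f i%:Z) + f 0 + f k.-1%:Z
  - f (k.-1 + j)%N%:Z - f (- (k.-1 + j)%N%:Z).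
Proof.
move=> k_gt0 e_next e_prev.
have right i : \sum_(0 <= r < k + i) (e r%:Z - f r%:Z) =
    \sum_(0 <= r < k) (e r%:Z - f r%:Z) + f k.-1%:Z - f (k.-1 + i)%N%:Z.
  elim: i => [|i IH]; first by rewrite !addn0 addrK.
  rewrite addnS big_nat_recr// IH.
  have -> : e (k + i)%N%:Z = f (k.-1 + i)%N%:Z.
    by rewrite -e_next; [congr e; lia|lia].
  have -> : (k.-1 + i.+1)%N = (k + i)%N by lia.
  by rewrite /=; ring.
have left i : \sum_(1 <= r < i.+1) (e (- r%:Z) - f (- r%:Z)) = f 0 - f (- i%:Z).
  elim: i => [|i IH]; first by rewrite big_geq// oppr0 subrr.
  rewrite big_nat_recr// IH.
  have -> : e (- i.+1%:Z) = f (- i%:Z).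
    by rewrite -e_prev; [congr e; lia|lia].
  by rewrite /=; ring.
rewrite big_split/= left addrA.
rewrite -[e 0 - f 0]/(e 0%:Z - f 0%:Z) -(big_ltn (F := fun r : nat => e r%:Z - f r%:Z))//.
have -> : (k.-1 + j).+1 = (k + j)%N by lia.
by rewrite right; ring.
Qed.

(** The formula for u is available only from some index on, which a shift of the sequences
    absorbs. *)
Lemma cvg_sub_tails {R : realType} {u v w : nat -> R} {l : R} {k : nat} :
  (forall j, u (k + j)%N = l - v (k + j)%N - w (k + j)%N) ->
  v n @[n --> \oo] --> 0 -> w n @[n --> \oo] --> 0 -> u n @[n --> \oo] --> l.
Proof.
move=> uE v0 w0.
have : l - v n - w n @[n --> \oo] --> l - 0 - 0.
  by apply: cvgB => //; apply: cvgB => //; exact: cvg_cst.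
rewrite !subr0 -(cvg_shiftn k (fun n => l - v n - w n)) -(cvg_shiftn k u).
rewrite (_ : [sequence l - v (n + k)%N - w (n + k)%N]_n = [sequence u (n + k)%N]_n)//.
by apply/funext => n; rewrite /= addnC uE.
Qed.

(** * Increments and their conditional expectations *)

Section increments.
Context {d} {E : measurableType d} {R : realType} {nu : probability E R}
  {K : R.-pker E ~> E} {d'} {Omega : measurableType d'} {P : probability Omega R}
  {X : int -> {RV P >-> E}}.
Hypothesis chainX : stationary_markov_chain X nu K.
Hypothesis reversible : self_adjoint nu (L2 nu) (kernel_op K).
Local Notation ev := (@window_fun _ _ _ _ _ _ X _).
Local Notation cond_next := (@cond_exp_next _ _ _ K _).
Local Notation cond_prev := (@cond_exp_prev _ _ _ K _).

Lemma path_space_of_block i n m (g : n.-tuple E -> R) : (i + n <= m)%N ->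
  measurable_fun setT g -> path_space X m (g \o block i n m) -> path_space X n g.
Proof.
move=> inm mg /(path_spaceP chainX m 0)[Lg g0].
have mgb : measurable_fun setT (g \o block i n m).
  by apply: measurableT_comp => //; exact: measurable_block.
apply/(path_spaceP chainX n i); rewrite -[i%:Z]add0r -(ev_block i n m)//.
split => //; apply/(L2_evP chainX n (0 + i%:Z)) => //.
by rewrite -(ev_block i n m)//; exact: (L2_ev chainX).
Qed.

(** Orthogonality to the sum of two subspaces is orthogonality to each, and a member of either is
    almost everywhere an element of H_n read at time 0 or at time 1. *)
Lemma incremental_spaceP n h : incremental_space X n.+1 h <->
  [/\ path_space X n.+1 h,
      forall g, path_space X n g -> inner P (ev h 0) (ev g 0) = 0 &
      forall g, path_space X n g -> inner P (ev h 0) (ev g 1) = 0].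
Proof.
have bl i g : (i <= 1)%N -> path_space X n g -> path_space X n.+1 h ->
    inner (path_law X n.+1) h (g \o block i n n.+1) = inner P (ev h 0) (ev g i%:Z).
  move=> i1 Hg Hh; have igb : (i + n <= n.+1)%N by rewrite -[n.+1]add1n leq_add2r.
  have Hgb := path_space_block chainX _ _ _ g igb Hg.
  rewrite (inner_path chainX n.+1 0) ?ev_block ?add0r//.
    exact: path_space_measurable Hh.
  exact: path_space_measurable Hgb.
split=> [[Hh hW]|[Hh h0 h1]].
  have addf0 (f : n.+1.-tuple E -> R) : f \+ cst 0 = f by apply/funext => x; rewrite /= addr0.
  have add0f (f : n.+1.-tuple E -> R) : cst 0 \+ f = f by apply/funext => x; rewrite /= add0r.
  have block0 i : block_space X n.+1 i n (cst 0).
    split; first exact: (path_space0 chainX).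
    by exists (cst 0) => //; exact: ae_eq_refl.
  have blockg i g : (i <= 1)%N -> path_space X n g -> block_space X n.+1 i n (g \o block i n n.+1).
    move=> i1 Hg; split.
      by apply: (path_space_block chainX) => //; rewrite -[n.+1]add1n leq_add2r.
    by exists g; [exact: path_space_measurable Hg|exact: ae_eq_refl].
  split => // g Hg.
    rewrite -(bl 0%N)//; apply: hW; exists (g \o block 0 n n.+1); first exact: blockg.
    by exists (cst 0); [exact: block0|rewrite addf0].
  rewrite -(bl 1%N)//; apply: hW; exists (cst 0); first exact: block0.
  by exists (g \o block 1 n n.+1); [exact: blockg|rewrite add0f].
split => // _ [u [Hu [g1 mg1 ug1]]] [v [Hv [g2 mg2 vg2]] <-].
have Lu := path_space_L2 _ _ Hu; have Lv := path_space_L2 _ _ Hv.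
have Lh := path_space_L2 _ _ Hh.
have H i f g : (i <= 1)%N -> path_space X n.+1 f -> measurable_fun setT g ->
    f = g \o block i n n.+1 %[ae path_law X n.+1] ->
    [/\ L2 (path_law X n.+1) (g \o block i n n.+1) & path_space X n g].
  move=> i1 Hf mg fg; have igb : (i + n <= n.+1)%N by rewrite -[n.+1]add1n leq_add2r.
  have mgb : measurable_fun setT (g \o block i n n.+1).
    by apply: measurableT_comp => //; exact: measurable_block.
  have Lgb : L2 (path_law X n.+1) (g \o block i n n.+1).
    exact: L2_ae mgb fg (path_space_L2 _ _ Hf).
  split => //; apply: (path_space_of_block i n n.+1) => //; split => //.
  rewrite -(ae_eq_Rintegral _ _ _ (path_space_measurable _ _ Hf) mgb fg).
  by case: Hf.
have [Lg1 Hg1] := H 0%N u g1 isT Hu mg1 ug1.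
have [Lg2 Hg2] := H 1%N v g2 isT Hv mg2 vg2.
rewrite (innerDr _ u v h)// (innerC _ h u) (innerC _ h v).
rewrite (inner_ael _ _ _ _ Lu Lg1 Lh ug1) (inner_ael _ _ _ _ Lv Lg2 Lh vg2).
rewrite (innerC _ _ h) (bl 0%N _ isT Hg1 Hh) (innerC _ _ h) (bl 1%N _ isT Hg2 Hh).
by rewrite h0// h1// addr0.
Qed.

Lemma incremental_comb m a f g : (0 < m)%N -> incremental_space X m f ->
  incremental_space X m g -> incremental_space X m (fun x => a * f x + g x).
Proof.
case: m f g => // n f g _ /incremental_spaceP[Hf f0 f1] /incremental_spaceP[Hg g0 g1].
have Lf := path_space_ev chainX n.+1 0 _ Hf; have Lg := path_space_ev chainX n.+1 0 _ Hg.
have C u : L2 P u -> inner P (ev (fun x => a * f x + g x) 0) u =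
    a * inner P (ev f 0) u + inner P (ev g 0) u.
  by move=> Lu; rewrite -innerZl// -innerDl//; exact: L2_scale.
apply/incremental_spaceP; split; first exact: (path_space_comb chainX).
  by move=> h Hh; rewrite C ?f0 ?g0 ?mulr0 ?addr0//; exact: (path_space_ev chainX).
by move=> h Hh; rewrite C ?f1 ?g1 ?mulr0 ?addr0//; exact: (path_space_ev chainX).
Qed.

Section one_increment.
Variables (n : nat) (h : n.+1.-tuple E -> R).
Hypothesis n_gt0 : (0 < n)%N.
Hypothesis incr_h : incremental_space X n.+1 h.

Let Hh : path_space X n.+1 h. Proof. by case: incr_h. Qed.

(** The conditional expectation of h given its first n coordinates is a function of n coordinates,
    so h is orthogonal to it, and the tower property makes its norm 0. The Markov property then
    extends orthogonality to any window in the past of the last coordinate. *)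
Lemma inner_increment_next p (g : p.-tuple E -> R) s t : t + p%:Z <= s + n%:Z ->
  L2 (path_law X p) g -> inner P (ev h s) (ev g t) = 0.
Proof.
move=> tpsn Lg; have Lh := path_space_L2 _ _ Hh.
have Hc := path_space_cond_next chainX n h n_gt0 Hh.
have Lc := path_space_L2 _ _ Hc; have mc := L2_measurable _ _ Lc.
rewrite (inner_cond_next chainX n p h g s t n_gt0 tpsn Lh Lg).
have cc : inner P (ev (cond_next h) s) (ev (cond_next h) s) = 0.
  have [_ h0 _] := (incremental_spaceP n h).1 incr_h.
  have nn : 0 + n%:Z <= 0 + n%:Z by [].
  rewrite -(inner_path chainX)// (inner_path chainX n 0)//.
  by rewrite -(inner_cond_next chainX n n h (cond_next h) 0 0 n_gt0 nn Lh Lc) h0.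
rewrite (inner_ael _ _ (cst 0)) ?inner0l//.
- exact: (L2_ev chainX).
- exact: L2_cst.
- exact: (L2_ev chainX).
- by apply: inner_eq0 => //; exact: (L2_ev chainX).
Qed.

Lemma inner_increment_prev p (g : p.-tuple E -> R) s t : s + 1 <= t ->
  L2 (path_law X p) g -> inner P (ev h s) (ev g t) = 0.
Proof.
move=> st Lg; have Lh := path_space_L2 _ _ Hh.
have Hc := path_space_cond_prev chainX reversible n h n_gt0 Hh.
have Lc := path_space_L2 _ _ Hc; have mc := L2_measurable _ _ Lc.
rewrite (inner_cond_prev chainX reversible n p h g s t n_gt0 st Lh Lg).
have cc : inner P (ev (cond_prev h) (s + 1)) (ev (cond_prev h) (s + 1)) = 0.
  have [_ _ h1] := (incremental_spaceP n h).1 incr_h.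
  have nn : (0 : int) + 1 <= 1 by [].
  rewrite -(inner_path chainX)// (inner_path chainX n 1)//.
  by rewrite -(inner_cond_prev chainX reversible n n h (cond_prev h) 0 1 n_gt0 nn Lh Lc) h1.
rewrite (inner_ael _ _ (cst 0)) ?inner0l//.
- exact: (L2_ev chainX).
- exact: L2_cst.
- exact: (L2_ev chainX).
- by apply: inner_eq0 => //; exact: (L2_ev chainX).
Qed.

End one_increment.

Definition block_sum (m k : nat) (h : m.-tuple E -> R) : k.-tuple E -> R :=
  fun x => \sum_(i < (k - m + 1)%N) h (block i m k x).

Lemma path_space_block_sum m k h : (m <= k)%N -> path_space X m h ->
  path_space X k (block_sum m k h).
Proof.
move=> mk Hh; apply: (path_space_sum chainX) => i.
by apply: (path_space_block chainX) => //; have := ltn_ord i; lia.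
Qed.

Lemma inner_block_sum m k h g : (m <= k)%N -> path_space X m h -> path_space X k g ->
  inner (path_law X k) (block_sum m k h) g =
  \sum_(0 <= i < (k - m + 1)%N) inner P (ev h i%:Z) (ev g 0).
Proof.
move=> mk Hh Hg; rewrite (inner_path chainX k 0); last 2 first.
- exact: path_space_measurable (path_space_block_sum _ _ _ mk Hh).
- exact: path_space_measurable Hg.
rewrite big_mkord -inner_suml.
- suff -> : ev (block_sum m k h) 0 = (fun w => \sum_(i < (k - m + 1)%N) ev h i%:Z w) by [].
  apply/funext => w; apply: eq_bigr => i _; rewrite block_window ?add0r//.
  by have := ltn_ord i; lia.
- by move=> i; exact: (path_space_ev chainX).
- exact: (path_space_ev chainX).
Qed.

(** * The action of B_k on increments *)

Section increments_green_kubo.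
Variables (k n : nat).
Hypothesis n_gt0 : (0 < n)%N.
Hypothesis nk : (n < k)%N.
Hypothesis gk_cvg : green_kubo_cvg X K k.
Variable h : n.+1.-tuple E -> R.
Hypothesis incr_h : incremental_space X n.+1 h.
Local Notation gk := (@gk _ _ _ K _ _ _ X k).
Local Notation gk_sum := (@gk_sum _ _ _ _ _ _ X k).

Let k_gt0 : (0 < k)%N. Proof. exact: leq_trans nk. Qed.
Let Hh : path_space X n.+1 h. Proof. by case: incr_h. Qed.
Let Hh0 : path_space X k (h \o block 0 n.+1 k).
Proof. exact: (path_space_block chainX). Qed.
Let HS : path_space X k (block_sum n.+1 k h).
Proof. exact: path_space_block_sum. Qed.

Lemma gk_increment g : path_space X k g ->
  gk (h \o block 0 n.+1 k) g = inner (path_law X k) (block_sum n.+1 k h) g.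
Proof.
move=> Hg; apply: (gk_unique chainX k_gt0 reversible gk_cvg) => //.
rewrite inner_block_sum//.
pose e s := inner P (ev h s) (ev g 0).
have Lg := path_space_L2 _ _ Hg.
(* The first coordinate of h lies before the window of g. *)
have e_neg (r : nat) : e (- r.+1%:Z) = 0.
  by apply: (inner_increment_prev n h) => //; lia.
(* The last coordinate of h, at time r + n >= k, lies after the window of g; the lags 0, ..., k - n
   - 1 remain. *)
have e_big (r : nat) : (k - n <= r)%N -> e r%:Z = 0.
  by move=> nr; apply: (inner_increment_next n h) => //; lia.
have gkE n' : (k - n <= n')%N -> gk_sum (h \o block 0 n.+1 k) g n' =
    \sum_(0 <= i < (k - n.+1 + 1)%N) e i%:Z.
  move=> kn; rewrite /gk_sum.
  under eq_bigr do rewrite !ev_block// !addr0.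
  rewrite ev_block// addr0.
  rewrite (eq_big_nat _ _ (F2 := fun r => e r%:Z)); last first.
    by move=> [//|r] _; rewrite -/(e _) -/(e _) e_neg addr0.
  transitivity (\sum_(0 <= i < n'.+1) e i%:Z); first by rewrite [RHS]big_ltn.
  rewrite (@big_cat_nat _ _ _ (k - n.+1 + 1))//=; last by lia.
  rewrite [X in _ + X](_ : _ = 0) ?addr0// big_nat_cond big1// => r /andP[/andP[kr _] _].
  by apply: e_big; lia.
by apply: cvg_near_cst; exists (k - n)%N => // n' /= kn.
Qed.

Lemma ker_block_sum : ker_green_kubo X K k
  (fun x => block_sum n.+1 k h x - (k - n)%:R * h (block 0 n.+1 k x)).
Proof.
have Nk : (k - n.+1 + 1)%N = (k - n)%N by lia.
rewrite (_ : (fun _ => _) = (fun x => \sum_(i < (k - n.+1 + 1)%N)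
    (h (block i n.+1 k x) - h (block 0 n.+1 k x)))).
  apply: (ker_sum chainX k_gt0 reversible gk_cvg) => i.
  apply: (ker_shift chainX k_gt0 reversible gk_cvg) => //.
  by have := ltn_ord i; lia.
apply/funext => x; rewrite sumrB; congr (_ - _).
by rewrite sumr_const card_ord Nk mulr_natl.
Qed.

Lemma gk_block_sum g : path_space X k g ->
  gk (block_sum n.+1 k h) g = (k - n)%:R * inner (path_law X k) (block_sum n.+1 k h) g.
Proof.
move=> Hg; have [_ kS] := (ker_green_kuboP chainX gk_cvg _).1 ker_block_sum.
rewrite -gk_increment//; apply/eqP; rewrite -subr_eq0; apply/eqP.
have HN := path_spaceZ chainX k (k - n)%:R _ Hh0.
rewrite -[RHS](kS g Hg) (gkB chainX k_gt0 reversible gk_cvg _ _ _ HS HN Hg); congr (_ - _).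
have H0 := path_space0 chainX k.
have := gk_comb chainX k_gt0 reversible gk_cvg (k - n)%:R _ _ g Hh0 H0 Hg.
have [_ k0] := (ker_green_kuboP chainX gk_cvg _).1
  (ker0 chainX k_gt0 reversible gk_cvg).
rewrite k0// addr0 => <-; congr (gk _ g).
by apply/funext => x; rewrite addr0.
Qed.

End increments_green_kubo.

(** * Functions of one coordinate as paths of length one *)

Section marginals.

Definition marg (a : E -> R) : 1.-tuple E -> R := fun y => a (tnth y ord0).

Lemma ev_marg a s w : ev (marg a) s w = a (X s w).
Proof. by rewrite /window_fun /marg/= tnth_mktuple addr0. Qed.

Lemma measurable_marg a : measurable_fun setT a -> measurable_fun setT (marg a).
Proof. by move=> ma; apply: measurableT_comp ma _; exact: measurable_tnth. Qed.

Lemma L2_margP a : measurable_fun setT a -> L2 (path_law X 1) (marg a) <-> L2 nu a.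
Proof.
move=> ma; have mma := measurable_marg _ ma.
have ma2 : measurable_fun setT (fun x => (a x ^+ 2)%:E).
  by apply/measurable_EFinP; exact: measurable_funX.
have E1 : (\int[path_law X 1]_x (marg a x ^+ 2)%:E = \int[nu]_x (a x ^+ 2)%:E)%E.
  rewrite (ge0_integral_path chainX 1 0 (fun x => (marg a x ^+ 2)%:E)); last 2 first.
  - by apply/measurable_EFinP; exact: measurable_funX.
  - by move=> x; rewrite lee_fin sqr_ge0.
  rewrite (eq_integral (fun w => (a (X 0 w) ^+ 2)%:E)); last by move=> w _; rewrite -ev_marg.
  rewrite -(@ge0_integral_distribution _ _ _ _ _ P (X 0) (fun x => (a x ^+ 2)%:E))//.
    by apply: eq_measure_integral => A mA _; exact: (chain_marginal _ _ _ chainX).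
  by move=> x; rewrite lee_fin sqr_ge0.
split=> /L2P[m_ /integrableP[mm I]]; apply/L2P; split=> //; apply/integrableP; split=> //.
  move: I; under eq_integral do rewrite /= ger0_norm ?sqr_ge0//.
  by under [in X in _ -> X]eq_integral do rewrite /= ger0_norm ?sqr_ge0//; rewrite E1.
  by apply/measurable_EFinP; exact: measurable_funX.
move: I; under eq_integral do rewrite /= ger0_norm ?sqr_ge0//.
by under [in X in _ -> X]eq_integral do rewrite /= ger0_norm ?sqr_ge0//; rewrite E1.
Qed.

Lemma path_space_margP a : measurable_fun setT a -> path_space X 1 (marg a) <-> L20 nu a.
Proof.
move=> ma; have mma := measurable_marg _ ma.
have E1 : \int[path_law X 1]_x marg a x = \int[nu]_x a x.
  rewrite (Rintegral_path chainX 1 0)//; under eq_Rintegral do rewrite ev_marg.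
  exact: (Rintegral_marginal chainX).
by split=> -[/(L2_margP _ ma) La a0]; split=> //; rewrite -a0 E1.
Qed.

Lemma margE (f : 1.-tuple E -> R) : f = marg (fun x => f [tuple x]).
Proof.
apply/funext => y; congr f; apply: eq_from_tnth => i.
by rewrite (ord1 i).
Qed.

Lemma L20_of_path_space f : path_space X 1 f -> L20 nu (fun x => f [tuple x]).
Proof.
move=> Hf; apply/path_space_margP; last by rewrite -margE.
apply: measurableT_comp (path_space_measurable _ _ Hf) _.
apply/measurable_fun_tnthP => i; rewrite (_ : _ \o _ = id)//.
by apply/funext => x; rewrite /= (ord1 i).
Qed.

Lemma L20_measurable a : L20 nu a -> measurable_fun setT a.
Proof. by case=> La _; exact: L2_measurable La. Qed.

Lemma path_space_marg a : L20 nu a -> path_space X 1 (marg a).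
Proof. by move=> La; apply/(path_space_margP _ (L20_measurable _ La)). Qed.

(** With K read as a conditional expectation on paths of length 2, its stability properties on L^2
    follow from those of path functions. *)
Lemma cond_next_marg a : cond_next (marg a \o block 1 1 2) = marg (kernel_op K a).
Proof.
apply/funext => y; rewrite /cond_exp_next /marg /kernel_op.
have -> : last point y = tnth y ord0 by rewrite (tnth_nth point); case: y => -[|? []].
by apply: eq_Rintegral => z _; rewrite /= tnth_mktuple/= nth_rcons size_tuple.
Qed.

Lemma cond_prev_marg a : cond_prev (marg a \o block 0 1 2) = marg (kernel_op K a).
Proof.
rewrite /cond_exp_prev.
have -> : (marg a \o block 0 1 2) \o rev_path = marg a \o block 1 1 2.
  apply/funext => y; rewrite /= block_rev// /marg /rev_path tnth_rev.
  by congr (a (tnth _ _)); exact/val_inj.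
rewrite cond_next_marg; apply/funext => y; rewrite /= /marg /rev_path tnth_rev.
by congr (kernel_op K a (tnth _ _)); exact/val_inj.
Qed.

Lemma L20_kernel_op a : L20 nu a -> L20 nu (kernel_op K a).
Proof.
move=> La; have Ha := path_space_marg _ La.
apply/path_space_margP; first exact: (measurable_kernel_op _ (L20_measurable _ La)).
rewrite -cond_next_marg; apply: (path_space_cond_next chainX) => //.
exact: (path_space_block chainX).
Qed.

Lemma L2_kernel_op a : L2 nu a -> L2 nu (kernel_op K a).
Proof.
move=> La; have ma := L2_measurable _ _ La.
apply/L2_margP; first exact: measurable_kernel_op.
rewrite -cond_next_marg; apply: (L2_cond_next chainX) => //.
have mb : measurable_fun setT (marg a \o block 1 1 2).
  by apply: measurableT_comp; [exact: measurable_marg|exact: measurable_block].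
apply/(L2_evP chainX 2 0) => //; rewrite ev_block//.
by apply: (L2_ev chainX); apply/L2_margP.
Qed.

End marginals.

(** * The action of B_k on sums of marginals *)

Section marginals_green_kubo.
Variable k : nat.
Hypothesis k_gt0 : (0 < k)%N.
Hypothesis gk_cvg : green_kubo_cvg X K k.
Local Notation gk := (@gk _ _ _ K _ _ _ X k).
Local Notation gk_sum := (@gk_sum _ _ _ _ _ _ X k).
Local Notation Kc := (kernel_op K).

(** Lags inside the window contribute c - K c at every coordinate. The lags beyond each end
    telescope to one boundary term K c, at the first and at the last coordinate; for k = 1 both fall
    on the same coordinate. *)
Definition marg_coef (c : E -> R) (i : nat) : E -> R :=
  fun x => (c x - Kc c x) + (i == 0%N)%:R * Kc c x + (i == k.-1)%:R * Kc c x.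

(* B_k applied to (c - K c)(x_1) (lemma [gk_marg]). *)
Definition marg_range (c : E -> R) : k.-tuple E -> R :=
  fun x => \sum_(i < k) marg_coef c i (tnth x i).

Lemma marg_block i (x : k.-tuple E) (ik : (i < k)%N) a :
  marg a (block i 1 k x) = a (tnth x (Ordinal ik)).
Proof. by rewrite /marg tnth_mktuple addn0 (tnth_nth point). Qed.

Lemma marg_sumE (a : nat -> E -> R) :
  (fun x : k.-tuple E => \sum_(i < k) a i (tnth x i)) =
  (fun x => \sum_(i < k) marg (a i) (block i 1 k x)).
Proof.
apply/funext => x; apply: eq_bigr => i _.
by rewrite (marg_block i x (ltn_ord i)); congr (a i (tnth x _)); exact/val_inj.
Qed.

Lemma L20_comb t a b : L20 nu a -> L20 nu b -> L20 nu (fun x => t * a x + b x).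
Proof.
move=> La Lb; have Ha := path_space_marg _ La; have Hb := path_space_marg _ Lb.
apply/path_space_margP; last exact: (path_space_comb chainX _ t _ _ Ha Hb).
apply: measurable_funD; last exact: L20_measurable Lb.
by apply: measurable_funM => //; exact: L20_measurable La.
Qed.

Lemma L20_marg_coef c i : L20 nu c -> L20 nu (marg_coef c i).
Proof.
move=> Lc; have LK := L20_kernel_op _ Lc.
rewrite /marg_coef.
have L1 := L20_comb ((i == 0%N)%:R + (i == k.-1)%:R - 1) _ _ LK Lc.
by congr (L20 nu _): L1; apply/funext => x; ring.
Qed.

Lemma path_space_marg_sum (a : nat -> E -> R) : (forall i, L20 nu (a i)) ->
  path_space X k (fun x => \sum_(i < k) a i (tnth x i)).
Proof.
move=> La; rewrite marg_sumE; apply: (path_space_sum chainX) => i.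
apply: (path_space_block chainX _ 1 k (marg (a i))); last exact: path_space_marg.
by rewrite addn1.
Qed.

Lemma inner_marg_sum (a : nat -> E -> R) g : (forall i, L20 nu (a i)) ->
  path_space X k g ->
  inner (path_law X k) (fun x => \sum_(i < k) a i (tnth x i)) g =
  \sum_(0 <= i < k) inner P (ev (marg (a i)) i%:Z) (ev g 0).
Proof.
move=> La Hg; rewrite (inner_path chainX k 0); last 2 first.
- exact: path_space_measurable (path_space_marg_sum _ La).
- exact: path_space_measurable Hg.
rewrite big_mkord -inner_suml.
- suff -> : ev (fun x => \sum_(i < k) a i (tnth x i)) 0 =
      (fun w => \sum_(i < k) ev (marg (a i)) i%:Z w) by [].
  apply/funext => w; rewrite marg_sumE; apply: eq_bigr => i _.
  by rewrite block_window ?add0r// addn1.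
- by move=> i; exact/(path_space_ev chainX)/path_space_marg.
- exact: (path_space_ev chainX).
Qed.

Section one_function.
Variables (c : E -> R) (g : k.-tuple E -> R).
Hypothesis Lc : L20 nu c.
Hypothesis Hg : path_space X k g.

Let e s := inner P (ev (marg c) s) (ev g 0).
Let f s := inner P (ev (marg (Kc c)) s) (ev g 0).

Let LK : L20 nu (Kc c). Proof. exact: L20_kernel_op. Qed.
Let Hc : path_space X 1 (marg c). Proof. exact: path_space_marg. Qed.
Let Hk : path_space X 1 (marg (Kc c)). Proof. exact: path_space_marg. Qed.

Let e_next (s : int) : k.-1%:Z <= s -> e (s + 1) = f s.
Proof.
move=> ks; have Hb : path_space X 2 (marg c \o block 1 1 2) by exact: (path_space_block chainX).
rewrite /e -(ev_block 1 1 2 (marg c) s)//.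
have H : 0 + k%:Z <= s + 1%:Z by lia.
by rewrite (inner_cond_next chainX 1 k _ g s 0 isT H (path_space_L2 _ _ Hb) (path_space_L2 _ _ Hg))
  cond_next_marg.
Qed.

Let e_prev (s : int) : s <= 0 -> e (s - 1) = f s.
Proof.
move=> s0; have Hb : path_space X 2 (marg c \o block 0 1 2) by exact: (path_space_block chainX).
rewrite /e -[s - 1]addr0 -(ev_block 0 1 2 (marg c) (s - 1))//.
have H : s - 1 + 1 <= 0 by lia.
rewrite (inner_cond_prev chainX reversible 1 k _ g (s - 1) 0 isT H (path_space_L2 _ _ Hb)
  (path_space_L2 _ _ Hg)) cond_prev_marg.
by rewrite subrK.
Qed.

Let inner_ev_comb a b s : inner P (ev (marg (fun x => c x - Kc c x + a * Kc c x + b * Kc c x)) s) (ev g 0) =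
  e s - f s + a * f s + b * f s.
Proof.
have Lc' := path_space_ev chainX 1 s _ Hc; have Lk' := path_space_ev chainX 1 s _ Hk.
have Lg := path_space_ev chainX k 0 _ Hg.
transitivity (inner P (fun w => (a + b - 1) * ev (marg (Kc c)) s w + ev (marg c) s w) (ev g 0)).
  by congr inner; apply/funext => w; rewrite /window_fun /marg/=; ring.
rewrite innerDl// ?innerZl//; last exact: L2_scale.
by rewrite /e /f; ring.
Qed.

Lemma gk_marg : gk (fun x => marg (fun y => c y - Kc c y) (block 0 1 k x)) g =
  inner (path_law X k) (marg_range c) g.
Proof.
have HcK : path_space X 1 (marg (fun y => c y - Kc c y)).
  apply: path_space_marg; have := L20_comb (-1) _ _ LK Lc.
  by congr (L20 nu _); apply/funext => y; ring.
have H0 : path_space X k (marg (fun y => c y - Kc c y) \o block 0 1 k).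
  exact: (path_space_block chainX).
apply: (gk_unique chainX k_gt0 reversible gk_cvg) => //.
rewrite inner_marg_sum//; last by move=> i; exact: L20_marg_coef.
pose D s := e s - f s.
have evD s : inner P (ev (fun x => marg (fun y => c y - Kc c y) (block 0 1 k x)) s) (ev g 0) = D s.
  rewrite (ev_block 0 1 k (marg (fun y => c y - Kc c y)) s)// addr0.
  have := inner_ev_comb 0 0 s; rewrite !mul0r !addr0 -/(D s) => <-.
  by congr (inner P (ev (marg _) s) _); apply/funext => x; rewrite !mul0r !addr0.
have rhsE : \sum_(0 <= i < k) inner P (ev (marg (marg_coef c i)) i%:Z) (ev g 0) =
    \sum_(0 <= i < k) D i%:Z + f 0 + f k.-1%:Z.
  under eq_bigr do rewrite /marg_coef inner_ev_comb.
  rewrite !big_split/=; congr (_ + _ + _).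
    by rewrite big_ltn// big_nat big1 ?mul1r ?addr0// => -[|i]//; rewrite mul0r.
  rewrite -(prednK k_gt0) big_nat_recr//= eqxx mul1r big_nat big1 ?add0r// => i /andP[_ ik].
  by rewrite ltn_eqF ?mul0r.
(* Truncating at k - 1 + j makes the sum cover the whole window, so that everything outside it
   telescopes. *)
have gkE j : gk_sum (fun x => marg (fun y => c y - Kc c y) (block 0 1 k x)) g (k.-1 + j)%N =
    \sum_(0 <= i < k) D i%:Z + f 0 + f k.-1%:Z - f (k.-1 + j)%N%:Z - f (- (k.-1 + j)%N%:Z).
  rewrite /gk_sum evD; under eq_bigr do rewrite !evD.
  exact: (telescope_two_sided j k_gt0 e_next e_prev).
rewrite rhsE; set l := _ + _ + _.
have Hkb i : (i < k)%N -> path_space X k (marg (Kc c) \o block i 1 k).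
  by move=> ik; apply: (path_space_block chainX) => //; rewrite addn1.
have f_block s : inner P (ev (marg (Kc c) \o block 0 1 k) s) (ev g 0) = f s.
  by rewrite (ev_block 0 1 k _ s k_gt0) addr0.
have f_cvg : f n%:Z @[n --> \oo] --> 0.
  have := inner_ev_cvg0 chainX k_gt0 gk_cvg _ g (Hkb 0%N k_gt0) Hg.
  by under eq_fun do rewrite f_block.
have f_cvgN : f (- n%:Z) @[n --> \oo] --> 0.
  have := inner_ev_cvgN0 chainX k_gt0 reversible gk_cvg _ g (Hkb 0%N k_gt0) Hg.
  by under eq_fun do rewrite f_block.
exact: (cvg_sub_tails gkE f_cvg f_cvgN).
Qed.

End one_function.

Lemma ker_marg_sum (a : nat -> E -> R) : (forall i, L20 nu (a i)) ->
  ker_green_kubo X K k (fun x => \sum_(i < k) a i (tnth x i) -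
    marg (fun y => \sum_(i < k) a i y) (block 0 1 k x)).
Proof.
move=> La; rewrite (_ : (fun _ => _) = (fun x => \sum_(i < k)
    (marg (a i) (block i 1 k x) - marg (a i) (block 0 1 k x)))).
  apply: (ker_sum chainX k_gt0 reversible gk_cvg) => i.
  apply: (ker_shift chainX k_gt0 reversible gk_cvg); last exact: path_space_marg.
  by rewrite addn1.
apply/funext => x; rewrite sumrB; congr (_ - _).
by have /(congr1 (fun F => F x)) := marg_sumE a.
Qed.

(** There are k copies of c - K c and two boundary terms K c, whence the coefficient k - 2. *)
Lemma marg_coef_sum c y : \sum_(i < k) marg_coef c i y = k%:R * c y - (k%:R - 2) * Kc c y.
Proof.
rewrite !big_split/= !sumr_const !card_ord -[c y *+ k]mulr_natl -[(- _) *+ k]mulr_natl.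
have -> : \sum_(i < k) (i == 0%N :> nat)%:R * Kc c y = Kc c y.
  rewrite (bigD1 (Ordinal k_gt0))//= mul1r big1 ?addr0// => i.
  by rewrite -val_eqE/= => /negPf ->; rewrite mul0r.
have kk : (k.-1 < k)%N by rewrite prednK.
have -> : \sum_(i < k) (i == k.-1 :> nat)%:R * Kc c y = Kc c y.
  rewrite (bigD1 (Ordinal kk))//= eqxx mul1r big1 ?addr0// => i.
  by rewrite -val_eqE/= => /negPf ->; rewrite mul0r.
by ring.
Qed.

End marginals_green_kubo.

End increments.

(** * The resolvent of the kernel *)

Section L2_geometric_series.
Context {d} {T : measurableType d} {R : realType} (mu : probability T R).
Variables (v : nat -> T -> R) (q b : R).
Hypothesis Lv : forall n, L2 mu (v n).
Hypothesis q01 : 0 <= q < 1.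
Hypothesis vb : forall n, inner mu (v n) (v n) <= b ^+ 2.
Hypothesis b_ge0 : 0 <= b.

Let q_ge0 : 0 <= q. Proof. by case/andP: q01. Qed.
Let S (N : nat) (x : T) : R := \sum_(0 <= n < N) q ^+ n * v n x.
Let W (N : nat) (x : T) : R := \sum_(0 <= n < N) q ^+ n * `|v n x|.
(** W bounds the partial sums S in absolute value. Its squares increase to W2, integrable by
    monotone convergence: one dominating function for all the S N ^ 2. *)
Let W2 (x : T) : \bar R := limn (fun N => (W N x ^+ 2)%:E).

Let L2_abs f : L2 mu f -> L2 mu (fun x => `|f x|).
Proof.
move=> /L2P[mf If]; apply/L2P; split; first exact: measurableT_comp.
by apply: eq_integrable If => // x _ /=; rewrite real_normK ?num_real.
Qed.

Let LS N : L2 mu (S N).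
Proof. by apply: L2_sum => n; exact: L2_scale. Qed.

Let LW N : L2 mu (W N).
Proof. by apply: L2_sum => n; apply: L2_scale; exact: L2_abs. Qed.

Let W_ge0 N x : 0 <= W N x.
Proof. by apply: sumr_ge0 => n _; rewrite mulr_ge0 ?exprn_ge0. Qed.

Let W_nd x : nondecreasing_seq (W ^~ x).
Proof.
apply/nondecreasing_seqP => N; rewrite /W big_nat_recr//= lerDl.
by rewrite mulr_ge0 ?exprn_ge0.
Qed.

Let S_le_W N x : `|S N x| <= W N x.
Proof.
apply: le_trans (ler_norm_sum _ _ _) _; apply: ler_sum => n _.
by rewrite normrM ger0_norm ?exprn_ge0.
Qed.

Let W2_nd x : nondecreasing_seq (fun N => (W N x ^+ 2)%:E).
Proof.
move=> m n mn; rewrite lee_fin.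
by rewrite ler_sqr ?nnegrE ?W_ge0//; exact: W_nd.
Qed.

Let W_le_W2 N x : ((W N x ^+ 2)%:E <= W2 x)%E.
Proof.
rewrite /W2 (cvg_lim _ (ereal_nondecreasing_cvgn (W2_nd x)))//.
by apply: ereal_sup_ubound; exists N.
Qed.

Let sum_q N : \sum_(0 <= n < N) q ^+ n <= (1 - q)^-1.
Proof.
have q1 : 0 < 1 - q by case/andP: q01 => _; rewrite subr_gt0.
rewrite -[leRHS]mul1r ler_pdivlMr//.
have -> : (\sum_(0 <= n < N) q ^+ n) * (1 - q) = 1 - q ^+ N.
  elim: N => [|N IH]; first by rewrite big_geq// mul0r expr0 subrr.
  by rewrite big_nat_recr//= mulrDl IH exprS; ring.
by rewrite gerBl exprn_ge0.
Qed.

(** The triangle inequality in squared form, by induction with the partial geometric sum; that sum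
    is bounded by its limit only at the end. *)
Let inner_W N : inner mu (W N) (W N) <= ((1 - q)^-1 * b) ^+ 2.
Proof.
apply: (@le_trans _ _ (((\sum_(0 <= n < N) q ^+ n) * b) ^+ 2)); last first.
  rewrite ler_sqr ?nnegrE ?mulr_ge0 ?sumr_ge0//; last 2 first.
  - by move=> n _; rewrite exprn_ge0.
  - by rewrite invr_ge0 subr_ge0; case/andP: q01 => _ /ltW.
  by rewrite ler_wpM2r.
elim: N => [|N IH].
  have -> : W 0 = cst 0 by apply/funext => x; rewrite /W big_geq.
  by rewrite inner0l sqr_ge0.
have -> : W N.+1 = (fun x => W N x + q ^+ N * `|v N x|).
  by apply/funext => x; rewrite /W big_nat_recr.
have La := L2_abs _ (Lv N); have Lqa := L2_scale mu (q ^+ N) _ La.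
rewrite inner_sqDl// big_nat_recr//=.
set s := \sum_(0 <= n < N) q ^+ n.
have s0 : 0 <= s by rewrite sumr_ge0// => n _; rewrite exprn_ge0.
have qN0 : 0 <= q ^+ N by rewrite exprn_ge0.
have yy : inner mu (fun x => q ^+ N * `|v N x|) (fun x => q ^+ N * `|v N x|) <= (q ^+ N * b) ^+ 2.
  rewrite innerZl// innerZr// mulrA -expr2 exprMn ler_wpM2l ?sqr_ge0//.
  apply: le_trans (vb N); rewrite le_eqVlt; apply/orP; left; apply/eqP.
  by apply: eq_Rintegral => x _; rewrite -!expr2 real_normK ?num_real.
have Wy : inner mu (W N) (fun x => q ^+ N * `|v N x|) <= s * b * (q ^+ N * b).
  have := inner_cauchy_schwarz mu _ _ (LW N) Lqa.
  move=> /le_trans/(_ (ler_pM (inner_ge0 _ _) (inner_ge0 _ _) IH yy)).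
  rewrite -exprMn => H; apply: le_trans (ler_norm _) _.
  by rewrite -ler_sqr ?nnegrE ?mulr_ge0// real_normK ?num_real.
have -> : ((s + q ^+ N) * b) ^+ 2 = (s * b) ^+ 2 + 2 * (s * b * (q ^+ N * b)) + (q ^+ N * b) ^+ 2.
  by ring.
by rewrite !lerD// ler_wpM2l.
Qed.

Let mW2N N : measurable_fun setT (fun x => (W N x ^+ 2)%:E).
Proof. by apply/measurable_EFinP; apply: measurable_funX; exact: L2_measurable (LW N). Qed.

Let integrable_W2 : mu.-integrable setT W2.
Proof.
have mW2 : measurable_fun setT W2.
  apply: (emeasurable_fun_cvg (fun N x => (W N x ^+ 2)%:E)) => // x _.
  exact: ereal_nondecreasing_is_cvgn.
have W20 x : (0 <= W2 x)%E by apply: le_trans (W_le_W2 0 x); rewrite lee_fin sqr_ge0.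
apply/integrableP; split => //.
under eq_integral do rewrite gee0_abs//.
rewrite monotone_convergence//; last by move=> N x _; rewrite lee_fin sqr_ge0.
apply: (@le_lt_trans _ _ (((1 - q)^-1 * b) ^+ 2)%:E); last by rewrite ltry.
apply: lime_le.
  apply: ereal_nondecreasing_is_cvgn => m n mn; apply: ge0_le_integral => //.
  - by move=> x _; rewrite lee_fin sqr_ge0.
  - by move=> x _; exact: W2_nd.
apply: nearW => N; apply: (@le_trans _ _ (inner mu (W N) (W N))%:E); last first.
  by rewrite lee_fin; exact: inner_W.
have := integrable_fin_num measurableT (L2_mul_integrable mu _ _ (LW N) (LW N)).
rewrite /inner /Rintegral => /fineK ->.
by under [leLHS]eq_integral do rewrite expr2.
Qed.

(** The upper limit is measurable whether or not the series converges at x, and it is the sum at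
    almost every x. *)
Let c (x : T) : R := fine (limn_esup (fun N => (S N x)%:E)).

Let S_cvg : {ae mu, forall x, S N x @[N --> \oo] --> c x}.
Proof.
have := integrable_ae measurableT integrable_W2.
apply: filterS => x /(_ Logic.I) Wfin.
have SE : (S ^~ x) = series (fun n => q ^+ n * v n x) by [].
have S_is_cvg : cvgn (S ^~ x).
  rewrite SE; apply: normed_cvg.
  have -> : [normed series (fun n => q ^+ n * v n x)] = W ^~ x.
    apply/funext => N; rewrite /W /=; apply: eq_bigr => n _.
    by rewrite normrM ger0_norm ?exprn_ge0.
  apply: nondecreasing_is_cvgn; first exact: W_nd.
  exists (fine (W2 x) + 1) => _ [N _ <-].
  have := W_le_W2 N x; rewrite -(fineK Wfin) lee_fin.
  have := W_ge0 N x; nra.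
have : (S N x)%:E @[N --> \oo] --> (limn (S ^~ x))%:E by apply: cvg_EFin => //; exact: nearW.
rewrite /c => Sl.
have -> : limn_esup (fun N => (S N x)%:E) = (limn (S ^~ x))%:E.
  rewrite is_cvg_limn_esupE; first exact/cvg_lim.
  by apply/cvg_ex; eexists; exact: Sl.
exact: S_is_cvg.
Qed.

Let mc : measurable_fun setT c.
Proof.
apply: (@measurableT_comp _ _ _ _ _ _ (@fine R)) => //.
apply: measurable_fun_limn_esup => N.
by apply/measurable_EFinP; exact: L2_measurable (LS N).
Qed.

Let S2_le N x : ((S N x ^+ 2)%:E <= W2 x)%E.
Proof.
apply: le_trans (W_le_W2 N x); rewrite lee_fin -real_normK ?num_real//.
by rewrite ler_sqr ?nnegrE ?W_ge0.
Qed.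

Let Lc : L2 mu c.
Proof.
apply/L2P; split => //.
have [] := @dominated_convergence _ _ _ mu setT measurableT
  (fun N x => (S N x ^+ 2)%:E) (EFin \o (fun x => c x ^+ 2)) W2 => //.
- by move=> N; apply/measurable_EFinP; apply: measurable_funX; exact: L2_measurable (LS N).
- by apply/measurable_EFinP; exact: measurable_funX.
- apply: filterS S_cvg => x Sx _; apply: cvg_EFin; first exact: nearW.
  by apply: (@cvg_comp _ _ _ (S ^~ x) (fun r : R => r ^+ 2)); [exact: Sx|exact: exprn_continuous].
- by apply: aeW => x N _; rewrite gee0_abs ?lee_fin ?sqr_ge0.
Qed.

Lemma L2_geometric_series : exists2 c, L2 mu c & forall h, L2 mu h ->
  \sum_(0 <= n < N) q ^+ n * inner mu (v n) h @[N --> \oo] --> inner mu c h.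
Proof.
exists c; first exact: Lc.
move=> h Lh.
have mh := L2_measurable _ _ Lh.
have Sint N := integrable_fin_num measurableT (L2_mul_integrable mu _ _ (LS N) Lh).
have cint := integrable_fin_num measurableT (L2_mul_integrable mu _ _ Lc Lh).
have mSh N : measurable_fun setT (fun x => (S N x * h x)%:E).
  by apply/measurable_EFinP; apply: measurable_funM => //; exact: L2_measurable (LS N).
have mch : measurable_fun setT (EFin \o (fun x => c x * h x)).
  by apply/measurable_EFinP; exact: measurable_funM.
have Sch : {ae mu, forall x, setT x -> (S N x * h x)%:E @[N --> \oo] --> (c x * h x)%:E}.
  apply: filterS S_cvg => x Sx _; apply: cvg_EFin; first exact: nearW.
  by apply: cvgM => //; exact: cvg_cst.
(* It dominates every product S N x * h x, whose absolute value is at most S N x ^ 2 + h x ^ 2. *)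
have idom : mu.-integrable setT (fun x => W2 x + (h x ^+ 2)%:E)%E.
  by apply: integrableD => //; case/L2P: Lh.
have dom : {ae mu, forall x N, setT x -> (`|(S N x * h x)%:E| <= W2 x + (h x ^+ 2)%:E)%E}.
  apply: aeW => x N _; apply: (@le_trans _ _ ((S N x ^+ 2)%:E + (h x ^+ 2)%:E)%E).
    by rewrite -EFinD lee_fin ler_norml; apply/andP; split; nra.
  by rewrite leeD2r.
have [_ _] := dominated_convergence measurableT mSh mch Sch idom dom.
rewrite -(fineK cint) => /fine_cvgP[_].
rewrite (_ : fine \o _ = fun N => \sum_(0 <= n < N) q ^+ n * inner mu (v n) h)//.
apply/funext => N; rewrite -[LHS]/(inner mu (S N) h).
rewrite (inner_suml mu _ _ (fun n x => q ^+ n * v n x))//; last by move=> n; exact: L2_scale.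
by apply: eq_bigr => n _; rewrite innerZl.
Qed.

End L2_geometric_series.

(** * Contraction and the Neumann series of the kernel *)

Section neumann.
Context {d} {E : measurableType d} {R : realType} {nu : probability E R}
  {K : R.-pker E ~> E} {d'} {Omega : measurableType d'} {P : probability Omega R}
  {X : int -> {RV P >-> E}}.
Hypothesis chainX : stationary_markov_chain X nu K.
Hypothesis reversible : self_adjoint nu (L2 nu) (kernel_op K).
Local Notation ev := (@window_fun _ _ _ _ _ _ X _).

Lemma inner_marg a b s : measurable_fun setT a -> measurable_fun setT b ->
  inner nu a b = inner P (ev (marg a) s) (ev (marg b) s).
Proof.
move=> ma mb; rewrite /inner -(Rintegral_marginal chainX s); last exact: measurable_funM.
by apply: eq_Rintegral => w _; rewrite !ev_marg.
Qed.

(** The squared norm of K a is the correlation of a(X_1) with (K a)(X_0); Cauchy-Schwarz bounds it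
    by the product of the norms of a and K a. *)
Lemma kernel_op_contraction a : L2 nu a ->
  inner nu (kernel_op K a) (kernel_op K a) <= inner nu a a.
Proof.
move=> La; have LK := L2_kernel_op chainX a La.
have ma := L2_measurable _ _ La; have mK := L2_measurable _ _ LK.
have LMa := (L2_margP chainX a ma).2 La; have LMK := (L2_margP chainX _ mK).2 LK.
have LMb : L2 (path_law X 2) (marg a \o block 1 1 2).
  apply/(L2_evP chainX 2 0); first by apply: measurableT_comp; [exact: measurable_marg|exact: measurable_block].
  by rewrite ev_block//; exact: (L2_ev chainX).
have E1 : inner nu (kernel_op K a) (kernel_op K a) =
    inner P (ev (marg a) 1) (ev (marg (kernel_op K a)) 0).
  rewrite (inner_marg _ _ 0 mK mK) -{1}cond_next_marg.
  by rewrite -(inner_cond_next chainX 1 1 _ _ 0 0 isT _ LMb LMK)// ev_block// add0r.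
have := inner_cauchy_schwarz P _ _ (L2_ev chainX 1 1 _ LMa) (L2_ev chainX 1 0 _ LMK).
rewrite -E1 -!inner_marg//.
have := inner_ge0 nu (kernel_op K a); have := inner_ge0 nu a.
move: (inner nu a a) (inner nu _ _) => u v u0 v0 uv.
by rewrite leNgt; apply/negP => vu; nra.
Qed.

(** c is the sum of the q^n K^n a. The equation is checked weakly: self-adjointness moves K to the
    test function h, where the weak limit applies. The residual is thus orthogonal to all of L^2,
    itself included. Testing against 1 shows that c is centered. *)
Lemma neumann q a : 0 <= q < 1 -> L20 nu a ->
  exists2 c, L20 nu c & (fun x => c x - q * kernel_op K c x) = a %[ae nu].
Proof.
move=> q01 [La a0].
pose v n := iter n (kernel_op K) a.
have Lv n : L2 nu (v n) by elim: n => //= n; exact: (L2_kernel_op chainX).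
have vb n : inner nu (v n) (v n) <= Num.sqrt (inner nu a a) ^+ 2.
  rewrite sqr_sqrtr ?inner_ge0//; elim: n => [|n IH]//.
  by apply: le_trans IH; exact: kernel_op_contraction.
have [c Lc c_lim] := L2_geometric_series nu v q _ Lv q01 vb (sqrtr_ge0 _).
have LKc := L2_kernel_op chainX c Lc.
have c_mean : inner nu c (cst 1) = 0.
  have vn n : inner nu (v n) (cst 1) = 0.
    elim: n => [|n IH]; first by rewrite -a0; apply: eq_Rintegral => x _; rewrite mulr1.
    by rewrite /= (reversible _ _ (Lv n) (L2_cst nu 1)) kernel_op1.
  have := c_lim _ (L2_cst nu 1).
  under eq_fun do under eq_bigr do rewrite vn mulr0.
  under eq_fun do rewrite big1//.
  by move=> /(cvg_lim (@Rhausdorff R)) <-; exact: lim_cst.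
exists c; first by split => //; rewrite -c_mean; apply: eq_Rintegral => x _; rewrite mulr1.
have weak h : L2 nu h -> inner nu c h - q * inner nu (kernel_op K c) h = inner nu a h.
  move=> Lh; have LKh := L2_kernel_op chainX h Lh.
  apply/eqP; rewrite subr_eq; apply/eqP; rewrite (reversible c h Lc Lh).
  have l1 : \sum_(0 <= n < N.+1) q ^+ n * inner nu (v n) h @[N --> \oo] --> inner nu c h.
    by rewrite (cvg_shiftS (fun N => \sum_(0 <= n < N) q ^+ n * inner nu (v n) h)); exact: c_lim.
  have l2 : inner nu a h + q * \sum_(0 <= n < N) q ^+ n * inner nu (v n) (kernel_op K h)
      @[N --> \oo] --> inner nu a h + q * inner nu c (kernel_op K h).
    by apply: cvgD; [exact: cvg_cst|apply: cvgM; [exact: cvg_cst|exact: c_lim]].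
  rewrite -(cvg_lim (@Rhausdorff R) l1) -(cvg_lim (@Rhausdorff R) l2); congr (lim (_ @ \oo)).
  apply/funext => N; rewrite big_nat_recl//= expr0 mul1r mulr_sumr; congr (_ + _).
  by apply: eq_bigr => n _; rewrite (reversible _ _ (Lv n) Lh) exprS mulrA.
have Lqk := L2_scale nu q _ LKc; have Lcq := L2_sub nu _ _ Lc Lqk.
have Lres := L2_sub nu _ _ Lcq La.
have := inner_eq0 nu _ Lres.
rewrite {1}innerBl// innerBl// innerZl// weak// subrr => /(_ erefl).
by apply: filterS => x /(_ Logic.I)/eqP; rewrite subr_eq0 => /eqP.
Qed.

(** Division by k reduces this to the Neumann series for q = (k - 2) / k and the right-hand side a /
    k. *)
Lemma kernel_resolvent k a : (2 <= k)%N -> L20 nu a ->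
  exists2 c, L20 nu c & (fun x => k%:R * c x - (k%:R - 2) * kernel_op K c x) = a %[ae nu].
Proof.
move=> k2 La; have k0 : 0 < k%:R :> R by rewrite ltr0n; exact: leq_trans k2.
have k2' : 2 <= k%:R :> R by rewrite ler_nat.
have q01 : 0 <= (k%:R - 2 : R) / k%:R < 1.
  apply/andP; split; first by rewrite divr_ge0 ?subr_ge0 ?(ltW k0).
  by rewrite ltr_pdivrMr// mul1r ltrBlDr ltrDl.
have La' : L20 nu (fun x => a x / k%:R).
  have := L20_comb chainX (k%:R^-1 - 1) _ _ La La.
  by congr (L20 nu _); apply/funext => x; ring.
have [c Lc cE] := neumann _ _ q01 La'; exists c => //.
apply: filterS cE => x /(_ Logic.I) cx _.
have -> : a x = k%:R * (a x / k%:R) by rewrite mulrC divfK// gt_eqF.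
by rewrite -cx; field; rewrite gt_eqF.
Qed.

End neumann.

(** * The decomposition *)

Section incremental_splitting.
Context {d} {E : measurableType d} {R : realType} {nu : probability E R}
  {K : R.-pker E ~> E} {d'} {Omega : measurableType d'} {P : probability Omega R}
  {X : int -> {RV P >-> E}}.
Hypothesis chainX : stationary_markov_chain X nu K.
Hypothesis reversible : self_adjoint nu (L2 nu) (kernel_op K).
Hypothesis invertible : invertible_on nu (L20 nu)
  (fun h x => h x - kernel_op K (kernel_op K h) x).
Local Notation ev := (@window_fun _ _ _ _ _ _ X _).
Local Notation cond_next := (@cond_exp_next _ _ _ K _).
Local Notation cond_prev := (@cond_exp_prev _ _ _ K _).

Lemma incremental_of_inner n (F : n.+2.-tuple E -> R) (l r : n.+1.-tuple E -> R) :
  path_space X n.+2 F -> path_space X n.+1 l -> path_space X n.+1 r ->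
  (forall g, path_space X n.+1 g ->
     inner P (ev F 0) (ev g 0) = inner P (ev l 0) (ev g 0) + inner P (ev r 1) (ev g 0)) ->
  (forall g, path_space X n.+1 g ->
     inner P (ev F 0) (ev g 1) = inner P (ev l 0) (ev g 1) + inner P (ev r 1) (ev g 1)) ->
  incremental_space X n.+2
    (fun x => F x - l (block 0 n.+1 n.+2 x) - r (block 1 n.+1 n.+2 x)).
Proof.
move=> HF Hl Hr g0 g1.
have Hl0 : path_space X n.+2 (l \o block 0 n.+1 n.+2) by exact: (path_space_block chainX).
have Hr1 : path_space X n.+2 (r \o block 1 n.+1 n.+2) by exact: (path_space_block chainX).
have HFl := path_spaceB chainX _ _ _ HF Hl0.
have E1 g s : path_space X n.+1 g ->
    inner P (ev (fun x => F x - l (block 0 n.+1 n.+2 x) - r (block 1 n.+1 n.+2 x)) 0) (ev g s) =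
    inner P (ev F 0) (ev g s) - inner P (ev l 0) (ev g s) - inner P (ev r 1) (ev g s).
  move=> Hg; have Lg := path_space_ev chainX _ s _ Hg.
  rewrite (innerBl P _ _ _ (path_space_ev chainX _ 0 _ HFl) (path_space_ev chainX _ 0 _ Hr1) Lg).
  rewrite (innerBl P _ _ _ (path_space_ev chainX _ 0 _ HF) (path_space_ev chainX _ 0 _ Hl0) Lg).
  by rewrite !ev_block// addr0 add0r.
apply/(incremental_spaceP chainX); split; first exact: (path_spaceB chainX).
  by move=> g Hg; rewrite E1// g0//; ring.
by move=> g Hg; rewrite E1// g1//; ring.
Qed.

(* The left and right parts a and b must solve a + K b = E[F | X_1] and
   K a + b = E[F | X_2], whence (I - K^2) a = E[F | X_1] - K E[F | X_2]. *)
Lemma split_increment2 (F : 2.-tuple E -> R) : path_space X 2 F ->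
  exists l r : 1.-tuple E -> R, [/\ path_space X 1 l, path_space X 1 r &
    incremental_space X 2 (fun x => F x - l (block 0 1 2 x) - r (block 1 1 2 x))].
Proof.
move=> HF; have LF := path_space_L2 _ _ HF.
have Ha := path_space_cond_next chainX 1 F isT HF.
have Hb := path_space_cond_prev chainX reversible 1 F isT HF.
pose alpha x := cond_next F [tuple x]; pose beta x := cond_prev F [tuple x].
have alphaE : cond_next F = marg alpha by exact: margE.
have betaE : cond_prev F = marg beta by exact: margE.
have Lalpha : L20 nu alpha by exact: (L20_of_path_space chainX).
have Lbeta : L20 nu beta by exact: (L20_of_path_space chainX).
have L20B u w : L20 nu u -> L20 nu w -> L20 nu (fun x => u x - w x).
  move=> Lu Lw; have := L20_comb chainX (-1) _ _ Lw Lu.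
  by congr (L20 nu _); apply/funext => x; ring.
have [S [C SP]] := invertible.
have LKb := L20_kernel_op chainX _ Lbeta.
pose a := S (fun x => alpha x - kernel_op K beta x).
have [La _ _ aE] := SP _ (L20B _ _ Lalpha LKb).
rewrite -/a in La aE.
have LKa := L20_kernel_op chainX _ La; have LKKa := L20_kernel_op chainX _ LKa.
pose b x := beta x - kernel_op K a x.
have Lb : L20 nu b by exact: L20B.
exists (marg a), (marg b); split; [exact: (path_space_marg chainX)..|].
have Hma := path_space_marg chainX _ La; have Hmb := path_space_marg chainX _ Lb.
apply: incremental_of_inner => // g Hg; have Lg := path_space_L2 _ _ Hg.
  have [g' Lg' gE] : exists2 g', L20 nu g' & g = marg g'.
    by exists (fun x => g [tuple x]); [exact: (L20_of_path_space chainX)|exact: margE].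
  have mg' := L20_measurable _ Lg'.
  rewrite (inner_cond_next chainX 1 1 F g 0 0 isT _ LF Lg)// alphaE.
  have Hmb1 : path_space X 2 (marg b \o block 1 1 2) by exact: (path_space_block chainX).
  have -> : inner P (ev (marg b) 1) (ev g 0) = inner nu (kernel_op K b) g'.
    rewrite -[1]add0r -(ev_block 1 1 2 (marg b) 0)//.
    rewrite (inner_cond_next chainX 1 1 _ g 0 0 isT _ (path_space_L2 _ _ Hmb1) Lg)//.
    rewrite cond_next_marg gE -(inner_marg chainX)//.
    exact: L20_measurable (L20_kernel_op chainX _ Lb).
  rewrite gE -!(inner_marg chainX)//; [|exact: L20_measurable La|exact: L20_measurable Lalpha].
  rewrite (reversible b g' Lb.1 Lg'.1) /b innerBl; [|exact: Lbeta.1|exact: LKa.1|]; last first.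
    exact: (L20_kernel_op chainX _ Lg').1.
  rewrite -(reversible beta g' Lbeta.1 Lg'.1) -(reversible _ g' LKa.1 Lg'.1).
  have := inner_ael nu _ _ g' (L20B _ _ La LKKa).1 (L20B _ _ Lalpha LKb).1 Lg'.1 aE.
  rewrite (innerBl nu _ _ _ La.1 LKKa.1 Lg'.1) (innerBl nu _ _ _ Lalpha.1 LKb.1 Lg'.1).
  move: (inner nu a g') (inner nu alpha g') (inner nu (kernel_op K beta) g')
    (inner nu (kernel_op K (kernel_op K a)) g') => u1 u2 u3 u4; lra.
have [g' Lg' gE] : exists2 g', L20 nu g' & g = marg g'.
  by exists (fun x => g [tuple x]); [exact: (L20_of_path_space chainX)|exact: margE].
have mg' := L20_measurable _ Lg'.
rewrite (inner_cond_prev chainX reversible 1 1 F g 0 1 isT _ LF Lg)// betaE add0r.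
have Hma0 : path_space X 2 (marg a \o block 0 1 2) by exact: (path_space_block chainX).
have -> : inner P (ev (marg a) 0) (ev g 1) = inner nu (kernel_op K a) g'.
  have <- : ev (marg a \o block 0 1 2) 0 = ev (marg a) 0 by rewrite ev_block// addr0.
  rewrite (inner_cond_prev chainX reversible 1 1 _ g 0 1 isT _ (path_space_L2 _ _ Hma0) Lg)//.
  rewrite cond_prev_marg gE add0r -(inner_marg chainX)//.
  exact: L20_measurable LKa.
rewrite gE -!(inner_marg chainX)//; [|exact: L20_measurable Lb|exact: L20_measurable Lbeta].
rewrite /b (innerBl nu _ _ _ Lbeta.1 LKa.1 Lg'.1).
by move: (inner nu beta g') (inner nu (kernel_op K a) g') => u1 u2; ring.
Qed.

(* For at least three coordinates the conditional expectations given the left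
   and the right block commute, so the parts are l = E[F | left] and
   r = E[F | right] - E[l | right], without inverting anything. *)
Lemma split_increment n (F : n.+2.-tuple E -> R) : path_space X n.+2 F ->
  exists l r : n.+1.-tuple E -> R, [/\ path_space X n.+1 l, path_space X n.+1 r &
    incremental_space X n.+2
      (fun x => F x - l (block 0 n.+1 n.+2 x) - r (block 1 n.+1 n.+2 x))].
Proof.
case: n F => [|n] F HF; first exact: split_increment2.
have LF := path_space_L2 _ _ HF.
pose l := cond_next F; pose bF := cond_prev F; pose pl := cond_prev l.
have Hl : path_space X n.+2 l by exact: (path_space_cond_next chainX).
have HbF : path_space X n.+2 bF by exact: (path_space_cond_prev chainX reversible).
have Hpl : path_space X n.+1 pl by exact: (path_space_cond_prev chainX reversible).
have Hplb : path_space X n.+2 (pl \o block 0 n.+1 n.+2) by exact: (path_space_block chainX).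
have Hr := path_spaceB chainX _ _ _ HbF Hplb.
exists l, (fun y => bF y - pl (block 0 n.+1 n.+2 y)); split => //.
have rE g s : path_space X n.+2 g ->
    inner P (ev (fun y => bF y - pl (block 0 n.+1 n.+2 y)) 1) (ev g s) =
    inner P (ev bF 1) (ev g s) - inner P (ev pl 1) (ev g s).
  move=> Hg; rewrite (innerBl P _ _ _ (path_space_ev chainX _ 1 _ HbF)
    (path_space_ev chainX _ 1 _ Hplb) (path_space_ev chainX _ s _ Hg)).
  by rewrite ev_block// addr0.
have Ll := path_space_L2 _ _ Hl; have LbF := path_space_L2 _ _ HbF.
have Lpl := path_space_L2 _ _ Hpl.
have s1 : (0 : int) + 1 <= 1 by [].
apply: (incremental_of_inner n.+1 F l _ HF Hl Hr) => g Hg; have Lg := path_space_L2 _ _ Hg.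
  pose pg := cond_prev g.
  have Lpg : L2 (path_law X n.+1) pg by exact: (L2_cond_prev chainX reversible).
  rewrite rE// (inner_cond_next chainX n.+2 n.+2 F g 0 0 isT _ LF Lg)// -/l.
  (* Both sides see g only through [pg], its conditional expectation on the block common to the left
     and right windows, and F and l have the same correlation with any function of that block. *)
  suff -> : inner P (ev bF 1) (ev g 0) = inner P (ev pl 1) (ev g 0) by ring.
  rewrite innerC (inner_cond_prev chainX reversible n.+1 n.+2 g bF 0 1 isT s1 Lg LbF) -/pg add0r.
  rewrite [RHS]innerC (inner_cond_prev chainX reversible n.+1 n.+1 g pl 0 1 isT s1 Lg Lpl) -/pg add0r.
  rewrite innerC [RHS]innerC.
  have := inner_cond_prev chainX reversible n.+2 n.+1 F pg 0 1 isT s1 LF Lpg.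
  rewrite -/bF add0r => <-.
  have := inner_cond_prev chainX reversible n.+1 n.+1 l pg 0 1 isT s1 Ll Lpg.
  rewrite -/pl add0r => <-.
  have H : (1 : int) + n.+1%:Z <= 0 + n.+2%:Z by lia.
  by rewrite (inner_cond_next chainX n.+2 n.+1 F pg 0 1 isT H LF Lpg).
rewrite rE//.
have := inner_cond_prev chainX reversible n.+2 n.+2 F g 0 1 isT s1 LF Lg.
have := inner_cond_prev chainX reversible n.+1 n.+2 l g 0 1 isT s1 Ll Lg.
by rewrite -/pl -/bF add0r => -> ->; ring.
Qed.

End incremental_splitting.

(** Used with x = <f, g> and y = <g, g> to pass from sums of marginals to their closure. *)
Lemma eq0_of_small_sqr {R : realFieldType} (x y : R) :
  (forall e, 0 < e -> x ^+ 2 <= e ^+ 2 * y) -> x = 0.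
Proof.
move=> xy; apply/eqP; rewrite -sqrf_eq0 eq_le sqr_ge0 andbT leNgt; apply/negP => x0.
have y0 : 0 < y.
  by have := lt_le_trans x0 (xy 1 ltr01); rewrite expr1n mul1r.
pose t := x ^+ 2 / y; have t0 : 0 < t by rewrite divr_gt0.
(* This choice gives e < 1 and e < t, hence e ^ 2 < t = x ^ 2 / y. *)
pose e := t / (1 + t); have t1 : 0 < 1 + t by rewrite addr_gt0.
have e0 : 0 < e by rewrite divr_gt0.
have := xy e e0; rewrite -ler_pdivrMr// -/t leNgt => /negP; apply.
have e1 : e < 1 by rewrite ltr_pdivrMr// mul1r ltrDr.
have et : e < t by rewrite ltr_pdivrMr// mulrDr mulr1 ltrDl mulr_gt0.
by apply: le_lt_trans et; rewrite expr2 ler_piMr// ltW.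
Qed.

(** The differences of components sum to 0; pairing that sum with the i-th difference leaves only
    its squared norm. *)
Lemma orthogonal_direct_sum_uniq {d} {T : measurableType d} {R : realType}
    (mu : probability T R) (V : set (T -> R)) (s : seq (set (T -> R)))
    (g g' : nat -> T -> R) :
  V `<=` L2 mu -> orthogonal_direct_sum mu V s ->
  (forall i, (i < size s)%N -> nth set0 s i (g i)) ->
  (forall i, (i < size s)%N -> nth set0 s i (g' i)) ->
  (fun x => \sum_(i < size s) g i x) = (fun x => \sum_(i < size s) g' i x) %[ae mu] ->
  forall i, (i < size s)%N -> g i = g' i %[ae mu].
Proof.
move=> VL [sub ortho _] sg sg' gg' i is_.
pose z j := if (j < size s)%N then (fun x => -1 * g' j x + g j x) else cst 0.
have sz j : (j < size s)%N -> nth set0 s j (z j).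
  by move=> js; rewrite /z js; have [_ _ comb] := sub _ js; apply: comb; auto.
have Lz j : L2 mu (z j).
  have [js|js] := ltnP j (size s); first by apply: VL; have [+ _ _] := sub _ js; apply; auto.
  by rewrite /z ltnNge js; exact: L2_cst.
have z0 : (fun x => \sum_(j < size s) z j x) = cst 0 %[ae mu].
  apply: filterS gg' => x /(_ Logic.I) gx _.
  under eq_bigr do rewrite /z ltn_ord.
  by rewrite big_split/= -mulr_sumr gx; ring.
have Ls : L2 mu (fun x => \sum_(j < size s) z j x) by apply: L2_sum => j; exact: Lz.
have zi0 : inner mu (z i) (z i) = 0.
  have := inner_ael mu _ (cst 0) (z i) Ls (L2_cst _ _) (Lz i) z0.
  rewrite inner0l (inner_suml mu _ _ (fun j : 'I_(size s) => z j)); [|by move=> j; exact: Lz|exact: Lz].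
  rewrite (bigD1 (Ordinal is_))//= big1 ?addr0// => j ji.
  by apply: (ortho j i) => //; exact: sz.
have := inner_eq0 mu _ (Lz i) zi0; rewrite /z is_.
by apply: filterS => x /(_ Logic.I) /= zx _; lra.
Qed.

(** * Orthogonality of the summands and existence of the decomposition *)

Section decomposition.
Context {d} {E : measurableType d} {R : realType} {nu : probability E R}
  {K : R.-pker E ~> E} {d'} {Omega : measurableType d'} {P : probability Omega R}
  {X : int -> {RV P >-> E}} {k : nat}.
Hypothesis chainX : stationary_markov_chain X nu K.
Hypothesis k_ge2 : (2 <= k)%N.
Hypothesis reversible : self_adjoint nu (L2 nu) (kernel_op K).
Hypothesis gk_cvg : green_kubo_cvg X K k.
Local Notation ev := (@window_fun _ _ _ _ _ _ X _).
Local Notation H := (path_space X k).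
Local Notation pi := (path_law X k).
Local Notation ker := (ker_green_kubo X K k).
Local Notation M := (marginal_space X nu k).
Local Notation Mplus := (marginal_plus X nu K k).
Local Notation gk := (@gk _ _ _ K _ _ _ X k).
Local Notation mrange := (@marg_range _ E R K k).
Local Notation mcoef := (@marg_coef _ E R K k).

Let k_gt0 : (0 < k)%N. Proof. exact: leq_trans k_ge2. Qed.

Lemma L20_cst0 : L20 nu (cst 0).
Proof.
apply/(path_space_margP chainX); first exact: measurable_cst.
exact: (path_space0 chainX).
Qed.

Lemma L20_sum (I : Type) (s : seq I) (a : I -> E -> R) : (forall i, L20 nu (a i)) ->
  L20 nu (fun y => \sum_(i <- s) a i y).
Proof.
move=> La; elim: s => [|i s IH].
  by under eq_fun do rewrite big_nil; exact: L20_cst0.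
under eq_fun do rewrite big_cons.
have := L20_comb chainX 1 _ _ (La i) IH.
by congr (L20 nu _); apply/funext => y; rewrite mul1r.
Qed.

(** The approximating family is reindexed by [nat], with 0 out of range, the form in which the
    lemmas on sums of marginals are stated. *)
Lemma marginal_approx f e : M f -> 0 < e -> exists2 a : nat -> E -> R,
  (forall i, L20 nu (a i)) &
  inner pi (fun x => f x - \sum_(i < k) a i (tnth x i))
    (fun x => f x - \sum_(i < k) a i (tnth x i)) < e ^+ 2.
Proof.
move=> [Hf fa] e0; have [a La ae] := fa e e0.
have L0 := L20_cst0.
exists (fun i => if insub i is Some j then a j else cst 0).
  by move=> i; case: insubP.
have aE x : \sum_(i < k) (if insub (i : nat) is Some j then a j else cst 0) (tnth x i) =
    \sum_(i < k) a i (tnth x i).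
  by apply: eq_bigr => i _; rewrite valK.
under eq_fun do rewrite aE.
apply: L2norm_lt => //; apply: L2_sub; first exact: path_space_L2 Hf.
apply: path_space_L2; under eq_fun do rewrite -aE.
apply: (path_space_marg_sum chainX k (fun i => if insub i is Some j then a j else cst 0)) => i.
by case: insubP.
Qed.

Lemma marginal_space_sum (a : nat -> E -> R) : (forall i, L20 nu (a i)) ->
  M (fun x => \sum_(i < k) a i (tnth x i)).
Proof.
move=> La; split; first exact: (path_space_marg_sum chainX).
move=> e e0; exists (fun i : 'I_k => a i) => //.
under eq_fun do rewrite subrr.
apply: lt_L2norm => //; first exact: L2_cst.
by rewrite inner0l exprn_gt0.
Qed.

Lemma marginal_space_comb t f g : M f -> M g -> M (fun x => t * f x + g x).
Proof.
move=> Mf Mg; have Hf := Mf.1; have Hg := Mg.1.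
split; first exact: (path_space_comb chainX).
(* Approximating f and g within e / (2 c) puts the combination within (|t| + 1) e / (2 c) = e /
   2. *)
move=> e e0; pose c := 1 + `|t|.
have c0 : 0 < c by rewrite ltr_wpDr.
have ec : 0 < e / (2 * c) by rewrite divr_gt0// mulr_gt0.
have [a La fa] := marginal_approx _ _ Mf ec.
have [b Lb gb] := marginal_approx _ _ Mg ec.
exists (fun i : 'I_k => fun x => t * a i x + b i x).
  by move=> i; exact: (L20_comb chainX).
set u := (fun x => f x - _) in fa; set v := (fun x => g x - _) in gb.
have Lu : L2 pi u.
  by apply: L2_sub; [exact: path_space_L2 Hf|exact: path_space_L2 (path_space_marg_sum chainX _ _ La)].
have Lv : L2 pi v.
  by apply: L2_sub; [exact: path_space_L2 Hg|exact: path_space_L2 (path_space_marg_sum chainX _ _ Lb)].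
rewrite (_ : (fun x => _) = (fun x => t * u x + v x)); last first.
  by apply/funext => x; rewrite /u /v big_split/= -mulr_sumr; ring.
have Ltu := L2_scale pi t _ Lu.
apply: lt_L2norm => //; first exact: L2_comb.
rewrite inner_sqDl// innerZl// innerZr// innerZl//.
have uu := inner_ge0 pi u; have vv := inner_ge0 pi v.
have uv := inner_cauchy_schwarz pi u v Lu Lv.
move: fa gb uu vv uv; rewrite -/u -/v.
move: (inner pi u u) (inner pi v v) (inner pi u v) => A B C.
set w := e / (2 * c) => Aw Bw A0 B0 CAB.
have w0 : 0 < w by [].
have Cw : `|C| <= w ^+ 2.
  rewrite -ler_sqr ?nnegrE ?sqr_ge0// real_normK ?num_real//.
  by apply: le_trans CAB _; rewrite expr2 ler_pM// ltW.
have wc : (w * c) ^+ 2 * 4 = e ^+ 2 by rewrite /w; field; rewrite gt_eqF.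
have tC : t * C <= `|t| * w ^+ 2.
  by apply: le_trans (ler_norm _) _; rewrite normrM ler_wpM2l.
have tA : t * (t * A) <= `|t| ^+ 2 * w ^+ 2.
  by rewrite mulrA -expr2 real_normK ?num_real// ler_wpM2l ?sqr_ge0// ltW.
have w20 : 0 < w ^+ 2 by rewrite exprn_gt0.
rewrite -wc exprMn /c; have := normr_ge0 t; move: (`|t|) tC tA => s tC tA s0.
by move: (w ^+ 2) w20 Bw tC tA => W W0 Bw tC tA; nra.
Qed.

Lemma ker_inner_marg_range c g : L20 nu c -> ker g -> inner pi (mrange c) g = 0.
Proof.
move=> Lc /(ker_green_kuboP chainX gk_cvg)[Hg g0].
rewrite -(gk_marg chainX reversible k k_gt0 gk_cvg c g Lc Hg).
have HcK : L20 nu (fun y => c y - kernel_op K c y).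
  have := L20_comb chainX (-1) _ _ (L20_kernel_op chainX _ Lc) Lc.
  by congr (L20 nu _); apply/funext => y; ring.
have Hb : H (fun x => marg (fun y => c y - kernel_op K c y) (block 0 1 k x)).
  by apply: (path_space_block chainX 0 1 k) => //; exact: (path_space_marg chainX).
by rewrite (gkC chainX k_gt0 reversible gk_cvg)// g0.
Qed.

Lemma marginal_plus_range c : L20 nu c -> Mplus (mrange c).
Proof.
move=> Lc; split; last by move=> g [_ kg]; exact: ker_inner_marg_range.
by apply: marginal_space_sum => i; exact: (L20_marg_coef chainX).
Qed.

Lemma marg_block_ae u v : L2 nu u -> L2 nu v -> u = v %[ae nu] ->
  (fun x => marg u (block 0 1 k x)) = (fun x => marg v (block 0 1 k x)) %[ae pi].
Proof.
move=> Lu Lv uv; have Luv := L2_sub nu _ _ Lu Lv.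
have muv := L2_measurable _ _ Luv.
have Lm : L2 pi (marg (fun x => u x - v x) \o block 0 1 k).
  apply/(L2_evP chainX k 0).
    by apply: measurableT_comp; [exact: measurable_marg|exact: measurable_block].
  by rewrite ev_block//; apply: (L2_ev chainX); apply/(L2_margP chainX).
have : inner pi (marg (fun x => u x - v x) \o block 0 1 k)
    (marg (fun x => u x - v x) \o block 0 1 k) = 0.
  rewrite (inner_path chainX k 0); [|exact: L2_measurable Lm..].
  rewrite ev_block// addr0 -(inner_marg chainX)//.
  rewrite (inner_ael nu _ (cst 0)) ?inner0l//; first exact: L2_cst.
  by apply: filterS uv => x uvx _; rewrite uvx// subrr.
move/(inner_eq0 pi _ Lm); apply: filterS => x /(_ Logic.I)/eqP.
by rewrite /= /marg subr_eq0 => /eqP.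
Qed.

Lemma ker_marg_range (a : E -> R) c : L20 nu a -> L20 nu c ->
  (fun x => k%:R * c x - (k%:R - 2) * kernel_op K c x) = a %[ae nu] ->
  ker (fun x => marg a (block 0 1 k x) - mrange c x).
Proof.
move=> La Lc ca; have Lm i := L20_marg_coef chainX k _ i Lc.
have k1 := ker_marg_sum chainX reversible k k_gt0 gk_cvg _ Lm.
have -> : (fun x => marg a (block 0 1 k x) - mrange c x) = fun x =>
   -1 * (mrange c x - marg (fun y => \sum_(i < k) mcoef c i y) (block 0 1 k x)) +
   (marg a (block 0 1 k x) - marg (fun y => \sum_(i < k) mcoef c i y) (block 0 1 k x)).
  by apply/funext => x; ring.
apply: (ker_comb chainX k_gt0 reversible gk_cvg); first exact: k1.
have Ls : L20 nu (fun y => \sum_(i < k) mcoef c i y).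
  exact: L20_sum.
have Hb u : L20 nu u -> H (fun x => marg u (block 0 1 k x)).
  by move=> Lu; apply: (path_space_block chainX 0 1 k) => //; exact: (path_space_marg chainX).
apply: (ker_ae chainX k_gt0 reversible gk_cvg (cst 0)).
- by apply: (path_spaceB chainX); exact: Hb.
- have Ra : (fun y => \sum_(i < k) mcoef c i y) = a %[ae nu].
    by apply: filterS ca => x cx _; rewrite marg_coef_sum// cx.
  by apply: filterS (marg_block_ae _ _ Ls.1 La.1 Ra) => x /(_ Logic.I) -> _; rewrite subrr.
- exact: (ker0 chainX k_gt0 reversible gk_cvg).
Qed.

Lemma exists_marg_range (a : E -> R) : L20 nu a ->
  exists2 c, L20 nu c & ker (fun x => marg a (block 0 1 k x) - mrange c x).
Proof.
move=> La; have [c Lc ca] := kernel_resolvent chainX reversible k a k_ge2 La.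
by exists c => //; exact: ker_marg_range ca.
Qed.

(* A sum of marginals F close to f differs from some [mrange c] by an element of
   M_k and ker B_k, to which both f and [mrange c] are orthogonal; hence
   [mrange c] is at least as close to f, and it is orthogonal to ker B_k. *)
Lemma marginal_plus_ker f g : Mplus f -> ker g -> inner pi f g = 0.
Proof.
move=> [Mf fK] kg; have Hf := Mf.1; have Hg := kg.1.
have Lf := path_space_L2 _ _ Hf; have Lg := path_space_L2 _ _ Hg.
apply: (eq0_of_small_sqr _ (inner pi g g)) => e e0.
have [a La fa] := marginal_approx _ _ Mf e0.
set F := (fun x => \sum_(i < k) a i (tnth x i)).
have HF : H F by exact: (path_space_marg_sum chainX).
have Ls : L20 nu (fun y => \sum_(i < k) a i y) by exact: L20_sum.
have [c Lc kc] := exists_marg_range _ Ls.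
have [Mr rK] := marginal_plus_range _ Lc; have Hr := Mr.1.
have k1 := ker_marg_sum chainX reversible k k_gt0 gk_cvg a La.
have ku : ker (fun x => F x - mrange c x).
  have := kerD chainX k_gt0 reversible gk_cvg _ _ k1 kc.
  by congr (ker _); apply/funext => x; rewrite addrA subrK.
have Mu : M (fun x => F x - mrange c x).
  have := marginal_space_comb (-1) _ _ Mr (marginal_space_sum a La).
  by congr (M _); apply/funext => x; rewrite -/(F x); ring.
have LF := path_space_L2 _ _ HF; have Lr := path_space_L2 _ _ Hr.
have Lu := L2_sub pi _ _ LF Lr; have Lfr := L2_sub pi _ _ Lf Lr.
have fg : inner pi f g = inner pi (fun x => f x - mrange c x) g.
  by rewrite innerBl// ker_inner_marg_range// subr0.
rewrite fg; apply: le_trans (inner_cauchy_schwarz pi _ _ Lfr Lg) _.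
rewrite ler_wpM2r ?inner_ge0//.
apply: le_trans (ltW fa).
have -> : (fun x => f x - F x) = (fun x => (f x - mrange c x) + -1 * (F x - mrange c x)).
  by apply/funext => x; ring.
have Lnu := L2_scale pi (-1) _ Lu.
have orth : inner pi (fun x => f x - mrange c x) (fun x => F x - mrange c x) = 0.
  by rewrite (innerBl pi _ _ _ Lf Lr Lu) (fK _ (conj Mu ku)) (rK _ (conj Mu ku)) subrr.
rewrite [leRHS](inner_sqDl pi _ _ Lfr Lnu) (innerZr pi _ _ _ Lu Lfr) orth !mulr0 addr0.
by rewrite lerDl inner_ge0.
Qed.

Lemma gk_block_sum_space m f g : (2 <= m <= k)%N -> block_sum_space X m k f -> H g ->
  gk f g = (k - m + 1)%:R * inner pi f g.
Proof.
case: m => [|[|n]]// /andP[_ nk] [Hf [h Ih fh]] Hg.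
have HS : H (block_sum n.+2 k h) by apply: (path_space_block_sum chainX) => //; case: Ih.
rewrite (gk_ae chainX k_gt0 reversible gk_cvg _ _ _ Hf HS Hg fh).
rewrite (gk_block_sum chainX reversible k n.+1 isT nk gk_cvg h Ih g Hg).
rewrite (inner_ael pi _ _ _ (path_space_L2 _ _ Hf) (path_space_L2 _ _ HS) (path_space_L2 _ _ Hg) fh).
by congr (_%:R * _); lia.
Qed.

Lemma block_sum_space_ker m f g : (2 <= m <= k)%N -> block_sum_space X m k f -> ker g ->
  inner pi f g = 0.
Proof.
move=> mk Sf /(ker_green_kuboP chainX gk_cvg)[Hg g0]; have Hf := Sf.1.
have := gk_block_sum_space m f g mk Sf Hg.
rewrite (gkC chainX k_gt0 reversible gk_cvg)// g0// => /esym/eqP.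
by rewrite mulf_eq0 pnatr_eq0 addn1 /= => /eqP.
Qed.

Lemma block_sum_space_ortho m m' f g : (2 <= m <= k)%N -> (2 <= m' <= k)%N -> m != m' ->
  block_sum_space X m k f -> block_sum_space X m' k g -> inner pi f g = 0.
Proof.
move=> mk mk' mm' Sf Sg; have Hf := Sf.1; have Hg := Sg.1.
have := gk_block_sum_space m f g mk Sf Hg.
rewrite (gkC chainX k_gt0 reversible gk_cvg)// (gk_block_sum_space m' g f mk' Sg Hf).
rewrite innerC => /eqP; rewrite -subr_eq0 -mulrBl mulf_eq0 subr_eq0 eqr_nat => /orP[|/eqP//].
by move=> /eqP; move: mm' => /eqP; lia.
Qed.

Lemma marginal_block_sum_space m f g : (2 <= m <= k)%N -> M f -> block_sum_space X m k g ->
  inner pi f g = 0.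
Proof.
move=> mk Mf Sg; have Hf := Mf.1; have Hg := Sg.1.
have Lf := path_space_L2 _ _ Hf; have Lg := path_space_L2 _ _ Hg.
apply: (eq0_of_small_sqr _ (inner pi g g)) => e e0.
have [a La fa] := marginal_approx _ _ Mf e0.
set F := (fun x => \sum_(i < k) a i (tnth x i)) in fa.
have HF : H F by exact: (path_space_marg_sum chainX).
have LF := path_space_L2 _ _ HF; have LfF := L2_sub pi _ _ Lf LF.
have Fg : inner pi F g = 0.
  case: m mk Sg => [|[|n]]// /andP[_ nk] [_ [h Ih gh]].
  have HS : H (block_sum n.+2 k h) by apply: (path_space_block_sum chainX) => //; case: Ih.
  rewrite innerC (inner_ael pi _ _ _ Lg (path_space_L2 _ _ HS) LF gh) innerC.
  rewrite (inner_marg_sum chainX)// big_nat big1// => i /andP[_ ik].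
  have ik1 : (i + 1 <= k)%N by rewrite addn1.
  have Hai := path_space_marg chainX _ (La i).
  have Hb : H (marg (a i) \o block i 1 k) by exact: (path_space_block chainX).
  have <- : ev (marg (a i) \o block i 1 k) 0 = ev (marg (a i)) i%:Z by rewrite ev_block// add0r.
  rewrite innerC -(inner_path chainX k 0); [|exact: path_space_measurable HS|exact: path_space_measurable Hb].
  rewrite (inner_block_sum chainX _ _ h _ nk _ Hb); last by case: Ih.
  rewrite big1// => j _; rewrite ev_block// add0r.
  have Lai := path_space_L2 _ _ Hai.
  (* A block of at least two coordinates starts at j. If i <= j, coordinate i precedes the last one
     of the block; otherwise it follows the first one. *)
  have [ij|ji] := leqP i j.
    by apply: (inner_increment_next chainX n.+1 h isT Ih) => //; lia.
  by apply: (inner_increment_prev chainX reversible n.+1 h isT Ih) => //; lia.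
have -> : inner pi f g = inner pi (fun x => f x - F x) g by rewrite innerBl// Fg subr0.
apply: le_trans (inner_cauchy_schwarz pi _ _ LfF Lg) _.
by rewrite ler_wpM2r ?inner_ge0// ltW.
Qed.

Lemma marginal_plus_subspace : linear_subspace H Mplus.
Proof.
split.
- by move=> f [[]].
- split; last by move=> g _; exact: inner0l.
  have L0 i : L20 nu ((fun _ : nat => cst 0) i) by exact: L20_cst0.
  have := marginal_space_sum (fun=> cst 0) L0.
  by congr (M _); apply/funext => x; rewrite big1.
- move=> t f g [Mf fK] [Mg gK]; split; first exact: marginal_space_comb.
  move=> u Ku; have Lu := path_space_L2 _ _ Ku.1.1.
  have Lf := path_space_L2 _ _ Mf.1; have Lg := path_space_L2 _ _ Mg.1.
  rewrite innerDl ?innerZl ?fK ?gK ?mulr0 ?addr0//; exact: L2_scale.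
Qed.

Lemma block_sum_space_subspace m : (2 <= m <= k)%N -> linear_subspace H (block_sum_space X m k).
Proof.
case: m => [|m]// /andP[m2 mk]; split.
- by move=> f [].
- split; first exact: (path_space0 chainX).
  exists (cst 0); last by apply: aeW => x _; rewrite big1.
  apply/(incremental_spaceP chainX); split; first exact: (path_space0 chainX).
    by move=> g _; exact: inner0l.
  by move=> g _; exact: inner0l.
- move=> t f g [Hf [h Ih fh]] [Hg [h' Ih' gh']]; split; first exact: (path_space_comb chainX).
  exists (fun x => t * h x + h' x); first exact: (incremental_comb chainX).
  by apply: filterS2 fh gh' => x fx gx _; rewrite fx// gx// big_split/= mulr_sumr.
Qed.

Lemma ker_subspace : linear_subspace H ker.
Proof.
split.
- by move=> f [].
- exact: (ker0 chainX k_gt0 reversible gk_cvg).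
- by move=> t f g kf kg; exact: (ker_comb chainX k_gt0 reversible gk_cvg).
Qed.

Hypothesis invertible : invertible_on nu (L20 nu)
  (fun h x => h x - kernel_op K (kernel_op K h) x).

Lemma block_block i m n j (x : k.-tuple E) : (i + m <= n)%N ->
  block i m n (block j n k x) = block (j + i) m k x.
Proof.
move=> imn; apply: eq_from_tnth => l; have lm := ltn_ord l.
have iln : (i + l < n)%N by lia.
by rewrite !tnth_mktuple (nth_mktuple _ _ (Ordinal iln))/= addnA.
Qed.

(** The identity holds at every x, because each replacement modulo ker B_k is recorded exactly in
    f0. *)
Lemma exists_decomposition n (F : n.+1.-tuple E -> R) : (n < k)%N -> path_space X n.+1 F ->
  exists fm fb f0, [/\ Mplus fm,
    forall m, (2 <= m <= n.+1)%N -> block_sum_space X m k (fb m), ker f0 &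
    forall x, F (block 0 n.+1 k x) = fm x + \sum_(2 <= m < n.+2) fb m x + f0 x].
Proof.
elim: n F => [|n IH] F nk HF.
  have La := L20_of_path_space chainX F HF.
  have [c Lc kc] := exists_marg_range _ La.
  exists (mrange c), (fun=> cst 0), (fun x => marg (fun y => F [tuple y]) (block 0 1 k x) - mrange c x).
  split => //; first exact: marginal_plus_range.
    by move=> m; case: m => [|[|m]].
  by move=> x; rewrite big_geq// addr0 -margE addrC subrK.
have [l [r [Hl Hr Ih]]] := split_increment chainX reversible invertible n F HF.
set h := (fun x => _) in Ih.
have Hh : path_space X n.+2 h by case: Ih.
have [fm [fb [f0 [Mfm Sfb kf0 lrE]]]] := IH _ (ltnW nk) (path_spaceD chainX _ _ _ Hl Hr).
have HS : H (block_sum n.+2 k h) by exact: (path_space_block_sum chainX).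
have N0 : (k - n.+1)%:R != 0 :> R by rewrite pnatr_eq0; lia.
(* The increment is replaced by its block sum divided by the eigenvalue k - (n + 2) + 1. The terms
   added to f0 are the costs of shifting r to the first coordinate and of this replacement. *)
exists fm, (fun m => if m == n.+2 then (fun x => (k - n.+1)%:R^-1 * block_sum n.+2 k h x) else fb m),
  (fun x => f0 x + (r (block 1 n.+1 k x) - r (block 0 n.+1 k x)) +
     - (k - n.+1)%:R^-1 * (block_sum n.+2 k h x - (k - n.+1)%:R * h (block 0 n.+2 k x))).
split => //.
- move=> m /andP[m2 mn]; case: eqP => [->|/eqP mn2]; last by apply: Sfb; lia.
  split; first exact: (path_spaceZ chainX).
  (* This is h / (k - n - 1), written in the form a * f + g of [incremental_comb]. *)
  exists (fun x => ((k - n.+1)%:R^-1 - 1) * h x + h x); first exact: (incremental_comb chainX).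
  by apply: aeW => x _; rewrite /block_sum mulr_sumr; apply: eq_bigr => i _; ring.
- apply: (kerD chainX k_gt0 reversible gk_cvg).
    apply: (kerD chainX k_gt0 reversible gk_cvg) => //.
    exact: (ker_shift chainX k_gt0 reversible gk_cvg).
  apply: (kerZ chainX k_gt0 reversible gk_cvg).
  exact: (ker_block_sum chainX reversible k n.+1 isT nk gk_cvg h Ih).
- move=> x; rewrite big_nat_recr//= eqxx.
  rewrite (eq_big_nat _ _ (F2 := fun m => fb m x)); last first.
    by move=> m /andP[_ mn]; rewrite ltn_eqF.
  have := lrE x.
  have FE : F (block 0 n.+2 k x) = l (block 0 n.+1 k x) + r (block 1 n.+1 k x) + h (block 0 n.+2 k x).
    by rewrite /h !block_block// !add0n; ring.
  rewrite FE; move: (\sum_(_ <= _ < _) _) => s lrx.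
  have -> : l (block 0 n.+1 k x) = fm x + s + f0 x - r (block 0 n.+1 k x) by rewrite -lrx addrK.
  by field.
Qed.

Lemma decomposition_ex f : H f -> exists fm fb f0, decomposition X nu K k f fm fb f0.
Proof.
move=> Hf; have kE : k.-1.+1 = k by rewrite prednK.
have kk : (0 + k <= k.-1.+1)%N by rewrite kE.
have [|fm [fb [f0 [Mfm Sfb kf0 fE]]]] :=
  exists_decomposition k.-1 (f \o block 0 k k.-1.+1) _ (path_space_block chainX 0 k k.-1.+1 f kk Hf).
  by rewrite kE.
exists fm, fb, f0; split=> //; first by move=> m; rewrite -{1}kE; exact: Sfb.
apply: aeW => x _; have := fE x.
by rewrite /= block_block// addn0 block_id kE.
Qed.

(** * The summands as an indexed list *)

Definition summands : seq (set (k.-tuple E -> R)) :=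
  Mplus :: [seq block_sum_space X m k | m <- index_iota 2 k.+1] ++ [:: ker].

(** Position 0 holds the marginal part, position k the kernel part, and a position i in between the
    part of block length i + 1. *)
Definition component (fm : k.-tuple E -> R) (fb : nat -> k.-tuple E -> R) f0 i :=
  if i == 0%N then fm else if i == k then f0 else fb i.+1.

Lemma size_summands : size summands = k.+1.
Proof. by rewrite /= size_cat size_map size_iota/=; lia. Qed.

Lemma nth_block_sum_space i : (0 < i < k)%N ->
  nth set0 summands i = block_sum_space X i.+1 k.
Proof.
case: i => // i /= ik; have ik2 : (i < k.+1 - 2)%N by lia.
by rewrite nth_cat size_map size_iota ik2 (nth_map 0%N) ?size_iota// nth_iota.
Qed.

Lemma nth_ker : nth set0 summands k = ker.
Proof.
have -> : nth set0 summands k = nth set0 (behead summands) k.-1 by rewrite nth_behead prednK.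
rewrite /summands [behead _]/=.
rewrite nth_cat size_map size_iota.
have -> : (k.-1 < k.+1 - 2)%N = false by apply/negbTE; rewrite -leqNgt; lia.
by have -> : (k.-1 - (k.+1 - 2))%N = 0%N by lia.
Qed.

Lemma summandsP i : (i < k.+1)%N ->
  [\/ i = 0%N, (0 < i < k)%N | i = k].
Proof.
move=> ik; case: (posnP i) => [|i0]; first by constructor 1.
by have [ik'|ki] := ltnP i k; [constructor 2|constructor 3; lia].
Qed.

Lemma summands_ortho i j f g : (i < j < k.+1)%N ->
  nth set0 summands i f -> nth set0 summands j g -> inner pi f g = 0.
Proof.
move=> /andP[ij jk]; have := summandsP _ jk; have := summandsP _ (ltn_trans ij jk).
move=> [i0|ik|ik] [j0|jk'|jk']; try lia.
- rewrite i0 (nth_block_sum_space j)// => -[Mf _].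
  by apply: marginal_block_sum_space => //; lia.
- by rewrite i0 jk' nth_ker; exact: marginal_plus_ker.
- by rewrite !nth_block_sum_space//; apply: block_sum_space_ortho; lia.
- by rewrite jk' nth_ker nth_block_sum_space//; apply: block_sum_space_ker; lia.
Qed.

Lemma nth_component fm fb f0 i : (i < k.+1)%N -> Mplus fm ->
  (forall m, (2 <= m <= k)%N -> block_sum_space X m k (fb m)) -> ker f0 ->
  nth set0 summands i (component fm fb f0 i).
Proof.
move=> ik Mfm Sfb kf0; case: (summandsP _ ik) => [->//|ik'|->].
  rewrite nth_block_sum_space// /component gtn_eqF ?ltn_eqF//; last lia.
    by apply: Sfb; lia.
  by lia.
by rewrite nth_ker /component eqxx gtn_eqF.
Qed.

Lemma sum_component fm fb f0 x :
  \sum_(i < k.+1) component fm fb f0 i x = fm x + \sum_(2 <= m < k.+1) fb m x + f0 x.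
Proof.
rewrite -(big_mkord xpredT (fun i => component fm fb f0 i x)) big_nat_recr// big_ltn//.
have -> : component fm fb f0 k x = f0 x by rewrite /component eqxx gtn_eqF.
rewrite [in RHS]big_add1; congr (_ + _ + _); apply: eq_big_nat => i ik.
by rewrite /component gtn_eqF ?ltn_eqF//; lia.
Qed.

Lemma direct_sum_summands : orthogonal_direct_sum pi H summands.
Proof.
split; rewrite ?size_summands.
- move=> i /summandsP[->|ik|->]; first exact: marginal_plus_subspace.
    by rewrite nth_block_sum_space//; apply: block_sum_space_subspace; lia.
  by rewrite nth_ker; exact: ker_subspace.
- move=> i j ik jk ij f g fi gj; have [ltij|ltji|eij] := ltngtP i j.
  + by apply: (summands_ortho i j) => //; rewrite ltij.
  + by rewrite innerC; apply: (summands_ortho j i) => //; rewrite ltji.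
  + by rewrite eij eqxx in ij.
- move=> f /decomposition_ex[fm [fb [f0 [Mfm Sfb kf0 fE]]]].
  exists (component fm fb f0); first by move=> i ik; exact: nth_component.
  by apply: filterS fE => x fx _; rewrite fx// sum_component.
Qed.

End decomposition.

Theorem theorem3p11
    (R : realType)
    (d : measure_display) (E : measurableType d)
    (nu : probability E R) (K : R.-pker E ~> E)
    (d' : measure_display) (Omega : measurableType d')
    (P : probability Omega R) (X : int -> {RV P >-> E})
    (k : nat)
    (chainX : stationary_markov_chain X nu K)
    (k_ge2 : (2 <= k)%N)
    (reversible : self_adjoint nu (L2 nu) (kernel_op K))
    (invertible : invertible_on nu (L20 nu)
       (fun h x => h x - kernel_op K (kernel_op K h) x))
    (gk_cvg : green_kubo_cvg X K k) :
  orthogonal_direct_sum (path_law X k) (path_space X k)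
    (marginal_plus X nu K k
       :: [seq block_sum_space X m k | m <- index_iota 2 k.+1]
       ++ [:: ker_green_kubo X K k]) /\
  (forall f, path_space X k f ->
     (exists fmarg fblk f0, decomposition X nu K k f fmarg fblk f0) /\
     (forall fmarg fblk f0 fmarg' fblk' f0',
        decomposition X nu K k f fmarg fblk f0 ->
        decomposition X nu K k f fmarg' fblk' f0' ->
        [/\ fmarg = fmarg' %[ae path_law X k],
            forall m, (2 <= m <= k)%N -> fblk m = fblk' m %[ae path_law X k] &
            f0 = f0' %[ae path_law X k] ])).
Proof.
have HL : path_space X k `<=` L2 (path_law X k) by move=> f [].
have dsum := direct_sum_summands chainX k_ge2 reversible gk_cvg invertible.
split=> // f Hf; split.
  exact: decomposition_ex chainX k_ge2 reversible gk_cvg invertible f Hf.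
move=> fm fb f0 fm' fb' f0' [Mfm Sfb kf0 fE] [Mfm' Sfb' kf0' fE'].
have eqc : forall i, (i < k.+1)%N ->
    component fm fb f0 i = component fm' fb' f0' i %[ae path_law X k].
  have := orthogonal_direct_sum_uniq (path_law X k) _ _
    (component fm fb f0) (component fm' fb' f0') HL dsum.
  rewrite (size_summands k_ge2); apply.
  - by move=> i ik; exact: (nth_component k_ge2).
  - by move=> i ik; exact: (nth_component k_ge2).
  - apply: filterS2 fE fE' => x /(_ Logic.I) fx /(_ Logic.I) fx' _.
    by rewrite !sum_component// -fx.
have k0 : (k == 0)%N = false by rewrite gtn_eqF// (leq_trans _ k_ge2).
split.
- exact: eqc 0%N isT.
- move=> m /andP[m2 mk]; have := eqc m.-1 ltac:(lia).
  (* Block length m sits at position m - 1; the identity is rewritten once for each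
     decomposition. *)
  have -> g g0 h0 : component g g0 h0 m.-1 = g0 m :> (k.-tuple E -> R).
    by rewrite /component gtn_eqF ?ltn_eqF ?prednK//; lia.
  have -> g g0 h0 : component g g0 h0 m.-1 = g0 m :> (k.-tuple E -> R).
    by rewrite /component gtn_eqF ?ltn_eqF ?prednK//; lia.
  by [].
- by have := eqc k (ltnSn k); rewrite /component k0 eqxx.
Qed.
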